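(* There is an algorithm which, given as input two regular languages $L_1,L_2\subseteq A^*$ over a finite alphabet $A$, decides whether $L_1$ is $\Sigma_2(<,+1,\min,\max)$-separable from $L_2$. Likewise, there is an algorithm which, given the same input, decides whether $L_1$ is $\Pi_2(<,+1,\min,\max)$-separable from $L_2$.
   Context: Words over $A$ (including the empty word) are viewed as logical structures with positions labeled by letters of $A$. $\mathrm{FO}(<,+1,\min,\max)$ is first-order logic with the unary predicates $P_a$ ($a\in A$; ''position $x$ carries letter $a$''), the binary predicate $<$ (linear order on positions), the binary predicate $y=x+1$ (''$y$ is the successor of $x$''), and the unary predicates $\min(x)$, $\max(x)$ (''$x$ is the first, resp. last, position''). A formula of this logic is $\Sigma_2$ (resp. $\Pi_2$) if its prenex normal form has either exactly two quantifier blocks, the first one existential (resp. universal), or at most one quantifier block. The corresponding classes of languages consist of the languages defined by such sentences. For a class $\mathcal C$ of languages, $L_1$ is $\mathcal C$-separable from $L_2$ if there is $K\in\mathcal C$ with $L_1\subseteq K$ and $K\cap L_2=\emptyset$. Regular languages are given as input by any standard finite representation (e.g. finite automata). *)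

(* Defs.v *)
(* A language over A is a boolean predicate on [seq A], and the positions of a
   word [w] are the ordinals ['I_(size w)]. *)
From HB Require Import structures.
From mathcomp Require Import all_boot.

Set Implicit Arguments.
Unset Strict Implicit.
Unset Printing Implicit Defensive.

(** * The logic FO(<,+1,min,max) on words *)

(* Well-scoped de Bruijn syntax: [formula A n] has its free variables in ['I_n]
   and a quantifier binds the variable [ord0] of its body, so that
   [formula A 0] is the type of sentences. *)
Inductive formula (A : Type) (n : nat) : Type :=
| FTrue
| FFalse
| FLetter of A & 'I_n
| FEq of 'I_n & 'I_n
| FLt of 'I_n & 'I_n
| FSucc of 'I_n & 'I_n        (* FSucc x y : y = x + 1 *)
| FMin of 'I_n
| FMax of 'I_n
| FNot of formula A n
| FAnd of formula A n & formula A n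
| FOr of formula A n & formula A n
| FEx of formula A n.+1
| FAll of formula A n.+1.

Definition extend (T : Type) (n : nat) (x : T) (e : 'I_n -> T) : 'I_n.+1 -> T :=
  fun i => oapp e x (unlift ord0 i).

Fixpoint sat (A : eqType) (w : seq A) (n : nat) (phi : formula A n) :
    ('I_n -> 'I_(size w)) -> bool :=
  match phi with
  | FTrue => fun _ => true
  | FFalse => fun _ => false
  | FLetter a x => fun e => tnth (in_tuple w) (e x) == a
  | FEq x y => fun e => e x == e y
  | FLt x y => fun e => e x < e y
  | FSucc x y => fun e => e y == (e x).+1 :> nat
  | FMin x => fun e => e x == 0 :> nat
  | FMax x => fun e => (e x).+1 == size w
  | FNot f => fun e => ~~ sat f e
  | FAnd f g => fun e => sat f e && sat g e
  | FOr f g => fun e => sat f e || sat g e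
  | FEx f => fun e => [exists x, sat f (extend x e)]
  | FAll f => fun e => [forall x, sat f (extend x e)]
  end.

Definition no_var (T : Type) (i : 'I_0) : T :=
  False_rect T (notF (ltn_ord i)).

Definition models (A : eqType) (phi : formula A 0) : pred (seq A) :=
  fun w => sat phi (@no_var 'I_(size w)).

(** * Prenex normal forms and quantifier blocks *)

Fixpoint quantifier_free (A : Type) (n : nat) (phi : formula A n) : bool :=
  match phi with
  | FNot f => quantifier_free f
  | FAnd f g | FOr f g => quantifier_free f && quantifier_free g
  | FEx _ | FAll _ => false
  | _ => true
  end.

Fixpoint prenex (A : Type) (n : nat) (phi : formula A n) : bool :=
  match phi with
  | FEx f => prenex f
  | FAll f => prenex f
  | f => quantifier_free f
  end.

Inductive quantifier := Existential | Universal.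

Definition dual (q : quantifier) : quantifier :=
  if q is Existential then Universal else Existential.

Definition add_quantifier (q : quantifier) (bs : seq quantifier) :=
  match q, bs with
  | Existential, Existential :: _ | Universal, Universal :: _ => bs
  | _, _ => q :: bs
  end.

(* The maximal blocks of the quantifier prefix, from the outside in. *)
Fixpoint blocks (A : Type) (n : nat) (phi : formula A n) : seq quantifier :=
  match phi with
  | FEx f => add_quantifier Existential (blocks f)
  | FAll f => add_quantifier Universal (blocks f)
  | _ => [::]
  end.

(* As usual in first-order logic, a formula and its prenex normal form are
   equivalent on nonempty structures: pulling a quantifier out of a
   disjunction or a conjunction is not sound on the empty word. The language
   of a sentence is still computed from the sentence itself, on every word, so
   that e.g. "(exists x, P_a x) or (forall x, false)" is a Sigma_2 sentence,
   with prenex normal form "exists x, forall y, P_a x or false", and defines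
   A* a A* together with the empty word. *)
Definition prenex_normal_form (A : eqType) (n : nat) (phi psi : formula A n) :=
  prenex psi /\
  forall (w : seq A) (e : 'I_n -> 'I_(size w)), w <> [::] ->
    sat phi e = sat psi e.

Definition level2 (q : quantifier) (A : eqType) (n : nat) (phi : formula A n) :=
  exists2 psi, prenex_normal_form phi psi &
    blocks psi = [:: q; dual q] \/ size (blocks psi) <= 1.

Definition Sigma2 (A : eqType) (n : nat) (phi : formula A n) :=
  level2 Existential phi.
Definition Pi2 (A : eqType) (n : nat) (phi : formula A n) :=
  level2 Universal phi.

Definition Sigma2_language (A : eqType) (K : pred (seq A)) : Prop :=
  exists2 phi : formula A 0, Sigma2 phi & K =1 models phi.
Definition Pi2_language (A : eqType) (K : pred (seq A)) : Prop :=
  exists2 phi : formula A 0, Pi2 phi & K =1 models phi.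

(** * Separation *)

Definition separable (A : Type) (C : pred (seq A) -> Prop)
    (L1 L2 : pred (seq A)) : Prop :=
  exists K, [/\ C K, forall w, L1 w -> K w & forall w, ~~ (K w && L2 w)].

(** * Nondeterministic finite automata *)

(* States are natural numbers; only the finitely many that are listed matter.
   A transition is a triple (source, letter, target). *)
Record nfa (A : Type) := Nfa {
  initials : seq nat;
  finals : seq nat;
  transitions : seq (nat * A * nat) }.

Fixpoint accepts_from (A : eqType) (M : nfa A) (p : nat) (w : seq A) : bool :=
  if w is a :: w' then
    has (fun t => [&& t.1.1 == p, t.1.2 == a & accepts_from M t.2 w'])
        (transitions M)
  else p \in finals M.

Definition nfa_language (A : eqType) (M : nfa A) : pred (seq A) :=
  fun w => has (fun p => accepts_from M p w) (initials M).

(** * Algorithms: mu-recursive programs *)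

Inductive program : Type :=
| PZero
| PSucc
| PProj of nat
| PComp of program & seq program
| PRec of program & program
| PMu of program.

(* [eval p xs y]: program [p] halts on the arguments [xs] with result [y]. *)
Inductive eval : program -> seq nat -> nat -> Prop :=
| eval_zero xs : eval PZero xs 0
| eval_succ x : eval PSucc [:: x] x.+1
| eval_proj i xs : i < size xs -> eval (PProj i) xs (nth 0 xs i)
| eval_comp f gs xs ys y :
    evals gs xs ys -> eval f ys y -> eval (PComp f gs) xs y
| eval_rec0 f g xs y : eval f xs y -> eval (PRec f g) (0 :: xs) y
| eval_recS f g n xs r y :
    eval (PRec f g) (n :: xs) r -> eval g [:: n, r & xs] y ->
    eval (PRec f g) (n.+1 :: xs) y
| eval_mu f xs n (v : nat -> nat) :
    (forall m, m < n -> eval f (m :: xs) (v m).+1) ->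
    eval f (n :: xs) 0 -> eval (PMu f) xs n
with evals : seq program -> seq nat -> seq nat -> Prop :=
| evals_nil xs : evals [::] xs [::]
| evals_cons g gs xs y ys :
    eval g xs y -> evals gs xs ys -> evals (g :: gs) xs (y :: ys).

Definition algorithmically_decidable (T : Type) (encode : T -> seq nat)
    (P : T -> Prop) : Prop :=
  exists p : program, forall x : T,
    (P x -> eval p (encode x) 1) /\ (~ P x -> eval p (encode x) 0).

(* [CodeSeq.code] is the library's effective bijection from [seq nat] to
   [nat]. *)
Definition encode_transition (k : nat) (t : nat * 'I_k * nat) : nat :=
  CodeSeq.code [:: t.1.1; val t.1.2; t.2].

Definition encode_nfa (k : nat) (M : nfa 'I_k) : nat :=
  CodeSeq.code [:: CodeSeq.code (initials M); CodeSeq.code (finals M);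
                   CodeSeq.code (map (@encode_transition k) (transitions M))].

(* The alphabet, ['I_k] without loss of generality, is part of the input. *)
Record separation_input := SeparationInput {
  alphabet_size : nat;
  automaton1 : nfa 'I_alphabet_size;
  automaton2 : nfa 'I_alphabet_size }.

Definition encode_input (x : separation_input) : seq nat :=
  [:: alphabet_size x; encode_nfa (automaton1 x); encode_nfa (automaton2 x)].

(* Main.v *)
(* Two preorders carry the proof. On words over the alphabet, w <= w' when the
   duplicator wins one round with n pebbles on w followed by one round with m
   pebbles on w'; a language is Sigma_2(<,+1,min,max) if and only if it is
   upward closed for some n and m, hence L1 is separable from L2 if and only
   if, for some n and m, no word of L1 is below a word of L2. On words over a
   finite alphabet of letters (f, s, g), where s is a value in the finite
   monoid recognizing L1 and L2 and f, g are idempotents, the order alone is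
   used. Cutting a word wherever its left context, of bounded length, is
   stabilized by an idempotent reduces the first preorder to the second one;
   replacing each f by a long power of a word of value f goes back, since few
   pebbles leave a copy free where the runs can be cut.

   For the order alone, consider the least set of facts (B, s, T), with B a set
   of letters, s a value and T a set of values, that contains the letters and
   is closed under product and, for idempotent e and E, under the passage from
   (B, e, E) to (B, e, E B* E). If (B, s, T) is such a fact then words of value
   s lie, for every n and m, below words of each value in T. Conversely, by
   factorization forests, every word of value s belongs to a monomial
   B1* b1 ... Br* br of bounded length with all its values in T, for some fact
   (B, s, T) of any set of facts with these closure properties. So separability
   amounts to the existence of a closed set of facts that relates no value of
   L1 to a value of L2. This is a search among finitely many sets, coded by
   bit masks and expressed in bounded arithmetic. Pi_2 follows by
   complementation. *)

Require Import Defs.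
From HB Require Import structures.
From mathcomp Require Import all_boot.
From mathcomp Require Import boolp zify.

Set Implicit Arguments.
Unset Strict Implicit.
Unset Printing Implicit Defensive.

(** The obstacle is the successor: neighbouring pebbles must be answered by neighbours, whereas the
    order alone tolerates gaps. When two letters are separated by more copies of a loop than there
    are pebbles, the border between them can be placed so that no pebble stands just after it, and
    no successor pair crosses it; the copies being equal, moving the border does not change the
    word. The criterion asks for a certificate instead of computing a least fixed point. For
    soundness, any set of values that contains the letters and is closed under product will do, and
    the facts may exceed the least ones. Hence the idempotent rule asks for some [T] that includes
    [E B* E], checked locally through a set [W] that includes [E] and is stable under [B] on the
    right. For completeness, the values of nonempty words and the realizable facts form a
    certificate. Letters [(f, s, g)] compose only when their ends match; matrices with a single
    nonzero block turn this partial product into a monoid of relations with a zero. The empty word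
    is treated apart, because prenex forms constrain a language only on nonempty words. *)

(** * Arithmetic and binary digits as recursive programs *)

Lemma evals_map (gs : seq program) (xs ys : seq nat) :
  size gs = size ys ->
  (forall i, i < size gs -> eval (nth PZero gs i) xs (nth 0 ys i)) ->
  evals gs xs ys.
Proof.
elim: gs ys => [|g gs IH] [|y ys] //= => [_ _|[sz] H]; first exact: evals_nil.
by apply: evals_cons; [exact: (H 0) | apply: IH => // i; apply: (H i.+1)].
Qed.

Definition projs (i n : nat) : seq program := map PProj (iota i n).

Lemma evals_projs (e0 e : seq nat) :
  evals (projs (size e0) (size e)) (e0 ++ e) e.
Proof.
apply: evals_map => [|i]; rewrite /projs size_map size_iota // => ilt.
rewrite (nth_map 0) ?size_iota // nth_iota //.
have -> : nth 0 e i = nth 0 (e0 ++ e) (size e0 + i).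
  by rewrite nth_cat ltnNge leq_addr /= addKn.
by apply: eval_proj; rewrite size_cat ltn_add2l.
Qed.

Definition p_add := PRec (PProj 0) (PComp PSucc [:: PProj 1]).
Definition p_mul := PRec PZero (PComp p_add [:: PProj 1; PProj 2]).
Definition p_one := PComp PSucc [:: PZero].
Definition p_exp2 := PRec p_one (PComp p_add [:: PProj 1; PProj 1]).
Definition p_pred := PRec PZero (PProj 0).
(** Recursion runs on the first argument, so the arguments [x], [y] give [y - x]; [p_not] and [p_le]
    order theirs accordingly. *)
Definition p_sub := PRec (PProj 0) (PComp p_pred [:: PProj 1]).
Definition p_not := PComp p_sub [:: PProj 0; p_one].
Definition p_le := PComp p_not [:: PComp p_sub [:: PProj 1; PProj 0]].

Definition p_odd := PRec PZero (PComp p_not [:: PProj 1]).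
Definition p_half :=
  PRec PZero (PComp p_add [:: PComp p_odd [:: PProj 0]; PProj 1]).
Definition p_shift := PRec (PProj 0) (PComp p_half [:: PProj 1]).
Definition p_bit := PComp p_odd [:: PComp p_shift [:: PProj 1; PProj 0]].

Lemma eval_comp1 f g xs y z :
  eval g xs y -> eval f [:: y] z -> eval (PComp f [:: g]) xs z.
Proof.
by move=> gy fz; apply: eval_comp fz; apply: evals_cons gy (evals_nil _).
Qed.

Lemma eval_comp2 f g h xs y z t :
  eval g xs y -> eval h xs z -> eval f [:: y; z] t ->
  eval (PComp f [:: g; h]) xs t.
Proof.
move=> gy hz ft; apply: eval_comp ft.
exact: evals_cons gy (evals_cons hz (evals_nil _)).
Qed.

Lemma eval_add x y : eval p_add [:: x; y] (x + y).
Proof.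
elim: x => [|x IH]; first by apply: eval_rec0; apply: (@eval_proj 0 [:: y]).
apply: eval_recS IH _; apply: eval_comp1 (eval_succ _).
exact: (@eval_proj 1 [:: x; x + y; y]).
Qed.

Lemma eval_mul x y : eval p_mul [:: x; y] (x * y).
Proof.
elim: x => [|x IH]; first by apply: eval_rec0; apply: eval_zero.
apply: eval_recS IH _; rewrite mulSn addnC; apply: eval_comp2 (eval_add _ _).
  exact: (@eval_proj 1 [:: x; x * y; y]).
exact: (@eval_proj 2 [:: x; x * y; y]).
Qed.

Lemma eval_one xs : eval p_one xs 1.
Proof. by apply: eval_comp1 (eval_zero _) (eval_succ _). Qed.

Lemma eval_exp2 x : eval p_exp2 [:: x] (2 ^ x).
Proof.
elim: x => [|x IH]; first by apply: eval_rec0; apply: eval_one.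
apply: eval_recS IH _; rewrite expnS mul2n -addnn.
by apply: eval_comp2 (eval_add _ _); apply: (@eval_proj 1 [:: x; 2 ^ x]).
Qed.

Lemma eval_pred x : eval p_pred [:: x] x.-1.
Proof.
elim: x => [|x IH]; first by apply: eval_rec0; apply: eval_zero.
by apply: eval_recS IH _; apply: (@eval_proj 0 [:: x; x.-1]).
Qed.

Lemma eval_sub x y : eval p_sub [:: x; y] (y - x).
Proof.
elim: x => [|x IH].
  by apply: eval_rec0; rewrite subn0; apply: (@eval_proj 0 [:: y]).
apply: eval_recS IH _; rewrite subnS; apply: eval_comp1 (eval_pred _).
exact: (@eval_proj 1 [:: x; y - x; y]).
Qed.

Lemma eval_not (b : bool) : eval p_not [:: b : nat] (~~ b).
Proof.
have -> : ~~ b = 1 - b :> nat by case: b.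
apply: eval_comp2 (eval_one _) (eval_sub _ _).
exact: (@eval_proj 0 [:: b : nat]).
Qed.

Lemma eval_le x y : eval p_le [:: x; y] (x <= y).
Proof.
have -> : (x <= y) = ~~ (0 < x - y) by rewrite lt0n negbK subn_eq0.
have -> : nat_of_bool (~~ (0 < x - y)) = 1 - (x - y).
  by case: (x - y) => // n; rewrite subSS sub0n.
apply: eval_comp1; last first.
  apply: (eval_comp2 _ (eval_one _) (eval_sub _ _)).
  exact: (@eval_proj 0 [:: x - y]).
apply: eval_comp2 (eval_sub _ _).
  exact: (@eval_proj 1 [:: x; y]).
exact: (@eval_proj 0 [:: x; y]).
Qed.

Lemma eval_odd x : eval p_odd [:: x] (odd x).
Proof.
elim: x => [|x IH]; first by apply: eval_rec0; apply: eval_zero.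
apply: eval_recS IH _; apply: eval_comp1 (eval_not _).
exact: (@eval_proj 1 [:: x; nat_of_bool (odd x)]).
Qed.

Lemma eval_half x : eval p_half [:: x] x./2.
Proof.
elim: x => [|x IH]; first by apply: eval_rec0; apply: eval_zero.
apply: eval_recS IH _; have -> : x.+1./2 = odd x + x./2 by rewrite /= uphalf_half.
apply: eval_comp2 (eval_add _ _); last exact: (@eval_proj 1 [:: x; x./2]).
by apply: eval_comp1 (eval_odd _); apply: (@eval_proj 0 [:: x; x./2]).
Qed.

Definition bit (x i : nat) : bool := odd (iter i half x).

Lemma eval_bit x i : eval p_bit [:: x; i] (bit x i).
Proof.
apply: eval_comp1 (eval_odd _); apply: (@eval_comp2 _ _ _ _ i x).
- exact: (@eval_proj 1 [:: x; i]).
- exact: (@eval_proj 0 [:: x; i]).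
elim: i => [|i IH]; first by apply: eval_rec0; apply: (@eval_proj 0 [:: x]).
apply: eval_recS IH _; apply: eval_comp1 (eval_half _).
exact: (@eval_proj 1 [:: i; iter i half x; x]).
Qed.

(** * Bounded arithmetic *)

Inductive term :=
| TVar of nat
| TZero
| TSucc of term
| TAdd of term & term
| TMul of term & term
| TExp2 of term.

Fixpoint term_value (t : term) (e : seq nat) : nat :=
  match t with
  | TVar i => nth 0 e i
  | TZero => 0
  | TSucc t => (term_value t e).+1
  | TAdd t u => term_value t e + term_value u e
  | TMul t u => term_value t e * term_value u e
  | TExp2 t => 2 ^ term_value t e
  end.

(* [BAll] and [BEx] bind the variable 0; [BSub f ts] is the simultaneous substitution
   of the terms [ts] for the variables of [f]. *)
Inductive bform :=
| BLe of term & term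
| BEq of term & term
| BBit of term & term
| BNot of bform
| BAnd of bform & bform
| BOr of bform & bform
| BImp of bform & bform
| BIff of bform & bform
| BAll of term & bform
| BEx of term & bform
| BSub of bform & seq term.

Fixpoint bholds (f : bform) (e : seq nat) : Prop :=
  match f with
  | BLe t u => term_value t e <= term_value u e
  | BEq t u => term_value t e = term_value u e
  | BBit t u => bit (term_value t e) (term_value u e)
  | BNot f => ~ bholds f e
  | BAnd f g => bholds f e /\ bholds g e
  | BOr f g => bholds f e \/ bholds g e
  | BImp f g => bholds f e -> bholds g e
  | BIff f g => bholds f e <-> bholds g e
  | BAll t f => forall x, x < term_value t e -> bholds f (x :: e)
  | BEx t f => exists2 x, x < term_value t e & bholds f (x :: e)
  | BSub f ts => bholds f [seq term_value t e | t <- ts]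
  end.

Fixpoint tprog (n : nat) (t : term) : program :=
  match t with
  | TVar i => if i < n then PProj i else PZero
  | TZero => PZero
  | TSucc t => PComp PSucc [:: tprog n t]
  | TAdd t u => PComp p_add [:: tprog n t; tprog n u]
  | TMul t u => PComp p_mul [:: tprog n t; tprog n u]
  | TExp2 t => PComp p_exp2 [:: tprog n t]
  end.

Lemma eval_tprog t e : eval (tprog (size e) t) e (term_value t e).
Proof.
elim: t => /= [i||t IH|t IHt u IHu|t IHt u IHu|t IH].
- case: ltnP => [|le_i]; first exact: eval_proj.
  by rewrite nth_default //; apply: eval_zero.
- exact: eval_zero.
- exact: eval_comp1 IH (eval_succ _).
- exact: eval_comp2 IHt IHu (eval_add _ _).
- exact: eval_comp2 IHt IHu (eval_mul _ _).
- exact: eval_comp1 IH (eval_exp2 _).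
Qed.

Definition pneg p := PComp p_not [:: p].
Definition pand p q := PComp p_mul [:: p; q].
Definition pimp p q := pneg (pand p (pneg q)).
(** A bounded universal quantifier is a product of truth values, by recursion on the bound. In the
    recursion step the arguments are the counter, the product so far and, from index 2 on, the
    environment. *)
Definition pall n t p :=
  PComp (PRec p_one
           (PComp p_mul [:: PProj 1; PComp p (PProj 0 :: projs 2 n)]))
        (t :: projs 0 n).

Fixpoint bprog (n : nat) (f : bform) : program :=
  match f with
  | BLe t u => PComp p_le [:: tprog n t; tprog n u]
  | BEq t u => pand (PComp p_le [:: tprog n t; tprog n u])
                    (PComp p_le [:: tprog n u; tprog n t])
  | BBit t u => PComp p_bit [:: tprog n t; tprog n u]
  | BNot f => pneg (bprog n f)
  | BAnd f g => pand (bprog n f) (bprog n g)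
  | BOr f g => pimp (pneg (bprog n f)) (bprog n g)
  | BImp f g => pimp (bprog n f) (bprog n g)
  | BIff f g => pand (pimp (bprog n f) (bprog n g)) (pimp (bprog n g) (bprog n f))
  | BAll t f => pall n (tprog n t) (bprog n.+1 f)
  | BEx t f => pneg (pall n (tprog n t) (pneg (bprog n.+1 f)))
  | BSub f ts => PComp (bprog (size ts) f) (map (tprog n) ts)
  end.

Lemma eval_pneg p e P : eval p e `[< P >] -> eval (pneg p) e `[< ~ P >].
Proof. by rewrite asbool_neg => ev; apply: eval_comp1 ev (eval_not _). Qed.

Lemma eval_pand p q e P Q : eval p e `[< P >] -> eval q e `[< Q >] ->
  eval (pand p q) e `[< P /\ Q >].
Proof.
by rewrite asbool_and -mulnb => ev ev'; apply: eval_comp2 ev ev' (eval_mul _ _).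
Qed.

Lemma eval_equiv p e P Q : P <-> Q -> eval p e `[< P >] -> eval p e `[< Q >].
Proof. by move=> PQ; rewrite (asbool_equiv_eq PQ). Qed.

Lemma eval_pimp p q e P Q : eval p e `[< P >] -> eval q e `[< Q >] ->
  eval (pimp p q) e `[< P -> Q >].
Proof.
move=> ev ev'; apply: (eval_equiv (P := ~ (P /\ ~ Q))).
  by split=> [H p0|H [/H]//]; apply: contrapT => nQ; apply: H.
by apply: eval_pneg; apply: eval_pand => //; apply: eval_pneg.
Qed.

Lemma eval_pall t p e b (P : nat -> Prop) : eval t e b ->
  (forall x, eval p (x :: e) `[< P x >]) ->
  eval (pall (size e) t p) e `[< forall x, x < b -> P x >].
Proof.
move=> evt evp; apply: (@eval_comp _ _ _ (b :: e)).
  by apply: evals_cons evt (evals_projs [::] e).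
elim: b {evt} => [|m IHm].
  rewrite (_ : `[< _ >] = true); last by apply/asboolP.
  by apply: eval_rec0; apply: eval_one.
apply: eval_recS IHm _; set r := `[< forall x, x < m -> _ >].
have -> : nat_of_bool `[< forall x, x < m.+1 -> P x >] = r * `[< P m >].
  rewrite mulnb -asbool_and; congr nat_of_bool; apply: asbool_equiv_eq.
  split=> [H|[H Hm] x]; first by split=> [x /leqW|]; apply: H.
  by rewrite ltnS leq_eqVlt => /orP[/eqP->|/H].
apply: eval_comp2 (eval_mul _ _); first exact: (@eval_proj 1 (m :: _ :: e)).
apply: eval_comp (evp m).
apply: evals_cons; first exact: (@eval_proj 0 (m :: _ :: e)).
exact: (evals_projs [:: m; nat_of_bool r] e).
Qed.

Lemma eval_ple t u e : eval (PComp p_le [:: tprog (size e) t; tprog (size e) u]) e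
  `[< term_value t e <= term_value u e >].
Proof.
by rewrite asboolb; apply: eval_comp2 (eval_tprog t e) (eval_tprog u e) (eval_le _ _).
Qed.

(** Truth in [bholds] is classical, but all quantifiers are bounded: the compiled program involves
    no minimization and always halts with the truth value. *)
Lemma eval_bprog f e : eval (bprog (size e) f) e `[< bholds f e >].
Proof.
elim: f e => /= [t u|t u|t u|f IH|f IHf g IHg|f IHf g IHg|f IHf g IHg|f IHf g IHg
  |t f IH|t f IH|f IH ts] e.
- exact: eval_ple.
- apply: eval_equiv (eval_pand (eval_ple _ _ _) (eval_ple _ _ _)).
  by split=> [[le le']|->] //; apply/eqP; rewrite eqn_leq le.
- rewrite asboolb; exact: eval_comp2 (eval_tprog t e) (eval_tprog u e) (eval_bit _ _).
- exact: eval_pneg.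
- exact: eval_pand.
- apply: (eval_equiv (P := ~ bholds f e -> bholds g e)).
    by split=> [H|[]//]; have [|/H] := EM (bholds f e); [left | right].
  by apply: eval_pimp => //; apply: eval_pneg.
- exact: eval_pimp.
- by apply: eval_pand; apply: eval_pimp.
- by apply: eval_pall => [|x]; [apply: eval_tprog | apply: (IH (x :: e))].
- apply: (eval_equiv (P := ~ forall x, x < term_value t e -> ~ bholds f (x :: e))).
    split=> [H|[x ltx Hx] /(_ x ltx)//]; apply: contrapT => nex; apply: H => x ltx Hx.
    by apply: nex; exists x.
  apply: eval_pneg; apply: eval_pall => [|x]; first exact: eval_tprog.
  by apply: eval_pneg; apply: (IH (x :: e)).
- apply: (@eval_comp _ _ _ [seq term_value t e | t <- ts]); last first.
    by rewrite -(size_map (fun t => term_value t e)); apply: IH.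
  apply: evals_map => [|i]; rewrite ?size_map // => lti.
  by rewrite !(nth_map TZero) //; apply: eval_tprog.
Qed.

Lemma bform_decidable (T : Type) (enc : T -> seq nat) (n : nat) (P : T -> Prop)
    (f : bform) :
  (forall x, size (enc x) = n) -> (forall x, P x <-> bholds f (enc x)) ->
  algorithmically_decidable enc P.
Proof.
move=> sz PE; exists (bprog n f) => x; rewrite PE -(sz x).
have := eval_bprog f (enc x); case: asboolP => H ev; split=> //.
Qed.

(** * Factorization forests *)

Section Languages.
Variable X : Type.
Implicit Types (P Q : seq X -> Prop) (u v w : seq X).

Definition lang_cat P Q w := exists u v, [/\ w = u ++ v, P u & Q v].

Inductive star P : seq X -> Prop :=
| star_nil : star P [::]
| star_cons u w : P u -> star P w -> star P (u ++ w).

End Languages.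

Section Forest.
Variables (X : Type) (W : finType) (op : W -> W -> W) (one : W).
Hypothesis opA : associative op.
Hypothesis op1x : left_id one op.
Hypothesis opx1 : right_id one op.
Variable nu : seq X -> W.
Hypothesis nu_nil : nu [::] = one.
Hypothesis nu_cat : forall u v, nu (u ++ v) = op (nu u) (nu v).
Implicit Types (P Q : seq X -> Prop) (u v w : seq X).
(** Boundedness stays abstract because the theorem is applied twice: to find idempotent factors in
    long words, and to cover words by monomials of bounded length. *)
Variable bounded : (seq X -> Prop) -> Prop.
Hypothesis bounded_sub : forall P Q,
  (forall u, P u -> Q u) -> bounded Q -> bounded P.
Hypothesis bounded_or : forall P Q,
  bounded P -> bounded Q -> bounded (fun u => P u \/ Q u).
Hypothesis bounded_cat : forall P Q,
  bounded P -> bounded Q -> bounded (lang_cat P Q).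
Hypothesis bounded_nil : bounded (fun u => u = [::]).
Hypothesis bounded_star : forall P e, op e e = e -> bounded P ->
  (forall u, P u -> nu u = e) -> bounded (star P).

Section Loops.
Variables (H : {set W}) (P : seq X -> Prop).
Hypothesis H_op : forall x y, x \in H -> y \in H -> op x y \in H.
Hypothesis bP : bounded P.
Hypothesis P_H : forall u, P u -> nu u \in H.
Hypothesis P_inj : forall u, P u ->
  {in H &, injective (op (nu u))}.

(* Words are read as paths in the right Cayley graph of [W]. *)
Inductive path_in (D : {set W}) (p : W) : seq X -> Prop :=
| path_in_nil : path_in D p [::]
| path_in_one u : P u -> path_in D p u
| path_in_cons u w : P u -> op p (nu u) \in D ->
    path_in D (op p (nu u)) w -> path_in D p (u ++ w).

Lemma path_in_val D p w : path_in D p w ->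
  w = [::] \/ nu w \in H /\ {in H &, injective (op (nu w))}.
Proof.
elim=> {p w} [p|p u Pu|p u w Pu _ _ IH]; first by left.
  by right; split; [apply: P_H | apply: P_inj].
case: IH => [->|[Hw inj]]; right.
  by rewrite cats0; split; [apply: P_H | apply: P_inj].
rewrite nu_cat; split; first by apply: H_op => //; apply: P_H.
move=> x y Hx Hy; rewrite -!opA => /(P_inj Pu) E; apply: inj => //.
by apply: E; apply: H_op.
Qed.

Definition loop D q u := [/\ path_in D q u, op q (nu u) = q & nu u \in H].

Lemma path_in_split D p q w : path_in D p w ->
  path_in (D :\ q) p w \/
  lang_cat (fun u => path_in (D :\ q) p u /\ op p (nu u) = q)
    (lang_cat (star (loop (D :\ q) q)) (path_in (D :\ q) q)) w.
Proof.
elim=> {p w} [p|p u Pu|p u w Pu Dp _ IH].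
- by left; apply: path_in_nil.
- by left; apply: path_in_one.
have [E|nE] := eqVneq (op p (nu u)) q; last first.
  have Dp' : op p (nu u) \in D :\ q by rewrite !inE nE.
  case: IH => [IH|[u2 [v [-> [pu2 Eu2] Hv]]]].
    by left; apply: path_in_cons.
  right; exists (u ++ u2), v; split=> //; first by rewrite catA.
  by split; [apply: path_in_cons | rewrite nu_cat opA].
right; exists u, w; split=> //; first by split=> //; apply: path_in_one.
move: IH; rewrite E => -[IH|[u2 [v [-> [pu2 Eu2] [v1 [v2 [-> Sv1 pv2]]]]]]].
  by exists [::], w; split=> //; apply: star_nil.
have [->|[Hu2 _]] := path_in_val pu2; first by exists v1, v2; split.
exists (u2 ++ v1), v2; split=> //; first by rewrite catA.
by apply: star_cons.
Qed.

(** Induction on the number of allowed states. If multiplication by [q] is not injective on [H],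
    then [q] is never reached from [p], since the values read on the way act injectively. Otherwise
    [q x = q] determines [x] in [H], so all loops at [q] have the same value [e], and
    [q (e e) = q e] gives [e e = e]: the hypothesis on stars of idempotent languages applies. *)
Lemma bounded_path_in D p :
  {in H &, injective (op p)} -> bounded (path_in D p).
Proof.
move: {2}#|D| (leqnn #|D|) => n; elim: n D p => [|n IH] D p leD injp.
  have D0 : D = set0 by apply/eqP; rewrite -cards_eq0 -leqn0.
  apply: bounded_sub (bounded_or bounded_nil bP) => u.
  by case=> [|v Pv|v w _]; [left | right | rewrite D0 inE].
have [D0|[q Dq]] := set_0Vmem D.
  apply: (IH D p) => //; by rewrite D0 cards0.
have leDq : #|D :\ q| <= n by move: leD; rewrite (cardsD1 q) Dq.
have [injq|ninjq] := EM {in H &, injective (op q)}; last first.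
  apply: bounded_sub (IH _ _ leDq injp) => w /(path_in_split q) [] //.
  move=> [u [v [_ [pu Eq] _]]]; case: ninjq.
  have [u0|[Hu inju]] := path_in_val pu.
    by move: Eq; rewrite u0 nu_nil opx1 => <-.
  move=> x y Hx Hy; rewrite -Eq -!opA => /injp E; apply: inju => //.
  by apply: E; apply: H_op.
have bp := IH _ _ leDq injp; have bq := IH _ _ leDq injq.
have bl : bounded (star (loop (D :\ q) q)).
  have [[e He Ee]|ne] := EM (exists2 e, e \in H & op q e = q).
    apply: (@bounded_star _ e).
    - by apply: injq; rewrite ?H_op // opA !Ee.
    - by apply: bounded_sub bq => u [].
    - by move=> u [_ Eu Hu]; apply: injq => //; rewrite Ee.
  apply: bounded_sub bounded_nil => w; case=> // u v [_ Eu Hu].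
  by case: ne; exists (nu u).
apply: bounded_sub (bounded_or bp (bounded_cat bp (bounded_cat bl bq))) => w.
move=> /(path_in_split q) [|[u [v [-> [pu _] Hv]]]]; first by left.
by right; exists u, v.
Qed.

Lemma bounded_star_inj : bounded (star P).
Proof.
apply: bounded_sub (bounded_path_in setT (p := one) _) => [w|x y _ _].
  move=> Sw; move: one; elim: Sw => {w} [|u w Pu _ IH] p; first exact: path_in_nil.
  by apply: path_in_cons => //; rewrite inE.
by rewrite !op1x.
Qed.

End Loops.

Lemma star_val (H : {set W}) P w :
  (forall x y, x \in H -> y \in H -> op x y \in H) ->
  (forall u, P u -> nu u \in H) -> star P w -> nu w = one \/ nu w \in H.
Proof.
move=> H_op PH; elim=> [|u v Pu _ IH]; first by left.
right; rewrite nu_cat; have Hu := PH _ Pu.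
by case: IH => [->|Hv]; rewrite ?opx1 ?H_op.
Qed.

(** Pairs are needed because a block reduced to a factor of value [c] need not have its value in
    [c * H], whereas two consecutive blocks do. The induction carries the claim for [w] and for
    [u ++ w], to follow both parities. *)
Lemma star_odd_even Q w : star Q w ->
  lang_cat (star (lang_cat Q Q)) (fun u => u = [::] \/ Q u) w.
Proof.
move=> Sw; suff [//] : lang_cat (star (lang_cat Q Q)) (fun u => u = [::] \/ Q u) w
  /\ forall u, Q u -> lang_cat (star (lang_cat Q Q)) (fun u => u = [::] \/ Q u) (u ++ w).
elim: Sw => [|u v Qu _ [IH1 IH2]].
  split; first by exists [::], [::]; split=> //; [apply: star_nil | left].
  move=> u Qu; exists [::], u; split; rewrite ?cats0 //; first exact: star_nil.
  by right.
split; first exact: IH2.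
move=> u' Qu'; case: IH1 => v1 [v2 [-> Sv1 Hv2]].
exists ((u' ++ u) ++ v1), v2; split=> //; first by rewrite !catA.
by apply: star_cons => //; exists u', u.
Qed.

(* Induction on the size of a subsemigroup [H] that contains the values, then
   on the number of values. If some value [c] has [c * H <> H] then words are
   cut at the factors of value [c], and the blocks, taken two by two, have
   values in [c * H]; otherwise the values act injectively on [H] and all
   loops at a state have the same idempotent value. *)
Theorem forest P : bounded P -> bounded (star P).
Proof.
move=> bP; have: forall n m (H G : {set W}), #|H| < n -> #|G| < m ->
    (forall x y, x \in H -> y \in H -> op x y \in H) -> G \subset H ->
    forall P, bounded P -> (forall u, P u -> nu u \in G) -> bounded (star P);
    last first.
  move=> main; apply: (main #|W|.+1 #|W|.+1 setT setT) => //.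
  - by rewrite ltnS max_card.
  - by rewrite ltnS max_card.
elim=> [//|n IHn]; elim=> [//|m IHm] H G leH leG H_op GH {bP}P bP PG.
have PH u : P u -> nu u \in H by move/PG; apply: (subsetP GH).
have [[c Gc cH]|inj] := EM (exists2 c, c \in G & op c @: H != H); last first.
  apply: (@bounded_star_inj H) => // u Pu; apply/imset_injP.
  have [E|nE] := eqVneq (op (nu u) @: H) H; first by rewrite E.
  by case: inj; exists (nu u) => //; apply: PG.
have Hc := subsetP GH c Gc.
have cHH : op c @: H \proper H.
  rewrite properEneq cH; apply/subsetP => _ /imsetP[x Hx ->]; exact: H_op.
pose R u := P u /\ nu u != c.
have bR : bounded (star R).
  apply: (IHm H (G :\ c)) => //.
  - by move: leG; rewrite (cardsD1 c) Gc.
  - by apply: subset_trans GH; apply: subsetDl.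
  - by apply: bounded_sub bP => u [].
  - by move=> u [Pu nu_c]; rewrite !inE nu_c PG.
have RH w : star R w -> nu w = one \/ nu w \in H.
  by apply: star_val => // u [/PH].
pose Y := lang_cat (fun u => P u /\ nu u = c) (star R).
have bY : bounded Y.
  by apply: bounded_cat bR; apply: bounded_sub bP => u [].
have bYY : bounded (star (lang_cat Y Y)).
  apply: (IHn #|W|.+1 (op c @: H) (op c @: H)) => //.
  - by rewrite -ltnS; apply: leq_trans leH; rewrite ltnS; apply: proper_card.
  - by rewrite ltnS max_card.
  - move=> _ _ /imsetP[x Hx ->] /imsetP[y Hy ->]; rewrite -opA.
    by apply: imset_f; rewrite !H_op.
  - exact: (bounded_cat bY bY).
  - move=> _ [_ [_ [-> [u [w [-> [_ Eu] Rw]]] [u' [w' [-> [_ Eu'] Rw']]]]]].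
    rewrite !nu_cat Eu Eu' -opA; apply: imset_f.
    have Hcw : op c (nu w') \in H by case: (RH _ Rw') => [->|Hw']; rewrite ?opx1 ?H_op.
    by case: (RH _ Rw) => [->|Hw]; [rewrite op1x | apply: H_op].
apply: bounded_sub (bounded_cat bR (bounded_cat bYY (bounded_or bounded_nil bY))).
move=> w Sw; suff: lang_cat (star R) (star Y) w.
  case=> u [v [-> Ru /star_odd_even Yv]]; by exists u, v.
elim: Sw => [|u v Pu _ [v1 [v2 [-> Rv1 Yv2]]]].
  by exists [::], [::]; split=> //; apply: star_nil.
have [E|nE] := eqVneq (nu u) c; last first.
  by exists (u ++ v1), v2; split=> //; [rewrite catA | apply: star_cons].
exists [::], ((u ++ v1) ++ v2); split=> //; first by rewrite catA.
  exact: star_nil.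
by apply: star_cons => //; exists u, v1.
Qed.

End Forest.

(** Instance of [forest] where a language is bounded if its long enough words contain a nonempty
    factor of idempotent value. A nonempty word in the star of an idempotent language starts with
    such a factor, up to empty words, so the bound is 0 there. *)
Lemma idempotent_factor (W : finType) (op : W -> W -> W) (one : W) :
  associative op -> left_id one op -> right_id one op ->
  exists n, forall s : seq W, n < size s ->
    exists a b c e, [/\ s = a ++ b ++ c, b != [::], foldr op one b = e & op e e = e].
Proof.
move=> opA op1x opx1.
pose idf (s : seq W) := exists a b c e,
  [/\ s = a ++ b ++ c, b != [::], foldr op one b = e & op e e = e].
have idf_catl u v : idf u -> idf (u ++ v).
  by move=> [a [b [c [e [-> ? ? ?]]]]]; exists a, b, (c ++ v), e; rewrite -!catA.
have idf_catr u v : idf v -> idf (u ++ v).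
  by move=> [a [b [c [e [-> ? ? ?]]]]]; exists (u ++ a), b, c, e; rewrite -!catA.
pose bounded (P : seq W -> Prop) :=
  exists n, forall s, P s -> n < size s -> idf s.
have f_cat u v : foldr op one (u ++ v) = op (foldr op one u) (foldr op one v).
  by elim: u => //= x u ->.
suff [n Hn]: bounded (star (fun s => exists x, s = [:: x])).
  exists n => s; apply: Hn; elim: s => [|x s IH]; first exact: star_nil.
  by rewrite -cat1s; apply: star_cons => //; exists x.
apply: (@forest W W op one opA op1x opx1 (foldr op one) _ f_cat bounded) => //.
- move=> P Q PQ [n Hn]; exists n => s /PQ; exact: Hn.
- move=> P Q [n Hn] [m Hm]; exists (n + m) => s [/Hn H|/Hm H] lt; apply: H.
    exact: leq_ltn_trans (leq_addr _ _) lt.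
  exact: leq_ltn_trans (leq_addl _ _) lt.
- move=> P Q [n Hn] [m Hm]; exists (n + m) => _ [u [v [-> Pu Qv]]].
  rewrite size_cat => lt; have [ltu|leu] := ltnP n (size u).
    by apply: idf_catl; apply: Hn.
  by apply: idf_catr; apply: Hm => //; lia.
- by exists 0 => s ->.
- move=> P e ee [n Hn] Pe; exists 0 => s; elim=> {s} [//|[//|x u] w Pu _ IH _].
  apply: idf_catl; exists [::], (x :: u), [::], e; rewrite cats0; split=> //.
  exact: Pe.
- by exists 1 => s [x ->].
Qed.

(** * The Sigma_2(<) preorder on words *)

Section Order.
Variable G : eqType.
Implicit Types (U V l : seq G) (ds : seq (seq G * G)).

(* A pair [(ds, l)] is a word with marked letters: the gap before each mark
   together with the mark, and the last gap. *)
Fixpoint plug ds l : seq G :=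
  if ds is (g, a) :: ds' then g ++ a :: plug ds' l else l.

(** The second round inside one gap: at most [k] positions chosen in [V] are answered in [l]. For
    [k = 1] this is the inclusion of the sets of letters. *)
Definition subk (k : nat) V l :=
  forall s, subseq s V -> size s <= k -> subseq s l.

Fixpoint fits (k : nat) ds l V : Prop :=
  if ds is (g, a) :: ds' then
    exists V1 V2, [/\ V = V1 ++ a :: V2, subk k V1 g & fits k ds' l V2]
  else subk k V l.

(** The first round puts at most [n] marks on [U]; the answer puts the same letters in [V], so that
    every gap of [V] can be answered in the corresponding gap of [U]. *)
Definition le2 (n k : nat) U V :=
  forall ds l, size ds <= n -> U = plug ds l -> fits k ds l V.

Lemma subseq_catP (s u v : seq G) : subseq s (u ++ v) ->
  exists s1 s2, [/\ s = s1 ++ s2, subseq s1 u & subseq s2 v].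
Proof.
move=> /subseqP[m szm ->]; exists (mask (take (size u) m) u), (mask (drop (size u) m) v).
split; rewrite ?mask_subseq // -mask_cat ?cat_take_drop // size_takel //.
by rewrite szm size_cat leq_addr.
Qed.

Lemma subk_cat k U1 U2 l1 l2 :
  subk k U1 l1 -> subk k U2 l2 -> subk k (U1 ++ U2) (l1 ++ l2).
Proof.
move=> H1 H2 s /subseq_catP[s1 [s2 [-> sub1 sub2]]]; rewrite size_cat => szs.
by apply: cat_subseq; [apply: H1 | apply: H2] => //; lia.
Qed.

Lemma subk_sub k U l : 0 < k -> subk k U l -> {subset U <= l}.
Proof. by move=> k0 H x; rewrite -!sub1seq => /H ->. Qed.

(** Concatenation of marked words: the last gap [l1] of the first one merges with the first gap of
    the second one, which is its last gap if it has no mark. *)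
Definition join_ds ds1 l1 ds2 :=
  if ds2 is (g, a) :: ds then ds1 ++ (l1 ++ g, a) :: ds else ds1.
Definition join_last l1 ds2 l2 := if ds2 is _ :: _ then l2 else l1 ++ l2.

Lemma fits_join k ds1 l1 ds2 l2 V1 V2 :
  fits k ds1 l1 V1 -> fits k ds2 l2 V2 ->
  fits k (join_ds ds1 l1 ds2) (join_last l1 ds2 l2) (V1 ++ V2).
Proof.
elim: ds1 V1 => /= [|[g a] ds1 IH] V1.
  case: ds2 => [|[g a] ds] /= H1 H2; first exact: subk_cat.
  case: H2 => V3 [V4 [-> H3 H4]]; exists (V1 ++ V3), V4; split=> //.
    by rewrite catA.
  exact: subk_cat.
case=> V3 [V4 [-> H3 H4]] H2; have := IH _ H4 H2.
case: ds2 H2 IH => [|[g2 a2] ds] /= _ _ H; exists V3, (V4 ++ V2); split=> //.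
  by rewrite -catA.
by rewrite -catA.
Qed.

Lemma plug_split ds l X Y : plug ds l = X ++ Y ->
  exists ds1 l1 ds2 l2, [/\ plug ds1 l1 = X, plug ds2 l2 = Y,
    ds = join_ds ds1 l1 ds2, l = join_last l1 ds2 l2
    & size ds = size ds1 + size ds2].
Proof.
elim: ds X => /= [|[g a] ds IH] X E; first by exists [::], X, [::], Y.
have [leX|ltX] := leqP (size X) (size g).
  exists [::], X, ((drop (size X) g, a) :: ds), l; split=> //=.
    move/(congr1 (drop (size X))): E; rewrite (drop_size_cat Y erefl) => <-.
    by rewrite drop_cat ltn_neqAle leX andbT; case: eqP => //= ->;
       rewrite subnn drop0 drop_size.
  congr ((_, _) :: _); rewrite -[in LHS](cat_take_drop (size X) g); congr (_ ++ _).
  by move/(congr1 (take (size X))): E; rewrite (take_size_cat Y erefl) takel_cat.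
have EX : X = g ++ a :: drop (size g).+1 X.
  rewrite -[LHS](cat_take_drop (size g)); congr (_ ++ _).
    by move/(congr1 (take (size g))): E; rewrite take_size_cat // takel_cat // ltnW.
  rewrite (drop_nth a) //; congr (_ :: _).
  by move/(congr1 (nth a ^~ (size g))): E; rewrite !nth_cat ltnn subnn ltX.
move: E; rewrite EX -catA => /eqP; rewrite eqseq_cat // => /andP[_ /eqP[]] E.
have [ds1 [l1 [ds2 [l2 [E1 E2 E3 E4 E5]]]]] := IH _ E.
exists ((g, a) :: ds1), l1, ds2, l2; rewrite /= E1 E2 E5; split=> //.
by rewrite E3; case: ds2 {E2 E3 E4 E5} => [|[]].
Qed.

Lemma le2_cat n k U1 U2 V1 V2 :
  le2 n k U1 V1 -> le2 n k U2 V2 -> le2 n k (U1 ++ U2) (V1 ++ V2).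
Proof.
move=> H1 H2 ds l szds /esym/plug_split[ds1 [l1 [ds2 [l2 [E1 E2 E3 -> E5]]]]].
rewrite {}E3 in szds E5 *; rewrite E5 in szds; apply: fits_join.
  by apply: H1 => //; apply: leq_trans szds; apply: leq_addr.
by apply: H2 => //; apply: leq_trans szds; apply: leq_addl.
Qed.

Lemma fits_refl k ds l : fits k ds l (plug ds l).
Proof. by elim: ds => //= [[g a] ds IH]; exists g, (plug ds l); split. Qed.

Lemma le2_refl n k U : le2 n k U U.
Proof. by move=> ds l _ ->; apply: fits_refl. Qed.

Lemma le2_sub n k U V : 0 < k -> le2 n k U V -> {subset V <= U}.
Proof. by move=> k0 /(_ [::] U isT erefl) /= H; apply: subk_sub H. Qed.

Lemma le2_nseq n k z Xs : (forall X, X \in Xs -> le2 n k z X) ->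
  le2 n k (flatten (nseq (size Xs) z)) (flatten Xs).
Proof.
elim: Xs => [|X Xs IH] H /=; first exact: le2_refl.
by apply: le2_cat; [apply: H | apply: IH => Y HY; apply: H];
   rewrite inE ?eqxx ?HY ?orbT.
Qed.

(** One letter is taken from each copy of [u]. *)
Lemma subk_nseq k W (u : seq G) :
  {subset W <= u} -> subk k W (flatten (nseq k u)).
Proof.
move=> sub s /mem_subseq sW; have {sub sW}: {subset s <= u} by move=> x /sW/sub.
elim: k s => [|k IH] [|x s] //= sub ltk; try exact: sub0seq.
rewrite -cat1s; apply: cat_subseq; first by rewrite sub1seq sub // inE eqxx.
by apply: IH => // y ys; apply: sub; rewrite inE ys orbT.
Qed.

(* Among the [m] blocks [z] at least one is free of marks; it makes room for
   all of the word that lies between the images of the other blocks. *)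
Lemma fits_insert n k (B : seq G) z W m ds l Xs Ys :
  (forall W', {subset W' <= B} -> subk k W' z) ->
  {subset z <= B} -> {subset W <= B} -> 0 < k ->
  (forall X, X \in Xs ++ Ys -> le2 n k z X) ->
  size ds < m -> size ds <= n -> size Xs = m -> m <= size Ys ->
  plug ds l = flatten (nseq m z) ->
  fits k ds l (flatten Xs ++ W ++ flatten Ys).
Proof.
move=> Hz zB WB k0; elim: m ds l Xs => [//|m IH] ds l [//|X Xs] lez ltds leds.
move=> [szX] szY /= /plug_split[ds1 [l1 [ds2 [l2 [E1 E2 E3 E4 E5]]]]].
have leB Z : Z \in (X :: Xs) ++ Ys -> {subset Z <= B}.
  by move/lez/(le2_sub k0) => H x /H/zB.
case: ds1 E1 E3 E5 => [|d ds1] /= E1 E3 E5; last first.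
  rewrite -catA E3 E4; apply: fits_join.
    by apply: (lez X); rewrite ?inE ?eqxx //= -/(plug (d :: ds1) l1); lia.
  apply: IH => //; try lia.
  by move=> Z HZ; apply: lez; rewrite inE HZ orbT.
have szdrop : size (drop (size Ys - m) Ys) = m by rewrite size_drop; lia.
have leY Z : Z \in Ys -> Z \in (X :: Xs) ++ Ys by rewrite mem_cat => ->; rewrite orbT.
(* The first block is free of marks. Its gap takes [X], the rest of [Xs], [W] and the first words of
   [Ys]; the [m] remaining blocks are matched with the last [m] words of [Ys]. *)
rewrite -[Ys](cat_take_drop (size Ys - m)) flatten_cat !catA E3 E4; apply: fits_join.
  rewrite /= E1; apply: Hz => x; rewrite -!catA !mem_cat => /or4P[] //.
  - by apply: leB; rewrite inE eqxx.
  - case/flattenP => Z HZ; apply: leB; by rewrite inE mem_cat HZ orbT.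
  - exact: WB.
  - by case/flattenP => Z /mem_take HZ; apply/leB/leY.
have := @le2_nseq n k z (drop (size Ys - m) Ys); rewrite szdrop; apply; rewrite ?E2 //.
  by move=> Z /mem_drop HZ; apply/lez/leY.
lia.
Qed.

End Order.

(** * Saturation *)

Section Saturation.
Variables (C : finType) (op : C -> C -> C) (one : C).
Hypothesis opA : associative op.
Hypothesis op1x : left_id one op.
Hypothesis opx1 : right_id one op.
Implicit Types (U V W : seq C) (B T E : {set C}).

Definition value U := foldr op one U.
Definition content U : {set C} := [set x in U].
Definition setop T1 T2 : {set C} := [set op x y | x in T1, y in T2].

Lemma value_cat U V : value (U ++ V) = op (value U) (value V).
Proof. by elim: U => //= x U ->. Qed.

Lemma content_cat U V : content (U ++ V) = content U :|: content V.
Proof. by apply/setP => x; rewrite !inE mem_cat. Qed.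

Lemma setopA : associative setop.
Proof.
move=> T1 T2 T3; apply/setP => x; apply/imset2P/imset2P.
  case=> y _ y1 /imset2P[z t z2 t3 ->] ->; exists (op y z) t => //.
  by apply/imset2P; exists y z.
case=> _ t /imset2P[y z y1 z2 ->] t3 ->; exists y (op z t) => //.
by apply/imset2P; exists z t.
Qed.

Lemma setop1x : left_id [set one] setop.
Proof.
move=> T; apply/setP => x; apply/imset2P/idP => [[_ y /set1P-> Ty ->]|Tx].
  by rewrite op1x.
by exists one x; rewrite ?set11.
Qed.

Lemma setopx1 : right_id [set one] setop.
Proof.
move=> T; apply/setP => x; apply/imset2P/idP => [[y _ Ty /set1P-> ->]|Tx].
  by rewrite opx1.
by exists x one; rewrite ?set11.
Qed.

Lemma mem_setop T1 T2 x y : x \in T1 -> y \in T2 -> op x y \in setop T1 T2.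
Proof. by move=> *; apply/imset2P; exists x y. Qed.

Variable ok : C -> Prop.

(* A fact [c B s T] states that no Sigma_2(<) property separates some word of
   content [B] and value [s] from words of each of the values in [T]. *)
Record saturated (c : {set C} -> C -> {set C} -> Prop) : Prop := Saturated {
  sat_one : c set0 one [set one];
  sat_letter : forall a, ok a -> c [set a] a [set a];
  sat_op : forall B1 s1 T1 B2 s2 T2, c B1 s1 T1 -> c B2 s2 T2 ->
    c (B1 :|: B2) (op s1 s2) (setop T1 T2);
  sat_idem : forall B e E, c B e E -> op e e = e -> setop E E = E ->
    exists T W : {set C}, [/\ E \subset W,
      forall x a, x \in W -> a \in B -> op x a \in W,
      forall x y, x \in W -> y \in E -> op x y \in T & c B e T] }.

(** In the last rule [T] is any set of values of [E B* E], so that all facts are realized by words,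
    whereas [saturated] asks for some [T] that includes [E B* E]. *)
Inductive Sat : {set C} -> C -> {set C} -> Prop :=
| Sat_one : Sat set0 one [set one]
| Sat_letter a : ok a -> Sat [set a] a [set a]
| Sat_op B1 s1 T1 B2 s2 T2 : Sat B1 s1 T1 -> Sat B2 s2 T2 ->
    Sat (B1 :|: B2) (op s1 s2) (setop T1 T2)
| Sat_idem B e E T : Sat B e E -> op e e = e -> setop E E = E ->
    (forall t, t \in T -> exists x y w, [/\ x \in E, y \in E,
       {subset w <= B} & t = op (op x (value w)) y]) -> Sat B e T.

(** The witnesses are [T = E B* E] and [W = E B*]. *)
Lemma Sat_saturated : saturated Sat.
Proof.
split; [exact: Sat_one | exact: Sat_letter | exact: Sat_op |].
move=> B e E SE ee EE.
exists [set t | `[< exists x y w, [/\ x \in E, y \in E,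
       {subset w <= B} & t = op (op x (value w)) y] >]],
  [set t | `[< exists x w, [/\ x \in E,
       {subset w <= B} & t = op x (value w)] >]]; split.
- by apply/subsetP => x Ex; rewrite inE; apply/asboolP; exists x, [::]; rewrite opx1.
- move=> x a; rewrite !inE => /asboolP[y [w [Ey wB ->]]] aB; apply/asboolP.
  exists y, (rcons w a); split=> //; last by rewrite -cats1 value_cat /= opx1 opA.
  by move=> z; rewrite mem_rcons inE => /orP[/eqP->|/wB].
- move=> x y; rewrite !inE => /asboolP[z [w [Ez wB ->]]] Ey; apply/asboolP.
  by exists z, y, w.
- by apply: Sat_idem SE ee EE _ => t; rewrite inE => /asboolP.
Qed.

Lemma Sat_ok B s T : Sat B s T -> forall a, a \in B -> ok a.
Proof.
elim=> {B s T} [a|a ok_a b|B1 s1 T1 B2 s2 T2 _ IH1 _ IH2 a|//]; rewrite ?inE //.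
  by move/eqP->.
by case/orP; [apply: IH1 | apply: IH2].
Qed.

Lemma idem_nseq e m u : value u = e -> op e e = e ->
  value (flatten (nseq m.+1 u)) = e.
Proof.
move=> <- ee; elim: m => [|m IH] /=; first by rewrite cats0.
by rewrite value_cat -/(flatten (nseq m.+1 u)) IH.
Qed.

(** As [E] is its own square, each of its elements is a product of [m.+1] elements of [E], each
    realized separately. *)
Lemma idem_split (R : seq C -> Prop) E m x : setop E E = E ->
  (forall t, t \in E -> exists2 V, value V = t & R V) -> x \in E ->
  exists Xs, [/\ size Xs = m.+1, forall X, X \in Xs -> R X
    & value (flatten Xs) = x].
Proof.
move=> EE HE; elim: m x => [|m IH] x Ex.
  have [V vV RV] := HE x Ex; exists [:: V]; rewrite /= cats0; split=> // X.
  by rewrite inE => /eqP->.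
move: Ex; rewrite -EE => /imset2P[y z Ey Ez ->].
have [V vV RV] := HE y Ey; have [Xs [szXs RXs vXs]] := IH z Ez.
exists (V :: Xs); split=> //=; first by rewrite szXs.
  by move=> X; rewrite inE => /orP[/eqP->|/RXs].
by rewrite value_cat vV vXs.
Qed.

Lemma content_nseq u m : content (flatten (nseq m.+1 u)) = content u.
Proof.
elim: m => [|m IH] /=; first by rewrite cats0.
by rewrite content_cat -/(flatten (nseq m.+1 u)) IH setUid.
Qed.

Theorem Sat_realized B s T n k : Sat B s T ->
  exists U, [/\ content U = B, value U = s &
    forall t, t \in T -> exists2 V, value V = t & le2 n k.+1 U V].
Proof.
elim=> {B s T} [|a _|B1 s1 T1 B2 s2 T2 _ [U1 [c1 v1 H1]] _ [U2 [c2 v2 H2]]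
  |B e E T _ [u [cu vu Hu]] ee EE HT].
- exists [::]; split=> //.
  by move=> t /set1P->; exists [::] => //; apply: le2_refl.
- exists [:: a]; split; first by apply/setP => x; rewrite !inE.
    by rewrite /= opx1.
  by move=> t /set1P->; exists [:: a]; [rewrite /= opx1 | apply: le2_refl].
- exists (U1 ++ U2); rewrite content_cat value_cat c1 c2 v1 v2; split=> // t.
  case/imset2P=> x y /H1[V1 <- le1] /H2[V2 <- le2'] ->.
  by exists (V1 ++ V2); [rewrite value_cat | apply: le2_cat].
(* With [k.+1] copies of [u], every word of at most [k.+1] letters of [B] is a subsequence of
   [z]. *)
pose z := flatten (nseq k.+1 u).
have vz : value z = e by apply: idem_nseq.
have cz : content z = B by rewrite content_nseq.
have Hz t : t \in E -> exists2 V, value V = t & le2 n k.+1 z V.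
  move=> /(idem_split k EE Hu)[Xs [szXs leXs vXs]]; exists (flatten Xs) => //.
  by have := le2_nseq leXs; rewrite szXs.
(* One more copy of [z] than there are marks, so that some copy is free. *)
exists (flatten (nseq n.+1 z)); split; first by rewrite content_nseq.
  exact: idem_nseq.
move=> _ /HT[x [y [w [/(idem_split n EE Hz)[Xs [szXs leXs <-]]
  /(idem_split n EE Hz)[Ys [szYs leYs <-]] wB ->]]]].
exists (flatten Xs ++ w ++ flatten Ys); first by rewrite !value_cat opA.
have memB x' : (x' \in u) = (x' \in B) by rewrite -cu inE.
move=> ds l szds E1; apply: (@fits_insert _ n k.+1 u z w n.+1) => //.
- by move=> W' W'u; apply: subk_nseq.
- by move=> x'; rewrite memB -cz inE.
- by move=> x' /wB; rewrite memB.
- by move=> X; rewrite mem_cat => /orP[/leXs|/leYs].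
- by rewrite szYs.
Qed.

(** * Covering words by monomials of bounded length *)

Section Bounded.
Variable c : {set C} -> C -> {set C} -> Prop.
Hypothesis c_sat : saturated c.

(* The list [K] stands for the monomial [B1* b1 B2* b2 ... Br* br]. *)
Fixpoint monomial (K : seq ({set C} * C)) U : Prop :=
  if K is (B, b) :: K' then
    exists U1 U2, [/\ U = U1 ++ b :: U2, {subset U1 <= B} & monomial K' U2]
  else U = [::].

Lemma monomial_cat K1 K2 U :
  monomial (K1 ++ K2) U <-> lang_cat (monomial K1) (monomial K2) U.
Proof.
split.
  elim: K1 U => [|[B b] K1 IH] U /=; first by exists [::], U.
  case=> U1 [_ [-> sub /IH[V1 [V2 [-> H1 H2]]]]].
  by exists (U1 ++ b :: V1), V2; split=> //; [rewrite -catA | exists U1, V1].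
case=> U1 [U2 [-> H1 H2]]; elim: K1 U1 H1 => [|[B b] K1 IH] U1 /=; first by move->.
case=> V1 [V2 [-> sub /IH H]]; exists V1, (V2 ++ U2); split=> //.
by rewrite -catA.
Qed.

(** The marks are the letters [b] of the monomial. The gaps are constrained only by their sets of
    letters, which is why one position in the second round is enough. *)
Lemma monomial_fits K U : monomial K U -> exists ds l,
  [/\ size ds <= size K, U = plug ds l &
      forall V, fits 1 ds l V -> monomial K V].
Proof.
elim: K U => [|[B b] K IH] U /=.
  move->; exists [::], [::]; split=> // -[|x V] // /(_ [:: x]).
  by rewrite /= eqxx sub0seq => /(_ isT isT).
case=> U1 [U2 [-> sub /IH[ds [l [szds -> H]]]]].
exists ((U1, b) :: ds), l; split=> // _ [V1 [V2 [-> sub1 /H KV2]]].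
by exists V1, V2; split=> // x /(subk_sub _ sub1)/sub; apply.
Qed.

Lemma monomial_le2 K n U V :
  size K <= n -> le2 n 1 U V -> monomial K U -> monomial K V.
Proof.
move=> szK leUV /monomial_fits[ds [l [szds EU H]]]; apply: H; apply: leUV => //.
exact: leq_trans szK.
Qed.

(** The monomial and [T] depend on [U]; only the length [n] has to be uniform. *)
Definition approx n U T := exists K, [/\ size K <= n, monomial K U,
  c (content U) (value U) T & forall V, monomial K V -> value V \in T].
Definition good n U := exists T, approx n U T.

Lemma approx_cat n m U V T T' : approx n U T -> approx m V T' ->
  approx (n + m) (U ++ V) (setop T T').
Proof.
move=> [K [szK KU cT HT]] [K' [szK' KV cT' HT']]; exists (K ++ K'); split.
- by rewrite size_cat leq_add.
- by apply/monomial_cat; exists U, V.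
- by rewrite content_cat value_cat; apply: sat_op.
- move=> _ /monomial_cat[V1 [V2 [-> /HT ? /HT' ?]]].
  by rewrite value_cat; apply: mem_setop.
Qed.

Lemma approx_nil n : approx n [::] [set one].
Proof.
exists [::]; split=> // [|V ->]; last exact: set11.
by rewrite (_ : content _ = set0); [apply: sat_one | apply/setP => x; rewrite !inE].
Qed.

Lemma good_nil n : good n [::].
Proof. by exists [set one]; apply: approx_nil. Qed.

Lemma good_letter a : ok a -> good 1 [:: a].
Proof.
move=> ok_a; exists [set a], [:: (set0, a)]; split=> //.
- by exists [::], [::].
- rewrite (_ : content _ = [set a]) /= ?opx1; last by apply/setP => x; rewrite !inE.
  exact: sat_letter.
- move=> _ [V1 [_ [-> sub ->]]]; case: V1 sub => [|x V1] sub /=.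
    by rewrite opx1 set11.
  by move: (sub x); rewrite !inE eqxx => /(_ isT).
Qed.

Lemma good_mono n m U : n <= m -> good n U -> good m U.
Proof.
by move=> le [T [K [szK *]]]; exists T, K; split=> //; apply: leq_trans le.
Qed.

Lemma good_cat n m U V : good n U -> good m V -> good (n + m) (U ++ V).
Proof. by move=> [T H] [T' H']; exists (setop T T'); apply: approx_cat. Qed.

Section Blocks.
Variables (B : {set C}) (e : C) (h : nat).
Hypothesis ee : op e e = e.

(** A word comes with a chosen set of values. This set is not a function of the word, so idempotents
    among the sets are sought along a list of blocks. *)
Definition block (b : seq C * {set C}) :=
  [/\ content b.1 = B, value b.1 = e & approx h b.1 b.2].
Definition block_word (bs : seq (seq C * {set C})) := flatten (map fst bs).
Definition block_image (bs : seq (seq C * {set C})) :=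
  foldr setop [set one] (map snd bs).

Lemma block_word_cat bs bs' : block_word (bs ++ bs') = block_word bs ++ block_word bs'.
Proof. by rewrite /block_word map_cat flatten_cat. Qed.

Lemma approx_blocks bs : (forall b, b \in bs -> block b) ->
  approx (h * size bs) (block_word bs) (block_image bs).
Proof.
elim: bs => [|b bs IH] Hbs; first exact: approx_nil.
rewrite mulnS; apply: approx_cat.
  by have [] := Hbs b (mem_head _ _).
by apply: IH => b' Hb'; apply: Hbs; rewrite inE Hb' orbT.
Qed.

Lemma content_block_word bs b0 : (forall b, b \in b0 :: bs -> block b) ->
  content (block_word (b0 :: bs)) = B /\ value (block_word (b0 :: bs)) = e.
Proof.
elim: bs b0 => [|b1 bs IH] b0 H; have [cb vb _] := H _ (mem_head _ _).
  by rewrite /block_word /= cats0.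
have [|cw vw] := IH b1; first by move=> b Hb; apply: H; rewrite inE Hb orbT.
rewrite -cat1s block_word_cat content_cat value_cat cw vw /block_word /= cats0 cb vb.
by rewrite setUid ee.
Qed.

(** The fact for [bs1] is [(B, e, E)], and the idempotent rule gives a [T] that includes [E B* E].
    The middle part is absorbed by a single factor [B* b], where [b] is its last letter; this factor
    is the extra 1 in the length. An empty middle part has no last letter and needs only
    concatenation. *)
Lemma good_gap E bs1 bs bs2 :
  (forall b, b \in bs1 ++ bs ++ bs2 -> block b) -> bs1 != [::] ->
  block_image bs1 = E -> block_image bs2 = E -> setop E E = E ->
  good (h * size bs1 + (h * size bs2).+1) (block_word (bs1 ++ bs ++ bs2)).
Proof.
move=> Hbs nil1 E1 E2 EE.
have [H1 [Hm H2]] : (forall b, b \in bs1 -> block b) /\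
  (forall b, b \in bs -> block b) /\ (forall b, b \in bs2 -> block b).
  by split; [|split]=> b Hb; apply: Hbs; rewrite !mem_cat Hb ?orbT.
have [K1 [sz1 KU1 c1 HT1]] := approx_blocks H1.
have [K2 [sz2 KU2 c2 HT2]] := approx_blocks H2.
have [cw vw] : content (block_word (bs1 ++ bs ++ bs2)) = B /\
               value (block_word (bs1 ++ bs ++ bs2)) = e.
  by case: bs1 nil1 Hbs {H1 E1 KU1 c1 sz1 HT1} => // b0 bs1 _ Hbs; apply: content_block_word.
have [cw1 vw1] : content (block_word bs1) = B /\ value (block_word bs1) = e.
  by case: bs1 nil1 H1 {E1 KU1 c1 sz1 HT1 Hbs cw vw} => // b0 bs1 _ H1; apply: content_block_word.
have mB x : x \in block_word bs -> x \in B.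
  by rewrite -cw inE !block_word_cat !mem_cat => ->; rewrite orbT.
move: cw vw; rewrite !block_word_cat; case: (lastP (block_word bs)) mB => [|M b] mB cw vw.
  apply: (@good_mono (h * size bs1 + h * size bs2)); first by rewrite leq_add2l.
  by apply: good_cat; [exists (block_image bs1) | exists (block_image bs2)]; apply: approx_blocks.
rewrite cw1 vw1 E1 in c1.
have [T [W [EW WB WE cT]]] := sat_idem c_sat c1 ee EE.
exists T, (K1 ++ (B, b) :: K2); split.
- by rewrite size_cat /= leq_add.
- apply/monomial_cat; exists (block_word bs1), (rcons M b ++ block_word bs2); split=> //=.
  exists M, (block_word bs2); rewrite cat_rcons; split=> // x Mx; apply: mB.
  by rewrite mem_rcons inE Mx orbT.
- by rewrite cw vw.
move=> _ /monomial_cat[V1 [_ [-> /HT1 v1 [V2 [V3 [-> sub /HT2 v3]]]]]].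
rewrite -cat_rcons !value_cat opA; apply: WE; last by rewrite -E2.
have {}sub : {subset rcons V2 b <= B}.
  move=> x; rewrite mem_rcons inE => /orP[/eqP->|/sub //].
  by apply: mB; rewrite mem_rcons inE eqxx.
elim/last_ind: (rcons V2 b) sub => [|V x IH] sub.
  by rewrite /= opx1; apply: (subsetP EW); rewrite -E1.
rewrite -cats1 value_cat /= opx1 opA; apply: WB.
  by apply: IH => y Vy; apply: sub; rewrite mem_rcons inE Vy orbT.
by apply: sub; rewrite mem_rcons inE eqxx.
Qed.

(* While more than [R] blocks remain, some factor of at most [R.+1] of them
   has an idempotent image [E] near the left end. Everything between this
   factor and the last factor of image [E] is absorbed by [B*], and [E] does
   not occur further to the right. *)
Lemma good_blocks : exists N, forall bs,
  (forall b, b \in bs -> block b) -> good N (block_word bs).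
Proof.
have [R HR] := idempotent_factor setopA setop1x setopx1.
have idem_prefix bs : R < size bs -> exists X Y Z, [/\ bs = X ++ Y ++ Z,
    Y != [::], size X + size Y <= R.+1 & setop (block_image Y) (block_image Y) = block_image Y].
  move=> ltR; have [|a [b [d [E [Ebs nil_b Eb EE]]]]] := HR (map snd (take R.+1 bs)).
    by rewrite size_map size_takel.
  have szab : size a + size b <= R.+1.
    have := congr1 size Ebs; rewrite size_map size_takel // !size_cat; lia.
  exists (take (size a) bs), (take (size b) (drop (size a) bs)),
    (drop (size b) (drop (size a) bs)); rewrite !cat_take_drop.
  have Emap : map snd (take (size b) (drop (size a) bs)) = b.
    have : take (size b) (drop (size a) (map snd (take R.+1 bs))) = b.
      by rewrite Ebs drop_size_cat // take_size_cat.
    by rewrite -map_drop -map_take !take_drop take_takel // addnC.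
  have sz_b : size (take (size b) (drop (size a) bs)) = size b.
    by rewrite -(size_map snd) Emap.
  split=> //; first by rewrite -size_eq0 sz_b size_eq0.
    by rewrite sz_b (leq_trans _ szab) // leq_add2r size_take; case: ltnP.
  by rewrite /block_image Emap Eb EE.
pose occurs E bs := exists X Y Z, [/\ bs = X ++ Y ++ Z, Y != [::],
  size Y <= R.+1, block_image Y = E & setop E E = E].
(* Induction on the size of a set [F] of sets of values that contains every idempotent image of a
   short factor of [bs]. *)
suff [N HN] : exists N, forall (F : {set {set C}}) bs, #|F| <= #|{set C}| ->
    (forall b, b \in bs -> block b) -> (forall E, occurs E bs -> E \in F) ->
    good N (block_word bs).
  exists N => bs Hbs; apply: (HN setT) => // [|E _]; last by rewrite inE.
  by rewrite max_card.
have short bs : (forall b, b \in bs -> block b) -> size bs <= R ->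
    good (h * R) (block_word bs).
  move=> Hbs le; apply: (@good_mono (h * size bs)); first by rewrite leq_mul2l le orbT.
  by exists (block_image bs); apply: approx_blocks.
elim: #|{set C}| => [|f [N IH]].
  exists (h * R) => F bs; rewrite leqn0 cards_eq0 => /eqP-> Hbs HF.
  have [le|/idem_prefix[X [Y [Z [EXYZ nY szY EE]]]]] := leqP (size bs) R.
    exact: short.
  have /HF : occurs (block_image Y) bs.
    by exists X, Y, Z; split=> //; apply: leq_trans szY; apply: leq_addl.
  by rewrite inE.
(* The summands are: at most [R] blocks when the list is short; at most [R.+1] blocks for each of
   [X], [Y] and [Y'], and 1 for the absorbing factor; [N] for the part to the right, where [E] no
   longer occurs. *)
exists (h * R + (h * R.+1 + (h * R.+1 + (h * R.+1).+1)) + N) => F bs leF Hbs HF.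
have [le|/idem_prefix[X [Y [Z [EXYZ nY szY EE]]]]] := leqP (size bs) R.
  by apply: good_mono (short _ Hbs le); rewrite -addnA leq_addr.
set E := block_image Y in EE.
(* The places where a short factor of image [E] begins; the last one is selected. *)
pose at_ m := `[< exists X Y Z, [/\ bs = X ++ Y ++ Z, size X = m, Y != [::],
  size Y <= R.+1 & block_image Y = E] >].
have ex_at : exists m, at_ m.
  exists (size X); apply/asboolP; exists X, Y, Z; split=> //.
  by apply: leq_trans szY; apply: leq_addl.
have at_le m : at_ m -> m <= size bs.
  by move=> /asboolP[X' [Y' [Z' [-> <- _ _ _]]]]; rewrite size_cat leq_addr.
have [m /asboolP[X' [Y' [Z' [E' szX' nY' szY' EY']]]] max_m] := ex_maxnP ex_at at_le.
have Hsub b bs' : (forall b, b \in bs' -> b \in bs) -> b \in bs' -> block b.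
  by move=> sub /sub; apply: Hbs.
have good_Z : good N (block_word Z').
  apply: (IH (F :\ E)).
  - rewrite -ltnS; apply: leq_trans leF; rewrite (cardsD1 E F) HF //.
    exists X, Y, Z; split=> //; apply: leq_trans szY; exact: leq_addl.
  - by move=> b Hb; apply: Hbs; rewrite E' !mem_cat Hb !orbT.
  move=> E2 [X2 [Y2 [Z2 [EZ' nY2 szY2 EY2 E22]]]]; rewrite !inE; apply/andP; split.
    apply/eqP => E2E; have: at_ (size (X' ++ Y' ++ X2)).
      apply/asboolP; exists (X' ++ Y' ++ X2), Y2, Z2; rewrite EY2 E2E; split=> //.
      by rewrite E' EZ' -!catA.
    move/max_m; rewrite -szX' !size_cat; case: Y' nY' {szY' E' EY'} => //=; lia.
  apply: HF; exists (X' ++ Y' ++ X2), Y2, Z2; split=> //.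
  by rewrite E' EZ' -!catA.
rewrite E' catA block_word_cat; apply: good_cat => //.
(* If the last occurrence [Y'] begins before the end of the first occurrence [Y], then [X' ++ Y'] is
   itself short and nothing has to be absorbed. *)
have [le|lt] := leqP (size X + size Y) (size X'); last first.
  apply: (@good_mono (h * size (X' ++ Y'))); last first.
    exists (block_image (X' ++ Y')); apply: approx_blocks => b Hb.
    by apply: Hbs; rewrite E' catA mem_cat Hb.
  rewrite size_cat mulnDr; apply: leq_trans (leq_addl _ _).
  have: h * size X' <= h * R.+1 by rewrite leq_mul2l; apply/orP; right; lia.
  have: h * size Y' <= h * R.+1 by rewrite leq_mul2l szY' orbT.
  lia.
have EX' : X' = X ++ Y ++ drop (size X + size Y) X'.
  rewrite catA -[LHS](cat_take_drop (size X + size Y)); congr (_ ++ _).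
  have := congr1 (take (size X + size Y)) E'; rewrite takel_cat // => <-.
  by rewrite EXYZ catA take_cat size_cat ltnn subnn take0 cats0.
move: (drop _ X') EX' => M EX'.
rewrite EX' -!catA block_word_cat.
apply: (@good_mono (h * size X + (h * size Y + (h * size Y').+1))).
  have: h * size X <= h * R.+1 by rewrite leq_mul2l; apply/orP; right; lia.
  have: h * size Y <= h * R.+1 by rewrite leq_mul2l; apply/orP; right; lia.
  have: h * size Y' <= h * R.+1 by rewrite leq_mul2l szY' orbT.
  lia.
apply: good_cat.
  exists (block_image X); apply: approx_blocks => b Hb.
  by apply: Hbs; rewrite EXYZ mem_cat Hb.
apply: (@good_gap E) => // b Hb; apply: Hbs.
by move: Hb; rewrite E' EX' !mem_cat => /or3P[] ->; rewrite ?orbT.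
Qed.

End Blocks.
(** [forest] is applied in the monoid of pairs of a content and a value: all factors of an
    idempotent star share [B] and [e], as the idempotent rule requires. The sets [T] do not form a
    morphism on words and are handled by [good_blocks]. *)
Theorem good_all : exists n, forall U, (forall a, a \in U -> ok a) -> good n U.
Proof.
pose bounded (P : seq C -> Prop) := exists n, forall U, P U -> good n U.
suff [n Hn]: bounded (star (fun U => exists2 a, ok a & U = [:: a])).
  exists n => U okU; apply: Hn; elim: U okU => [|a U IH] okU; first exact: star_nil.
  rewrite -cat1s; apply: star_cons; first by exists a => //; apply: okU; rewrite mem_head.
  by apply: IH => b Ub; apply: okU; rewrite inE Ub orbT.
pose opW (x y : {set C} * C) := (x.1 :|: y.1, op x.2 y.2).
apply: (@forest C ({set C} * C)%type opW (set0, one) _ _ _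
  (fun U => (content U, value U)) _ _ bounded).
- by move=> x y z; rewrite /opW /= setUA opA.
- by case=> B x; rewrite /opW /= set0U op1x.
- by case=> B x; rewrite /opW /= setU0 opx1.
- by congr (_, _); apply/setP => x; rewrite !inE.
- by move=> U V; rewrite content_cat value_cat.
- by move=> P Q PQ [n Hn]; exists n => U /PQ; apply: Hn.
- move=> P Q [n Hn] [m Hm]; exists (n + m) => U [/Hn|/Hm]; apply: good_mono.
    exact: leq_addr.
  exact: leq_addl.
- move=> P Q [n Hn] [m Hm]; exists (n + m) => _ [U [V [-> /Hn ? /Hm ?]]].
  exact: good_cat.
- by exists 0 => U ->; apply: good_nil.
- move=> P [B e] [_ ee] [n Hn] HP; have [N HN] := good_blocks B n ee.
  exists N => U SU.
  suff [bs -> Hbs] : exists2 bs, U = block_word bs & forall b, b \in bs -> block B e n b.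
    exact: HN.
  elim: SU => [|V W PV _ [bs -> Hbs]]; first by exists [::].
  have [T HT] := Hn V PV; have [cV vV] := HP _ PV.
  exists ((V, T) :: bs) => // b; rewrite inE => /orP[/eqP-> /=|/Hbs //].
  by split.
- by exists 1 => _ [a ok_a ->]; apply: good_letter.
Qed.

End Bounded.

Variables F1 F2 : C -> Prop.

Definition conflict_free (c : {set C} -> C -> {set C} -> Prop) :=
  forall B s T t, c B s T -> F1 s -> t \in T -> ~ F2 t.

Theorem saturated_separates c : saturated c -> conflict_free c ->
  exists n, forall U V, (forall a, a \in U -> ok a) -> le2 n 1 U V ->
    F1 (value U) -> ~ F2 (value V).
Proof.
move=> c_sat Hc; have [n Hn] := good_all c_sat; exists n => U V okU leUV F1U.
have [T [K [szK KU cT HT]]] := Hn U okU.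
by apply: Hc cT F1U _; apply: HT; apply: monomial_le2 leUV KU.
Qed.

Theorem Sat_conflict_free n k :
  (forall U V, (forall a, a \in U -> ok a) -> (forall a, a \in V -> ok a) ->
     le2 n k.+1 U V -> F1 (value U) -> ~ F2 (value V)) -> conflict_free Sat.
Proof.
move=> H B s T t SB F1s Tt F2t; have [U [cU vU HU]] := Sat_realized n k SB.
have [V vV leUV] := HU t Tt.
have okU a : a \in U -> ok a by move=> Ua; apply: (Sat_ok SB); rewrite -cU inE.
apply: (H U V) => //; rewrite ?vU ?vV // => a Va.
by apply: okU; apply: le2_sub leUV _ Va.
Qed.

End Saturation.

(** * Logic *)

Section Logic.
Variable A : eqType.
Implicit Types (w : seq A) (l xs ys zs ts : seq nat).

(** Environments are lists of numbers, the innermost variable first. Their type does not depend on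
    the word, so two words can be compared. *)
Fixpoint nsat w (n : nat) (phi : formula A n) (l : seq nat) : bool :=
  match phi with
  | FTrue => true
  | FFalse => false
  | FLetter a x => onth w (nth 0 l x) == Some a
  | FEq x y => nth 0 l x == nth 0 l y
  | FLt x y => nth 0 l x < nth 0 l y
  | FSucc x y => nth 0 l y == (nth 0 l x).+1
  | FMin x => nth 0 l x == 0
  | FMax x => (nth 0 l x).+1 == size w
  | FNot f => ~~ nsat w f l
  | FAnd f g => nsat w f l && nsat w g l
  | FOr f g => nsat w f l || nsat w g l
  | FEx f => has (fun x => nsat w f (x :: l)) (iota 0 (size w))
  | FAll f => all (fun x => nsat w f (x :: l)) (iota 0 (size w))
  end.

Lemma onth_some x0 w i : i < size w -> onth w i = Some (nth x0 w i).
Proof. by elim: w i => [|x w IH] [|i] //= /IH. Qed.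

Lemma sat_nsat w n (phi : formula A n) (e : 'I_n -> 'I_(size w)) l :
  (forall i, e i = nth 0 l i :> nat) -> sat phi e = nsat w phi l.
Proof.
have ext m (e' : 'I_m -> 'I_(size w)) l' x : (forall i, e' i = nth 0 l' i :> nat) ->
    forall i, extend x e' i = nth 0 (nat_of_ord x :: l') i :> nat.
  by move=> He i; rewrite /extend; case: unliftP => [j ->|->] //=; rewrite He.
elim: phi e l => {n} //= [n a i|n i j|n i j|n i j|n i|n i|n f IH|n f IHf g IHg
  |n f IHf g IHg|n f IH|n f IH] e l He; rewrite -?He //.
- by rewrite (tnth_nth a) (onth_some a).
- by rewrite (IH _ l).
- by rewrite (IHf _ l) // (IHg _ l).
- by rewrite (IHf _ l) // (IHg _ l).
- apply/existsP/hasP => [[x Hx]|[x]].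
    exists (val x); first by rewrite mem_iota ltn_ord.
    by rewrite -(IH _ (val x :: l) (ext _ _ _ _ He)).
  rewrite mem_iota => /= ltx Hx; exists (Ordinal ltx).
  by rewrite (IH _ (x :: l) (ext _ _ _ (Ordinal ltx) He)).
- apply/forallP/allP => [H x|H x].
    rewrite mem_iota => /= ltx.
    by rewrite -(IH _ (x :: l) (ext _ _ _ (Ordinal ltx) He)).
  rewrite (IH _ (val x :: l) (ext _ _ _ _ He)); apply: H.
  by rewrite mem_iota ltn_ord.
Qed.

Lemma models_nsat w phi : models phi w = nsat w phi [::].
Proof. by apply: sat_nsat => -[]. Qed.

(** Equality of the atomic types of two tuples. Equality of positions is not listed: it follows from
    the two strict comparisons. *)
Definition agree w l w' l' := size l = size l' /\
  forall i, i < size l ->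
    [/\ onth w (nth 0 l i) = onth w' (nth 0 l' i),
        (nth 0 l i == 0) = (nth 0 l' i == 0),
        ((nth 0 l i).+1 == size w) = ((nth 0 l' i).+1 == size w') &
        forall j, j < size l ->
          (nth 0 l i < nth 0 l j) = (nth 0 l' i < nth 0 l' j) /\
          (nth 0 l j == (nth 0 l i).+1) = (nth 0 l' j == (nth 0 l' i).+1)].

Lemma agree_qf w l w' l' n (phi : formula A n) :
  agree w l w' l' -> n <= size l -> quantifier_free phi ->
  nsat w phi l = nsat w' phi l'.
Proof.
move=> [sz H]; elim: phi => {n} //= [n a i|n i j|n i j|n i j|n i|n i|n f IH|n f IHf g IHg
  |n f IHf g IHg] len.
- by have [-> _ _ _] := H i (leq_trans (ltn_ord i) len).
- have Hi := leq_trans (ltn_ord i) len; have Hj := leq_trans (ltn_ord j) len.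
  have [_ _ _ /(_ _ Hj)[E _]] := H i Hi; have [_ _ _ /(_ _ Hi)[E' _]] := H j Hj.
  rewrite !eqn_leq (leqNgt (nth 0 l i)) (leqNgt (nth 0 l j)).
  by rewrite (leqNgt (nth 0 l' i)) (leqNgt (nth 0 l' j)) E E'.
- have Hi := leq_trans (ltn_ord i) len; have Hj := leq_trans (ltn_ord j) len.
  by have [_ _ _ /(_ _ Hj)[E _]] := H i Hi.
- have Hi := leq_trans (ltn_ord i) len; have Hj := leq_trans (ltn_ord j) len.
  by have [_ _ _ /(_ _ Hj)[_ E]] := H i Hi.
- by have [_ -> _ _] := H i (leq_trans (ltn_ord i) len).
- by have [_ _ -> _] := H i (leq_trans (ltn_ord i) len).
- by move=> /IH ->.
- by move=> /andP[/IHf-> // /IHg->].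
- by move=> /andP[/IHf-> // /IHg->].
Qed.

Definition pts w n xs := size xs = n /\ forall x, x \in xs -> x < size w.

Lemma pts_cons w n x xs : pts w n.+1 (x :: xs) <-> x < size w /\ pts w n xs.
Proof.
split=> [[[sz] H]|[ltx [<- H]]].
  by split; [apply: H; rewrite mem_head | split=> // y Hy; apply: H; rewrite inE Hy orbT].
by split=> // y; rewrite inE => /orP[/eqP->|/H].
Qed.

Lemma pts_cat w n m xs ys : pts w n xs -> pts w m ys -> pts w (n + m) (xs ++ ys).
Proof.
move=> [<- H] [<- H']; split; first by rewrite size_cat.
by move=> x; rewrite mem_cat => /orP[/H|/H'].
Qed.

Lemma pts_take w n m xs : pts w (n + m) xs -> pts w n (take n xs).
Proof.
move=> [sz H]; split; first by rewrite size_takel // sz leq_addr.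
by move=> x /mem_take/H.
Qed.

Lemma pts_drop w n m xs : pts w (n + m) xs -> pts w m (drop n xs).
Proof.
move=> [sz H]; split; first by rewrite size_drop sz addKn.
by move=> x /mem_drop/H.
Qed.

Lemma pts_ex w n : w != [::] -> exists xs, pts w n xs.
Proof.
move=> w0; exists (nseq n 0); split; first by rewrite size_nseq.
by move=> x /nseqP[-> _]; rewrite lt0n size_eq0.
Qed.

(* One Ehrenfeucht-Fraisse round with [n] pebbles on [w] followed by one round
   with [m] pebbles on [w']. *)
Definition game n m w w' := forall xs, pts w n xs -> exists2 ys, pts w' n ys &
  forall zs, pts w' m zs -> exists2 ts, pts w m ts & agree w (ts ++ xs) w' (zs ++ ys).

(** The arity [N] comes with an equation instead of being [m + n] itself, which spares casts between
    arities when a quantifier is removed. *)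
Lemma nsat_univ n (psi : formula A n) :
  prenex psi -> blocks psi = [::] \/ blocks psi = [:: Universal] ->
  exists m N (phi : formula A N), [/\ quantifier_free phi, N = m + n &
    forall w l, nsat w psi l <-> forall zs, pts w m zs -> nsat w phi (zs ++ l)].
Proof.
have qf k (f : formula A k) : quantifier_free f -> exists m N (phi : formula A N),
    [/\ quantifier_free phi, N = m + k &
    forall w l, nsat w f l <-> forall zs, pts w m zs -> nsat w phi (zs ++ l)].
  move=> qf; exists 0, k, f; split=> // w l; split=> [H [|? ?] []|/(_ [::])] //.
  by apply; split.
elim: psi => {n} [n|n|n a i|n i j|n i j|n i j|n i|n i|n f IH|n f IHf g IHg
  |n f IHf g IHg|n f IH|n f IH] pf bl; try by apply: qf.
  by move: bl => /=; case: (blocks f) => [|[] ?] [].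
rewrite /= in pf bl; have [|m [N [phi [qphi E H]]]] := IH pf.
  by case: (blocks f) bl => [|[] [|? ?]] [] //; [left | right].
exists m.+1, N, phi; split=> //; first by rewrite E addnS.
move=> w l; split=> [Hall|Hall].
  elim/last_ind=> [|zs x _] [] //; rewrite size_rcons => -[szs] Hzs.
  have ltx : x < size w by apply: Hzs; rewrite mem_rcons mem_head.
  have /(allP Hall)/H : x \in iota 0 (size w) by rewrite mem_iota.
  rewrite cat_rcons; apply.
  by split=> // y Hy; apply: Hzs; rewrite mem_rcons inE Hy orbT.
apply/allP => x; rewrite mem_iota => /= ltx; apply/H => zs [szs Hzs].
rewrite -cat_rcons; apply: Hall; split; first by rewrite size_rcons szs.
by move=> y; rewrite mem_rcons inE => /orP[/eqP->|/Hzs].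
Qed.

Definition sigma2_blocks (bs : seq quantifier) :=
  bs = [:: Existential; Universal] \/ size bs <= 1.

Lemma nsat_sigma2 n (psi : formula A n) : prenex psi -> sigma2_blocks (blocks psi) ->
  exists k m N (phi : formula A N), [/\ quantifier_free phi, N = m + (k + n) &
    forall w l, nsat w psi l <-> exists2 xs, pts w k xs &
      forall zs, pts w m zs -> nsat w phi (zs ++ xs ++ l)].
Proof.
have univ k (f : formula A k) : prenex f ->
    blocks f = [::] \/ blocks f = [:: Universal] ->
    exists k' m N (phi : formula A N), [/\ quantifier_free phi, N = m + (k' + k) &
    forall w l, nsat w f l <-> exists2 xs, pts w k' xs &
      forall zs, pts w m zs -> nsat w phi (zs ++ xs ++ l)].
  move=> pf bl; have [m [N [phi [qphi E H]]]] := nsat_univ pf bl.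
  exists 0, m, N, phi; split=> // w l; split=> [/H Hf|[[|? ?] [] // _ _ Hf]].
    by exists [::] => //; split.
  exact/H.
elim: psi => {n} [n|n|n a i|n i j|n i j|n i j|n i|n i|n f IH|n f IHf g IHg
  |n f IHf g IHg|n f IH|n f IH] pf bl; try by apply: univ => //; left.
  rewrite /= in pf bl; have [|k [m [N [phi [qphi E H]]]]] := IH pf.
    by case: (blocks f) bl => [|[] [|b r]] //= bl; first [by right | by case: bl => // -[]].
  exists k.+1, m, N, phi; split=> //; first by rewrite E addnS.
  move=> w l; split=> [/hasP[x]|[xs]].
    rewrite mem_iota => /= ltx /H[xs [sxs Hxs] Hf]; exists (rcons xs x).
      split; first by rewrite size_rcons sxs.
      by move=> y; rewrite mem_rcons inE => /orP[/eqP->|/Hxs].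
    by move=> zs Hzs; rewrite cat_rcons; apply: Hf.
  case: (lastP xs) => [[]|{}xs x [sxs Hxs] Hf] //.
  have ltx : x < size w by apply: Hxs; rewrite mem_rcons mem_head.
  apply/hasP; exists x; first by rewrite mem_iota.
  apply/H; exists xs.
    split; first by move: sxs; rewrite size_rcons => -[].
    by move=> y Hy; apply: Hxs; rewrite mem_rcons inE Hy orbT.
  by move=> zs Hzs; rewrite -cat_rcons; apply: Hf.
apply: univ => //=; move: bl => /=.
by case: (blocks f) => [|[] [|b r]] /= bl; first [by right | by case: bl => // -[]].
Qed.

Lemma Sigma2_game (phi : formula A 0) : Sigma2 phi -> exists n m, forall w w',
  w != [::] -> w' != [::] -> game n m w w' -> models phi w -> models phi w'.
Proof.
case=> psi [ppsi Epsi] bl; have [k [m [N [chi [qchi EN H]]]]] := nsat_sigma2 ppsi bl.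
exists k, m => w w' w0 w'0 gww'.
rewrite /models (Epsi w) ?(Epsi w'); try exact/eqP.
rewrite !(@sat_nsat _ _ _ _ [::]); try by case.
move=> /H[xs Hpx Hxs]; have [ys Hys Hww'] := gww' _ Hpx.
apply/H; exists ys => // zs /Hww'[ts Hts agr].
rewrite !cats0 in Hxs *; rewrite -(agree_qf agr) //; first exact: Hxs.
by have [[sz _] [sz' _]] := (Hts, Hpx); rewrite size_cat sz sz' EN addn0.
Qed.

End Logic.

(** * Definability of the upward closed languages *)

Lemma agree_sub (A : eqType) (w w' : seq A) l l' (h : nat -> nat) l1 l1' :
  agree w l w' l' -> size l1 = size l1' ->
  (forall i, i < size l1 -> h i < size l) ->
  (forall i, i < size l1 -> nth 0 l1 i = nth 0 l (h i)) ->
  (forall i, i < size l1 -> nth 0 l1' i = nth 0 l' (h i)) ->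
  agree w l1 w' l1'.
Proof.
move=> [sz H] sz1 hlt E E'; split=> // i lti.
rewrite !E // !E' //; have [H1 H2 H3 H4] := H _ (hlt i lti).
by split=> // j ltj; rewrite !E // !E' //; apply: H4; apply: hlt.
Qed.

Section Definability.
Variable A : finType.
Implicit Types (w : seq A) (l xs ys zs ts : seq nat) (K : seq A -> Prop).

(** A semantic normal form whose matrix is any relation invariant under [agree]. Boolean operations
    then split and join tuples without touching the syntax. Only nonempty words are constrained. *)
Definition sigma2_def K := exists n m (P : seq A -> seq nat -> seq nat -> Prop),
  (forall w xs zs w' xs' zs', size xs = n -> size xs' = n ->
     size zs = m -> size zs' = m ->
     agree w (zs ++ xs) w' (zs' ++ xs') -> P w xs zs -> P w' xs' zs') /\
  forall w, w != [::] -> K w <->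
    exists2 xs, pts w n xs & forall zs, pts w m zs -> P w xs zs.

Lemma agree_parts w w' n1 n2 m1 m2 xs xs' zs zs' :
  size xs = n1 + n2 -> size xs' = n1 + n2 ->
  size zs = m1 + m2 -> size zs' = m1 + m2 ->
  agree w (zs ++ xs) w' (zs' ++ xs') ->
  agree w (take m1 zs ++ take n1 xs) w' (take m1 zs' ++ take n1 xs') /\
  agree w (drop m1 zs ++ drop n1 xs) w' (drop m1 zs' ++ drop n1 xs').
Proof.
move=> szx szx' szz szz' agr.
have [s1 s2 s3 s4] : [/\ size (take m1 zs) = m1, size (take n1 xs) = n1,
    size (take m1 zs') = m1 & size (take n1 xs') = n1].
  by rewrite !size_takel // ?szz ?szx ?szz' ?szx' leq_addr.
have [d1 d2 d3 d4] : [/\ size (drop m1 zs) = m2, size (drop n1 xs) = n2,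
    size (drop m1 zs') = m2 & size (drop n1 xs') = n2].
  by rewrite !size_drop ?szz ?szx ?szz' ?szx' !addKn.
split.
  apply: (agree_sub (h := fun i => if i < m1 then i else i + m2) agr);
    rewrite !size_cat ?s1 ?s2 ?s3 ?s4 ?szz ?szx // => i lti /=.
  - by case: (ltnP i m1) => ?; lia.
  - rewrite !nth_cat s1 szz; have [lt|le] := ltnP i m1.
      by rewrite nth_take // ltn_addr.
    have -> : (i + m2 < m1 + m2) = false by lia.
    by rewrite nth_take; [congr (nth _ _ _); lia | lia].
  - rewrite !nth_cat s3 szz'; have [lt|le] := ltnP i m1.
      by rewrite nth_take // ltn_addr.
    have -> : (i + m2 < m1 + m2) = false by lia.
    by rewrite nth_take; [congr (nth _ _ _); lia | lia].
apply: (agree_sub (h := fun i => if i < m2 then m1 + i else m1 + n1 + i) agr);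
  rewrite !size_cat ?d1 ?d2 ?d3 ?d4 ?szz ?szx // => i lti /=.
- by case: (ltnP i m2) => ?; lia.
- rewrite !nth_cat d1 szz; have [lt|le] := ltnP i m2.
    by rewrite nth_drop // ltn_add2l lt.
  have -> : (m1 + n1 + i < m1 + m2) = false by lia.
  by rewrite nth_drop; congr (nth _ _ _); lia.
- rewrite !nth_cat d3 szz'; have [lt|le] := ltnP i m2.
    by rewrite nth_drop // ltn_add2l lt.
  have -> : (m1 + n1 + i < m1 + m2) = false by lia.
  by rewrite nth_drop; congr (nth _ _ _); lia.
Qed.

Lemma sigma2_def_or K1 K2 : sigma2_def K1 -> sigma2_def K2 ->
  sigma2_def (fun w => K1 w \/ K2 w).
Proof.
move=> [n1 [m1 [P1 [inv1 H1]]]] [n2 [m2 [P2 [inv2 H2]]]].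
exists (n1 + n2), (m1 + m2), (fun w xs zs => P1 w (take n1 xs) (take m1 zs) \/
  P2 w (drop n1 xs) (drop m1 zs)); split.
  move=> w xs zs w' xs' zs' sx sx' sz sz' /(agree_parts sx sx' sz sz')[a1 a2].
  by case=> [P1w|P2w]; [left; apply: inv1 P1w | right; apply: inv2 P2w] => //;
     rewrite ?size_takel ?size_drop ?sx ?sx' ?sz ?sz' ?addKn ?leq_addr.
move=> w w0; rewrite H1 // H2 //; split.
  case=> -[xs Hxs Hall].
    have [ys Hys] := pts_ex n2 w0; exists (xs ++ ys); first exact: pts_cat.
    move=> zs Hzs; left; rewrite take_size_cat; last by case: Hxs.
    by apply: Hall; apply: pts_take Hzs.
  have [ys Hys] := pts_ex n1 w0; exists (ys ++ xs); first exact: pts_cat.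
  move=> zs Hzs; right; rewrite drop_size_cat; last by case: Hys.
  by apply: Hall; apply: pts_drop Hzs.
case=> xs Hxs Hall.
(* If some tuple [z1] refutes the first matrix, then pairing it with an arbitrary [zs] forces the
   second matrix on [zs]. *)
have [Hall1|/existsNP[z1 /not_implyP[Hz1 N1]]] :=
  EM (forall zs, pts w m1 zs -> P1 w (take n1 xs) zs).
  by left; exists (take n1 xs) => //; apply: pts_take Hxs.
right; exists (drop n1 xs); first exact: pts_drop Hxs.
move=> zs Hzs; case: (Hall (z1 ++ zs)); first exact: pts_cat.
  by rewrite take_size_cat //; case: Hz1.
by rewrite drop_size_cat //; case: Hz1.
Qed.

Lemma sigma2_def_and K1 K2 : sigma2_def K1 -> sigma2_def K2 ->
  sigma2_def (fun w => K1 w /\ K2 w).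
Proof.
move=> [n1 [m1 [P1 [inv1 H1]]]] [n2 [m2 [P2 [inv2 H2]]]].
exists (n1 + n2), (m1 + m2), (fun w xs zs => P1 w (take n1 xs) (take m1 zs) /\
  P2 w (drop n1 xs) (drop m1 zs)); split.
  move=> w xs zs w' xs' zs' sx sx' sz sz' /(agree_parts sx sx' sz sz')[a1 a2].
  by case=> P1w P2w; split; [apply: inv1 P1w | apply: inv2 P2w] => //;
     rewrite ?size_takel ?size_drop ?sx ?sx' ?sz ?sz' ?addKn ?leq_addr.
move=> w w0; rewrite H1 // H2 //; split.
  case=> -[xs Hxs Hall] [ys Hys Hall2]; exists (xs ++ ys); first exact: pts_cat.
  move=> zs Hzs; rewrite take_size_cat ?drop_size_cat; try by case: Hxs.
  by split; [apply: Hall; apply: pts_take Hzs | apply: Hall2; apply: pts_drop Hzs].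
case=> xs Hxs Hall; split.
  exists (take n1 xs); first exact: pts_take Hxs.
  move=> zs Hzs; have [ys Hys] := pts_ex m2 w0.
  have [] := Hall (zs ++ ys); first exact: pts_cat.
  by rewrite take_size_cat //; case: Hzs.
exists (drop n1 xs); first exact: pts_drop Hxs.
move=> zs Hzs; have [ys Hys] := pts_ex m1 w0.
have [] := Hall (ys ++ zs); first exact: pts_cat.
by rewrite drop_size_cat //; case: Hys.
Qed.

Lemma sigma2_def_const (P : Prop) : sigma2_def (fun _ => P).
Proof.
exists 0, 0, (fun _ _ _ => P); split=> // w _; split=> [p|[xs _ /(_ [::])]].
  by exists [::].
by apply.
Qed.

Lemma sigma2_def_ext K1 K2 : (forall w, w != [::] -> K1 w <-> K2 w) ->
  sigma2_def K1 -> sigma2_def K2.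
Proof.
by move=> E [n [m [P [inv H]]]]; exists n, m, P; split=> // w w0; rewrite -E // H.
Qed.

Lemma sigma2_def_ex (I : finType) (K : I -> seq A -> Prop) :
  (forall i, sigma2_def (K i)) -> sigma2_def (fun w => exists i, K i w).
Proof.
move=> HK; suff H (s : seq I) : sigma2_def (fun w => exists2 i, i \in s & K i w).
  apply: sigma2_def_ext (H (enum I)) => w _; split=> [[i _]|[i]]; first by exists i.
  by exists i; rewrite // mem_enum.
elim: s => [|i s IH].
  by apply: sigma2_def_ext (sigma2_def_const False) => w _; split=> // -[].
apply: sigma2_def_ext (sigma2_def_or (HK i) IH) => w _; split.
  case=> [Ki|[j js Kj]]; first by exists i; rewrite ?mem_head.
  by exists j; rewrite // inE js orbT.
by case=> j; rewrite inE => /orP[/eqP->|js] Kj; [left | right; exists j].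
Qed.

Lemma sigma2_def_all (I : finType) (K : I -> seq A -> Prop) :
  (forall i, sigma2_def (K i)) -> sigma2_def (fun w => forall i, K i w).
Proof.
move=> HK; suff H (s : seq I) : sigma2_def (fun w => forall i, i \in s -> K i w).
  apply: sigma2_def_ext (H (enum I)) => w _; split=> H' i; last by move=> _.
  by apply: H'; rewrite mem_enum.
elim: s => [|i s IH].
  by apply: sigma2_def_ext (sigma2_def_const True) => w _; split.
apply: sigma2_def_ext (sigma2_def_and (HK i) IH) => w _; split.
  by case=> Ki Ks j; rewrite inE => /orP[/eqP->|/Ks].
by move=> H'; split=> [|j js]; apply: H'; rewrite inE ?eqxx ?js ?orbT.
Qed.

(** * Atomic types and their defining formulas *)

Definition atom (n : nat) : finType :=
  (A * 'I_n + ('I_n * 'I_n + 'I_n * 'I_n) + ('I_n + 'I_n))%type.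

Definition atom_formula n (x : atom n) : formula A n :=
  match x with
  | inl (inl (a, i)) => FLetter a i
  | inl (inr (inl (i, j))) => FLt A i j
  | inl (inr (inr (i, j))) => FSucc A i j
  | inr (inl i) => FMin A i
  | inr (inr i) => FMax A i
  end.

Definition atomic_type n w l : {set atom n} :=
  [set x | nsat w (atom_formula x) l].

Lemma atom_formula_qf n (x : atom n) : quantifier_free (atom_formula x).
Proof. by case: x => [[[]|[[]|[]]]|[]]. Qed.

Lemma atomic_type_agree n w l w' l' : size l = n -> size l' = n ->
  (forall x, x \in l -> x < size w) ->
  atomic_type n w l = atomic_type n w' l' -> agree w l w' l'.
Proof.
move=> szl szl' Hl E; split=> [|i lti]; first by rewrite szl.
have at_eq (x : atom n) : nsat w (atom_formula x) l = nsat w' (atom_formula x) l'.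
  by move/setP/(_ x): E; rewrite !inE.
have ltw : nth 0 l i < size w by apply: Hl; rewrite mem_nth.
rewrite szl in lti *; pose I := Ordinal lti; split.
- case: w => [|x0 w] // in Hl E at_eq ltw *.
  have := at_eq (inl (inl (nth x0 (x0 :: w) (nth 0 l i), I))).
  by rewrite [LHS]/= (onth_some x0 ltw) eqxx => /esym/eqP ->.
- exact: at_eq (inr (inl I)).
- exact: at_eq (inr (inr I)).
move=> j ltj; pose J := Ordinal ltj.
by split; [exact: at_eq (inl (inr (inl (I, J)))) | exact: at_eq (inl (inr (inr (I, J))))].
Qed.

Definition type_formula n (t : {set atom n}) : formula A n :=
  foldr (fun x f => FAnd (if x \in t then atom_formula x else FNot (atom_formula x)) f)
    (FTrue A n) (enum (atom n)).

Lemma nsat_type_formula n w l (t : {set atom n}) :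
  nsat w (type_formula t) l = (t == atomic_type n w l).
Proof.
rewrite /type_formula; transitivity (all (fun x => (x \in t) == nsat w (atom_formula x) l)
    (enum (atom n))).
  by elim: (enum _) => //= x s ->; case: (x \in t) => //=; case: (nsat _ _ _).
apply/allP/eqP => [H|-> x _]; last by rewrite inE.
by apply/setP => x; rewrite inE; apply/eqP/H; rewrite mem_enum.
Qed.

Definition types_formula n (Q : pred {set atom n}) : formula A n :=
  foldr (fun t f => FOr (type_formula t) f) (FFalse A n) (enum Q).

Lemma nsat_types_formula n w l Q :
  nsat w (@types_formula n Q) l = Q (atomic_type n w l).
Proof.
rewrite /types_formula; transitivity (atomic_type n w l \in enum Q).
  by elim: (enum Q) => //= t s IH; rewrite IH inE nsat_type_formula eq_sym.
by rewrite mem_enum.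
Qed.

Lemma types_formula_qf n Q : quantifier_free (@types_formula n Q).
Proof.
rewrite /types_formula; elim: (enum Q) => //= t s ->; rewrite andbT /type_formula.
elim: (enum _) => //= x r ->; rewrite andbT.
by case: ifP => _; apply: atom_formula_qf.
Qed.

Fixpoint close_all (m n : nat) : formula A (m + n) -> formula A n :=
  if m is m'.+1 then fun phi => close_all (FAll phi : formula A (m' + n)) else id.

Fixpoint close_ex (n : nat) : formula A n -> formula A 0 :=
  if n is n'.+1 then fun phi => close_ex (FEx phi) else id.

Lemma nsat_close_all m n (phi : formula A (m + n)) w l :
  nsat w (close_all phi) l <-> forall zs, pts w m zs -> nsat w phi (zs ++ l).
Proof.
elim: m phi l => [|m IH] phi l /=.
  by split=> [H [|? ?] []|/(_ [::])] //; apply; split.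
rewrite IH; split=> [H [|z zs]|H zs Hzs].
- by case.
- by move=> /pts_cons[ltz /H /= /allP]; apply; rewrite mem_iota.
- apply/allP => z; rewrite mem_iota => /= ltz; apply: (H (z :: zs)).
  exact/pts_cons.
Qed.

Lemma nsat_close_ex n (phi : formula A n) w :
  nsat w (close_ex phi) [::] <-> exists2 xs, pts w n xs & nsat w phi xs.
Proof.
elim: n phi => [|n IH] phi /=.
  by split=> [H|[[|? ?] []]] //; exists [::].
rewrite IH; split=> [[xs Hxs /= /hasP[x]]|[[|x xs]]].
- by rewrite mem_iota => /= ltx Hx; exists (x :: xs) => //; apply/pts_cons.
- by case.
- move=> /pts_cons[ltx Hxs] Hx; exists xs => //=; apply/hasP; exists x => //.
  by rewrite mem_iota.
Qed.

Lemma close_all_prenex m n (phi : formula A (m + n)) : prenex phi -> prenex (close_all phi).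
Proof. by elim: m phi => //= m IH phi pphi; apply: IH. Qed.

Lemma close_ex_prenex n (phi : formula A n) : prenex phi -> prenex (close_ex phi).
Proof. by elim: n phi => //= n IH phi pphi; apply: IH. Qed.

Lemma qf_prenex n (phi : formula A n) : quantifier_free phi ->
  prenex phi /\ blocks phi = [::].
Proof. by case: phi. Qed.

Lemma close_all_blocks m n (phi : formula A (m + n)) :
  blocks phi = [::] \/ blocks phi = [:: Universal] ->
  blocks (close_all phi) = [::] \/ blocks (close_all phi) = [:: Universal].
Proof. by elim: m phi => //= m IH phi bl; apply: IH => /=; right; case: bl => ->. Qed.

Lemma close_ex_blocks n (phi : formula A n) :
  sigma2_blocks (blocks phi) -> sigma2_blocks (blocks (close_ex phi)).
Proof.
elim: n phi => //= n IH phi bl; apply: IH; rewrite /sigma2_blocks /=.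
case: (blocks phi) bl => [|[] [|b r]] //= bl; first [by left | by right | by case: bl => // -[]].
Qed.

(** The matrix becomes the finite disjunction of the atomic types of tuples that satisfy [P] in some
    nonempty word; invariance under [agree] makes it equivalent to [P]. *)
Theorem sigma2_def_Sigma2 K : sigma2_def K ->
  exists2 phi : formula A 0, Sigma2 phi & forall w, models phi w <-> K w.
Proof.
move=> [n [m [P [inv H]]]].
pose Q (b : {set atom (m + n)}) := `[< exists w xs zs,
  [/\ w != [::], pts w n xs, pts w m zs, P w xs zs & atomic_type (m + n) w (zs ++ xs) = b] >].
pose psi := close_ex (close_all (types_formula Q)).
have psiE w : w != [::] -> nsat w psi [::] <-> K w.
  move=> w0; rewrite H // nsat_close_ex; split=> -[xs Hxs Hall]; exists xs => //.
    move=> zs Hzs; have := (nsat_close_all (types_formula Q) w xs).1 Hall zs Hzs.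
    rewrite nsat_types_formula => /asboolP[w' [xs' [zs' [w'0 Hxs' Hzs' Pw' E]]]].
    apply: inv Pw'; try by [case: Hxs | case: Hzs | case: Hxs' | case: Hzs'].
    have [sz _] := pts_cat Hzs Hxs; have [sz' lt'] := pts_cat Hzs' Hxs'.
    exact: atomic_type_agree E.
  apply/nsat_close_all => zs Hzs; rewrite nsat_types_formula; apply/asboolP.
  by exists w, xs, zs; split=> //; apply: Hall.
have ppsi : prenex psi.
  apply/close_ex_prenex/close_all_prenex.
  by have [] := qf_prenex (types_formula_qf Q).
have bpsi : blocks psi = [:: Existential; Universal] \/ size (blocks psi) <= 1.
  apply: close_ex_blocks; have [_ bl] := qf_prenex (types_formula_qf Q).
  by have [|->|->] := @close_all_blocks m n (types_formula Q); [left| right | right].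
have sig phi : (forall w (e : 'I_0 -> 'I_(size w)), w <> [::] -> sat phi e = sat psi e) ->
    Sigma2 phi by exists psi.
have no_ex w : has (fun x => true) (iota 0 (size w)) = (w != [::]).
  by case: w.
(* The empty word is added or removed by a Boolean combination with the existence of a position. On
   nonempty words the result is equivalent to [psi], which therefore is its prenex normal form. *)
have [K0|nK0] := EM (K [::]).
  exists (FOr psi (FNot (FEx (FTrue A 1)))).
    apply: sig => w e /eqP w0; rewrite !(@sat_nsat _ _ _ _ e [::]); try by case.
    by rewrite /= no_ex w0 orbF.
  move=> w; rewrite models_nsat /= no_ex; have [->|w0] := eqVneq w [::].
    by rewrite orbT.
  by rewrite orbF psiE.
exists (FAnd psi (FEx (FTrue A 1))).
  apply: sig => w e /eqP w0; rewrite !(@sat_nsat _ _ _ _ e [::]); try by case.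
  by rewrite /= no_ex w0 andbT.
move=> w; rewrite models_nsat /= no_ex; have [->|w0] := eqVneq w [::].
  by rewrite andbF; split.
by rewrite andbT psiE.
Qed.

(** [X w xs] collects the atomic types reachable in the second round after [xs], and [tau w]
    collects these sets. Each [basic Y] is definable, and a nonempty word that satisfies [basic Y]
    for all [Y] in [tau v] is above [v] in the game. As there are finitely many [tau v], the set [K]
    is a finite union of finite intersections of basic properties. *)
Theorem game_closed_Sigma2 n m K :
  (forall w w', w != [::] -> w' != [::] -> game n m w w' -> K w -> K w') ->
  exists2 phi : formula A 0, Sigma2 phi & forall w, models phi w <-> K w.
Proof.
move=> up; apply: sigma2_def_Sigma2.
pose X w xs : {set {set atom (m + n)}} :=
  [set b | `[< exists2 ts, pts w m ts & atomic_type (m + n) w (ts ++ xs) = b >]].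
pose tau w : {set {set {set atom (m + n)}}} :=
  [set Y | `[< exists2 xs, pts w n xs & X w xs = Y >]].
pose basic (Y : {set {set atom (m + n)}}) w' := exists2 ys, pts w' n ys &
  forall zs, pts w' m zs -> atomic_type (m + n) w' (zs ++ ys) \in Y.
have bdef Y : sigma2_def (basic Y).
  exists n, m, (fun w xs zs => atomic_type (m + n) w (zs ++ xs) \in Y); split=> //.
  move=> w xs zs w' xs' zs' sx sx' sz sz' agr.
  suff -> : atomic_type (m + n) w (zs ++ xs) = atomic_type (m + n) w' (zs' ++ xs') by [].
  apply/setP => x; rewrite !inE; apply: agree_qf agr _ (atom_formula_qf x).
  by rewrite size_cat sx sz.
pose good (t : {set {set {set atom (m + n)}}}) := exists w, [/\ w != [::], K w & tau w = t].
apply: sigma2_def_ext (sigma2_def_ex (K := fun t w => good t /\ forall Y, Y \in t -> basic Y w) _); last first.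
  move=> t; apply: sigma2_def_and; first exact: sigma2_def_const.
  apply: (sigma2_def_all (K := fun Y w => Y \in t -> basic Y w)) => Y.
  case: (Y \in t); last by apply: sigma2_def_ext (sigma2_def_const True) => w _; split.
  by apply: sigma2_def_ext (bdef Y) => w _; split=> // /(_ isT).
move=> w w0; split=> [[_ [[v [v0 Kv <-]] Hv]]|Kw]; last first.
  exists (tau w); split; first by exists w.
  move=> Y; rewrite inE => /asboolP[xs Hxs <-]; exists xs => // zs Hzs.
  by rewrite inE; apply/asboolP; exists zs.
apply: (up v) => // xs Hxs; have [|ys Hys Hall] := Hv (X v xs).
  by rewrite inE; apply/asboolP; exists xs.
exists ys => // zs Hzs; have := Hall zs Hzs; rewrite inE => /asboolP[ts Hts E].
exists ts => //; have [sz lt] := pts_cat Hts Hxs; have [sz' _] := pts_cat Hzs Hys.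
exact: atomic_type_agree E.
Qed.

End Definability.

(** * Embeddings of marked words *)

Section Embedding.
Variables (G : eqType) (x0 : G).
Implicit Types (U V l : seq G) (ds : seq (seq G * G)) (J : seq nat).

Definition embeds (D : nat -> Prop) (h : nat -> nat) V U :=
  (forall j, D j -> h j < size U /\ nth x0 U (h j) = nth x0 V j) /\
  (forall i j, D i -> D j -> i < j -> h i < h j).

Lemma subseq_embeds t U : subseq t U ->
  exists h, embeds (fun i => i < size t) h t U.
Proof.
elim: U t => [|x U IH] [|y t] //=; try by exists id; split.
case: eqP => [->|_] /IH[h [H1 H2]]; last first.
  exists (fun i => (h i).+1); split=> [j Hj|i j Hi Hj ltij]; first exact: H1.
  by rewrite ltnS; apply: H2.
exists (fun i => if i is i'.+1 then (h i').+1 else 0); split=> [[|j] Hj|[|i] [|j]] //=.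
  exact: (H1 j).
by move=> Hi Hj lt; apply: (H2 i j).
Qed.

Lemma subk_embeds k V l J : subk k V l -> (forall j, j \in J -> j < size V) ->
  size J <= k -> exists h, embeds (fun j => j \in J) h V l.
Proof.
move=> Hk HJ szJ; pose s := [seq j <- iota 0 (size V) | j \in J].
have us : uniq s by rewrite filter_uniq // iota_uniq.
have ss : sorted ltn s by apply: sorted_filter (iota_ltn_sorted _ _); apply: ltn_trans.
have mem_s j : (j \in s) = (j \in J).
  by rewrite mem_filter mem_iota; case: (boolP (j \in J)) => //= /HJ.
have sub : subseq (map (nth x0 V) s) V.
  by rewrite -[X in subseq _ X](mkseq_nth x0 V); apply/map_subseq/filter_subseq.
have [|f [Hf1 Hf2]] := subseq_embeds (Hk _ sub _).
  by rewrite size_map (leq_trans _ szJ) // uniq_leq_size // => j; rewrite mem_s.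
rewrite size_map in Hf1 Hf2.
exists (fun j => f (index j s)); split=> [j|i j]; rewrite -!mem_s => Hj.
  have lt : index j s < size s by rewrite index_mem.
  by have [-> ->] := Hf1 _ lt; rewrite (nth_map 0) // nth_index.
move=> Hj' ltij; apply: Hf2; rewrite ?index_mem //.
rewrite ltnNge; apply/negP => le.
have := sorted_leq_nth leq_trans leqnn 0 (sub_sorted _ ss) (index j s) (index i s).
rewrite !inE !index_mem !nth_index // => /(_ (fun x y => @ltnW x y) Hj' Hj le).
by rewrite leqNgt ltij.
Qed.

Fixpoint marks ds : seq nat :=
  if ds is (g, _) :: ds' then size g :: map (addn (size g).+1) (marks ds') else [::].

Lemma size_marks ds : size (marks ds) = size ds.
Proof. by elim: ds => //= [[g a] ds /= IH]; rewrite size_map IH. Qed.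

Lemma marks_lt ds l i : i \in marks ds -> i < size (plug ds l).
Proof.
elim: ds i => //= [[g a] ds IH] i; rewrite inE size_cat /= => /orP[/eqP->|].
  by rewrite -[X in X < _]addn0 ltn_add2l.
by case/mapP => j /IH lt ->; rewrite addSnnS ltn_add2l.
Qed.

(** The order of quantifiers is that of the game: the marks of [V] are fixed before the further
    positions [J] are chosen. The embedding [h] depends on [J], but always sends marks to marks in
    order. *)
Lemma fits_embeds k ds l V : fits k ds l V ->
  exists ds' l', [/\ V = plug ds' l', size ds' = size ds &
    forall J, (forall j, j \in J -> j < size V) -> size J <= k ->
    exists h, embeds (fun j => j \in J \/ j \in marks ds') h V (plug ds l) /\
      map h (marks ds') = marks ds].
Proof.
elim: ds V => [|[g a] ds IH] V /=.
  move=> Hk; exists [::], V; split=> // J HJ szJ.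
  have [h [H1 H2]] := subk_embeds Hk HJ szJ; exists h; split=> //; split.
    by move=> j [/H1|].
  by move=> i j [Hi|//] [Hj|//]; apply: H2.
case=> V1 [V2 [-> Hk /IH[ds' [l' [EV2 szds HV2]]]]].
exists ((V1, a) :: ds'), l'; rewrite /= EV2 szds; split=> // J HJ szJ.
pose J1 := [seq j <- J | j < size V1].
pose J2 := [seq j - (size V1).+1 | j <- J & size V1 < j].
have [||h1 [H11 H12]] := @subk_embeds k V1 g J1 Hk.
- by move=> j; rewrite mem_filter => /andP[].
- by rewrite size_filter (leq_trans (count_size _ _)).
have [||h2 [[H21 H22] H23]] := HV2 J2.
- move=> _ /mapP[j + ->]; rewrite mem_filter => /andP[lt /HJ].
  by rewrite size_cat /= EV2; lia.
- by rewrite size_map size_filter (leq_trans (count_size _ _)).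
pose h j := if j < size V1 then h1 j else if j == size V1 then size g
  else (size g).+1 + h2 (j - (size V1).+1).
have D j : j \in J \/ j \in size V1 :: map (addn (size V1).+1) (marks ds') ->
    [\/ j < size V1 /\ j \in J1, j = size V1 |
      size V1 < j /\ (j - (size V1).+1 \in J2 \/ j - (size V1).+1 \in marks ds')].
  case=> [Jj|].
    case: (ltngtP j (size V1)) => [lt|lt|]; last by constructor 2.
      by constructor 1; rewrite mem_filter lt.
    by constructor 3; split=> //; left; apply/mapP; exists j; rewrite // mem_filter lt.
  rewrite inE => /orP[/eqP|/mapP[i Hi ->]]; first by constructor 2.
  by constructor 3; rewrite addKn; split; [lia | right].
have h_lt j : j < size V1 -> h j = h1 j by rewrite /h => ->.
have h_eq : h (size V1) = size g by rewrite /h ltnn eqxx.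
have h_gt j : size V1 < j -> h j = (size g).+1 + h2 (j - (size V1).+1).
  by rewrite /h => lt; rewrite ltnNge ltnW //= gtn_eqF.
exists h; split; last first.
  rewrite h_eq -H23 -!map_comp; congr (_ :: _); apply/eq_map => i /=.
  by rewrite h_gt ?addKn //; lia.
split=> [j /D[[lt /H11[H3 H4]]|->|[lt /H21[H3 H4]]]|].
- by rewrite h_lt // !nth_cat lt H3 size_cat; split=> //; lia.
- by rewrite h_eq !nth_cat !ltnn !subnn size_cat /=; split=> //; lia.
- rewrite h_gt // !nth_cat size_cat /=; split; first by lia.
  have -> : ((size g).+1 + h2 (j - (size V1).+1) < size g) = false by lia.
  have -> : (j < size V1) = false by lia.
  have -> : (size g).+1 + h2 (j - (size V1).+1) - size g = (h2 (j - (size V1).+1)).+1.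
    by lia.
  have -> : j - size V1 = (j - (size V1).+1).+1 by lia.
  by rewrite /= H4 EV2.
move=> i j /D[[lti Hi]|->|[lti Hi]] /D[[ltj Hj]|->|[ltj Hj]] ltij; try lia.
- by rewrite !h_lt //; apply: H12.
- by rewrite h_lt // h_eq; have [] := H11 i Hi.
- by rewrite h_lt // h_gt //; have [] := H11 i Hi; lia.
- by rewrite h_eq h_gt //; lia.
- by rewrite !h_gt // ltn_add2l; apply: H22 => //; lia.
Qed.

Lemma mark_word (I : seq nat) U : exists ds l,
  U = plug ds l /\ marks ds = [seq i <- iota 0 (size U) | i \in I].
Proof.
suff H (m : pred nat) : exists ds l,
    U = plug ds l /\ marks ds = [seq i <- iota 0 (size U) | m i] by apply: H.
elim: U m => [|a U IH] m; first by exists [::], [::].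
have [ds [l [-> E]]] := IH (fun i => m i.+1).
have Em : [seq i <- iota 1 (size (plug ds l)) | m i] = map succn (marks ds).
  by rewrite E -[1]/(1 + 0) iotaDl filter_map.
rewrite /= Em; case: (m 0).
  by exists (([::], a) :: ds), l.
case: ds {E Em} => [|[g b] ds] /=; first by exists [::], (a :: l).
exists ((a :: g, b) :: ds), l; split=> //=; congr (_ :: _).
by rewrite -map_comp; apply: eq_map.
Qed.

(** When the marked word labels the positions listed in [cs], these are the positions under its
    marks. *)
Fixpoint marked ds (cs : seq nat) : seq nat :=
  if ds is (g, _) :: ds' then
    nth 0 cs (size g) :: marked ds' (drop (size g).+1 cs)
  else [::].

Lemma size_marked ds cs : size (marked ds cs) = size ds.
Proof. by elim: ds cs => //= [[g a] ds IH] cs /=; rewrite IH. Qed.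

Lemma sorted_ltn_cat (s1 s2 : seq nat) x : sorted ltn (s1 ++ x :: s2) ->
  [/\ forall y, y \in s1 -> y < x, forall y, y \in s2 -> x < y & sorted ltn s2].
Proof.
rewrite (sorted_pairwise ltn_trans) pairwise_cat /= => /and3P[/allrelP H _ /andP[/allP Hx H2]].
split; first by move=> y Hy; apply: H; rewrite ?mem_head.
  exact: Hx.
by rewrite (sorted_pairwise ltn_trans).
Qed.

Lemma marked_mem (f : nat -> G) ds l cs : plug ds l = map f cs ->
  {subset marked ds cs <= cs}.
Proof.
elim: ds cs => //= [[g a] ds IH] cs E y; rewrite inE.
have lt : size g < size cs.
  by rewrite -(size_map f) -E size_cat /= -addSnnS leq_addr.
case/orP=> [/eqP->|/IH H]; first by rewrite mem_nth.
apply: (@mem_drop (size g).+1); apply: H.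
by rewrite map_drop -E drop_cat ltnNge leqW //= subSnn /= drop0.
Qed.

(** The comparisons of a position with the marked ones determine its gap. For [k = 1] a gap fits as
    soon as each of its letters occurs in the corresponding gap, so one [c] for each [c']
    suffices. *)
Lemma fits_map (f f' : nat -> G) (pi : nat -> nat) ds l cs cs' :
  sorted ltn cs -> sorted ltn cs' -> plug ds l = map f cs ->
  (forall x, x \in marked ds cs -> pi x \in cs' /\ f' (pi x) = f x) ->
  (forall c', c' \in cs' -> exists c, [/\ c \in cs, f c = f' c' &
     forall x, x \in marked ds cs ->
       (x < c) = (pi x < c') /\ (c < x) = (c' < pi x)]) ->
  (forall x y, x \in marked ds cs -> y \in marked ds cs -> x < y -> pi x < pi y) ->
  fits 1 ds l (map f' cs').
Proof.
have sub1 (cs1 cs2 : seq nat) : (forall c', c' \in cs1 -> exists2 c, c \in cs2 & f c = f' c') ->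
    subk 1 (map f' cs1) (map f cs2).
  move=> H [|y [|z s]] //; rewrite ?sub0seq // !sub1seq => /mapP[c' /H[c Hc <-] ->] _.
  exact: map_f.
elim: ds cs cs' => [|[g a] ds IH] cs cs' scs scs' E H1 H2 H3.
  move: E => /= ->; apply: sub1 => c' /H2[c [Hc E _]]; by exists c.
have lt : size g < size cs.
  by rewrite -(size_map f) -E size_cat /= -addSnnS leq_addr.
set x := nth 0 cs (size g); pose cs1 := take (size g) cs; pose cs2 := drop (size g).+1 cs.
have Ecs : cs = cs1 ++ x :: cs2 by rewrite -drop_nth ?cat_take_drop.
have sz1 : size cs1 = size g by rewrite size_takel // ltnW.
move: (E); rewrite {1}Ecs map_cat /= => /eqP; rewrite eqseq_cat ?size_map // => /andP[/eqP Eg].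
rewrite eqseq_cons => /andP[/eqP Ea /eqP El].
have [px fx] := H1 x (mem_head _ _).
move: scs; rewrite Ecs => /sorted_ltn_cat[lt1 lt2 scs2].
case/splitPr: px H1 H2 scs' => cs1' cs2' H1 H2 /sorted_ltn_cat[lt1' lt2' scs2'].
have Hx : x \in marked ((g, a) :: ds) cs by rewrite mem_head.
have Hm y : y \in marked ds cs2 -> y \in marked ((g, a) :: ds) cs.
  by move=> Hy; rewrite inE Hy orbT.
exists (map f' cs1'), (map f' cs2'); split.
- by rewrite map_cat /= fx Ea.
- rewrite Eg; apply: sub1 => c' Hc'; have [|c [Hc Ec /(_ x Hx)[_ Hlt]]] := H2 c'.
    by rewrite mem_cat Hc'.
  exists c => //; move: Hc Hlt; rewrite (lt1' _ Hc') Ecs mem_cat inE.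
  case/or3P=> [//|/eqP->|/lt2 lt2c]; first by rewrite ltnn.
  by move=> ltc; have := ltn_trans ltc lt2c; rewrite ltnn.
- apply: (IH cs2) => //.
  + move=> y Hy; have [py Ey] := H1 y (Hm y Hy); split=> //.
    have lty := H3 _ _ Hx (Hm y Hy) (lt2 y (marked_mem El Hy)).
    move: py; rewrite mem_cat inE; case/or3P=> [/lt1' ltp|/eqP Ep|//]; first by have := ltn_trans ltp lty; rewrite ltnn.
    by rewrite Ep ltnn in lty.
  + move=> c' Hc'; have [|c [Hc Ec Hall]] := H2 c'.
      by rewrite mem_cat inE Hc' !orbT.
    exists c; split=> // [|y Hy]; last by apply: Hall; apply: Hm.
    have [Hlt _] := Hall x Hx; move: Hc Hlt; rewrite (lt2' _ Hc') Ecs mem_cat inE.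
    case/or3P=> [/lt1 ltc|/eqP->|//]; last by rewrite ltnn.
    by move=> ltc'; have := ltn_trans ltc ltc'; rewrite ltnn.
  + by move=> y z Hy Hz; apply: H3; apply: Hm.
Qed.

End Embedding.

(** * From words of letters to words over the alphabet *)

Section Unfolding.
Variables (G A : eqType) (lw mw rw : G -> seq A) (L : nat).
Hypothesis mw_nil : forall x, mw x != [::].
Variable x0 : G.
Implicit Types (U V : seq G).

Definition linked x y := (rw x == lw y) && (lw y != [::]).

(** Empty loop words signal the ends: [lw] is empty exactly at the first letter and [rw] exactly at
    the last one, so that equal letters in two chained words are both first, or both last, or
    neither. *)
Definition chained U := if U is x :: U' then
  [&& lw x == [::], path linked x U' & rw (last x U') == [::]] else false.

Lemma chained_nth U i : chained U -> i < size U ->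
  [/\ (lw (nth x0 U i) == [::]) = (i == 0),
      (rw (nth x0 U i) == [::]) = (i.+1 == size U) &
      i.+1 < size U -> rw (nth x0 U i) = lw (nth x0 U i.+1)].
Proof.
case: U => // x U /and3P[/eqP lx /(pathP x0) H /eqP rx] lti; split.
- case: i lti => [|i] lti; first by rewrite /= lx.
  by have /andP[_ /negbTE] := H i lti.
- move: lti; rewrite ltnS leq_eqVlt => /orP[/eqP->|lti].
    by rewrite nth_last /= rx !eqxx.
  have /andP[/eqP -> nl] := H i lti; rewrite (negbTE nl) /= eqSS.
  by rewrite ltn_eqF.
- by move=> /= lt; have /andP[/eqP] := H i lt.
Qed.

(* The word of [U] has [L] copies of the loop shared by two consecutive
   letters; cutting it after [q] copies gives [q] of them to the left letter. *)
Definition piece q x := flatten (nseq (L - q) (lw x)) ++ mw x ++ flatten (nseq q (rw x)).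
Definition text q U := flatten (map (piece q) U).

Lemma size_piece q x :
  size (piece q x) = (L - q) * size (lw x) + size (mw x) + q * size (rw x).
Proof.
rewrite !size_cat addnA; congr (_ + _ + _).
  by rewrite size_flatten /shape map_nseq sumn_nseq mulnC.
by rewrite size_flatten /shape map_nseq sumn_nseq mulnC.
Qed.

Lemma piece_gt0 q x : 0 < size (piece q x).
Proof. by rewrite size_piece !addn_gt0 !lt0n size_eq0 mw_nil orbT. Qed.

(** Each border hands [q] copies of its loop from the right letter to the left one. For [q = 0] all
    copies belong to the right letter. *)
Lemma text_shift q U : q <= L -> chained U -> text q U = text 0 U.
Proof.
move=> leq_; case: U => // x U /and3P[/eqP lx pU /eqP rx].
have nseq_nil k : flatten (nseq k [::]) = [::] :> seq A by elim: k.
suff H : flatten (nseq q (lw x)) ++ text q (x :: U) = text 0 (x :: U).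
  by rewrite -H lx nseq_nil.
have nseqL (s : seq A) : flatten (nseq q s) ++ flatten (nseq (L - q) s) = flatten (nseq L s).
  by rewrite -flatten_cat -nseqD subnKC.
elim: U x {lx} pU rx => [|y U IH] x /=.
  move=> _ rx; rewrite /text /= /piece !cats0 subn0 rx catA nseqL.
  by rewrite nseq_nil cats0.
case/andP=> /andP[/eqP E _] pU rx; have := IH y pU rx; rewrite /text /= => <-.
by rewrite /piece cats0 subn0 E -!catA catA nseqL.
Qed.

Definition start q U b := sumn (map (fun x => size (piece q x)) (take b U)).

Fixpoint coord q U p : nat * nat :=
  if U is x :: U' then
    if p < size (piece q x) then (0, p)
    else let c := coord q U' (p - size (piece q x)) in (c.1.+1, c.2)
  else (0, p).

Lemma coordP q U p : p < size (text q U) ->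
  [/\ (coord q U p).1 < size U,
      (coord q U p).2 < size (piece q (nth x0 U (coord q U p).1)) &
      p = start q U (coord q U p).1 + (coord q U p).2].
Proof.
elim: U p => //= x U IH p; rewrite /text /= size_cat.
case: (ltnP p (size (piece q x))) => [lt _|le lt] //=.
have [|H1 H2 H3] := IH (p - size (piece q x)); first by rewrite ltn_subLR.
by split=> //; rewrite /start /= -addnA -H3 subnKC.
Qed.

Lemma startS q U b : b < size U ->
  start q U b.+1 = start q U b + size (piece q (nth x0 U b)).
Proof.
by move=> lt; rewrite /start (take_nth x0) // map_rcons sumn_rcons.
Qed.

Lemma start_le q U b b' : b <= b' -> start q U b <= start q U b'.
Proof.
move=> le; rewrite /start -[take b' U](cat_take_drop b) take_takel //.
by rewrite map_cat sumn_cat leq_addr.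
Qed.

Lemma start_lt q U b b' o : b < b' -> b < size U ->
  o < size (piece q (nth x0 U b)) -> start q U b + o < start q U b'.
Proof.
move=> lt ltU lto; apply: leq_trans (start_le q U lt).
by rewrite startS // ltn_add2l.
Qed.

Lemma start_inj q U b o b' o' : b < size U -> b' < size U ->
  o < size (piece q (nth x0 U b)) -> o' < size (piece q (nth x0 U b')) ->
  start q U b + o = start q U b' + o' -> b = b' /\ o = o'.
Proof.
move=> ltb ltb' lto lto' E; case: (ltngtP b b') => [lt|lt|Eb].
- by have := start_lt lt ltb lto; lia.
- by have := start_lt lt ltb' lto'; lia.
- by split=> //; move: E; rewrite Eb => /addnI.
Qed.

Lemma size_text q U : size (text q U) = start q U (size U).
Proof. by rewrite /start take_size /text size_flatten /shape -map_comp. Qed.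

Lemma start_text q U b o : b < size U -> o < size (piece q (nth x0 U b)) ->
  start q U b + o < size (text q U).
Proof. by move=> ltb lto; rewrite size_text; apply: start_lt. Qed.

Lemma coord_start q U b o : b < size U -> o < size (piece q (nth x0 U b)) ->
  coord q U (start q U b + o) = (b, o).
Proof.
move=> ltb lto; have [H1 H2 H3] := coordP (start_text ltb lto).
have [E1 E2] := start_inj ltb H1 lto H2 H3; by rewrite [LHS]surjective_pairing -E1 -E2.
Qed.

Lemma onth_text q U b o : b < size U -> o < size (piece q (nth x0 U b)) ->
  onth (text q U) (start q U b + o) = onth (piece q (nth x0 U b)) o.
Proof.
elim: U b => // x U IH [|b] /= ltb lto; rewrite /text /= onth_cat.
  by rewrite /start take0 /= lto.
rewrite /start /= -addnA ltnNge leq_addr /= addKn -/(start q U b) -/(text q U).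
exact: IH.
Qed.

(** A piece loses [q] copies on its left and gains [q] on its right, so the shifts cancel except at
    the border just before [b]. *)
Lemma start_shift q U b : q <= L -> chained U -> b < size U ->
  start q U b = start 0 U b + q * size (lw (nth x0 U b)).
Proof.
move=> leq_ cU; elim: b => [|b IH] ltb.
  have [/esym + _ _] := chained_nth cU ltb; rewrite eqxx => /esym/eqP->.
  by rewrite /start take0 muln0.
rewrite !startS ?IH ?size_piece; try by apply: ltnW.
have [_ _ ->] := chained_nth cU (ltnW ltb) => //.
rewrite subn0 mul0n !addn0; have := leq_; set lb := size _; set mb := size _.
move=> /subnK E; rewrite -{2}E mulnDl; lia.
Qed.

Lemma start_ltE q U b o b' o' : b < size U -> b' < size U ->
  o < size (piece q (nth x0 U b)) -> o' < size (piece q (nth x0 U b')) ->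
  (start q U b + o < start q U b' + o') = (b < b') || (b == b') && (o < o').
Proof.
move=> ltb ltb' lto lto'; case: (ltngtP b b') => [lt|lt|->] /=.
- exact: leq_trans (start_lt lt ltb lto) (leq_addr _ _).
- apply/negbTE; rewrite -leqNgt; apply: leq_trans (leq_addr _ _).
  exact: ltnW (start_lt lt ltb' lto').
- by rewrite ltn_add2l.
Qed.

(** The last hypothesis says that the second position is not just after a border, so a successor
    pair stays inside one piece. This is what the choice of the cut has to ensure. *)
Lemma start_succE q U b o b' o' : b < size U -> b' < size U ->
  o < size (piece q (nth x0 U b)) -> o' < size (piece q (nth x0 U b')) ->
  (o' = 0 -> b' = 0) ->
  (start q U b' + o' == (start q U b + o).+1) = (b' == b) && (o' == o.+1).
Proof.
move=> ltb ltb' lto lto' o'0; case: (ltngtP b b') => [lt|lt|->] /=.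
- have := start_lt lt ltb lto; rewrite -addnS.
  by case: o' o'0 {lto'} => [/(_ erefl) E|o' _]; [rewrite E in lt | lia].
- by have := start_lt lt ltb' lto'; lia.
- by rewrite -addnS eqn_add2l.
Qed.

Lemma start_eq0 q U b o : b < size U ->
  (start q U b + o == 0) = (b == 0) && (o == 0).
Proof.
move=> ltb; rewrite addn_eq0; congr (_ && _); case: b ltb => [|b] ltb.
  by rewrite /start take0.
rewrite startS ?addn_eq0; last exact: ltnW.
by rewrite (negbTE (lt0n_neq0 (piece_gt0 _ _))) andbF.
Qed.

Lemma start_last q U b o : b < size U -> o < size (piece q (nth x0 U b)) ->
  ((start q U b + o).+1 == size (text q U)) =
  (b.+1 == size U) && (o.+1 == size (piece q (nth x0 U b))).
Proof.
move=> ltb lto; rewrite size_text; case: (ltngtP b.+1 (size U)) => [lt|lt|E] /=.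
- by have := start_lt lt lt (piece_gt0 q (nth x0 U b.+1)); rewrite startS // addn0; lia.
- by move: lt; rewrite ltnS leqNgt ltb.
- by rewrite -E startS // -addnS eqn_add2l.
Qed.

(** Each pebble marks its letter and the preceding one, because the copies at their border are
    shared out only after the second round begins: hence [2 * n]. In the second round [m.+1]
    positions are allowed, so that one is available even if [m = 0]; it is used to keep adjacent
    marks adjacent. *)
Theorem le2_game n m U V : n + m <= L -> chained U -> chained V ->
  le2 (2 * n) m.+1 U V -> game n m (text 0 U) (text 0 V).
Proof.
move=> leL cU cV leUV xs [szxs Hxs].
pose cx p := coord 0 U p.
pose I := flatten [seq [:: (cx p).1.-1; (cx p).1] | p <- xs].
have [ds [l [EU Eds]]] := mark_word I U.
have szds : size ds <= 2 * n.
  rewrite -size_marks Eds; apply: (@leq_trans (size I)).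
    apply: uniq_leq_size; first by rewrite filter_uniq // iota_uniq.
    by move=> i; rewrite mem_filter => /andP[].
  rewrite /I -szxs size_flatten /shape -map_comp.
  by elim: (xs) => //= p s IH; rewrite /= -[2]/(1 + 1); lia.
have [ds' [l' [EV szds' Hemb]]] := fits_embeds x0 (leUV ds l szds EU).
rewrite -EU in Hemb.
have mI p : p \in xs -> (cx p).1 \in marks ds /\ (cx p).1.-1 \in marks ds.
  move=> Hp; have [lt _ _] := coordP (Hxs p Hp).
  rewrite Eds !mem_filter !mem_iota /= !add0n lt (leq_ltn_trans (leq_pred _) lt) !andbT.
  split; apply/flattenP; exists [:: (cx p).1.-1; (cx p).1]; rewrite ?inE ?eqxx ?orbT //;
    by apply/mapP; exists p.
pose pr i := nth 0 (marks ds') (index i (marks ds)).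
have pr_mem i : i \in marks ds -> pr i \in marks ds'.
  by move=> Hi; rewrite mem_nth // size_marks szds' -size_marks index_mem.
have mV i : i \in marks ds' -> i < size V by rewrite EV; apply: marks_lt.
have h_pr h i : map h (marks ds') = marks ds -> i \in marks ds -> h (pr i) = i.
  move=> /(congr1 (nth 0 ^~ (index i (marks ds)))) /= + Hi.
  rewrite nth_index // (nth_map 0) //.
  by rewrite size_marks szds' -size_marks index_mem.
have [h0 [[h01 h02] h03]] : exists h, embeds x0 (fun j => j \in marks ds') h V U /\
    map h (marks ds') = marks ds.
  have [//|//|h [[h1 h2] h3]] := Hemb [::]; exists h; split=> //; split.
    by move=> j Hj; apply: h1; right.
  by move=> i j Hi Hj; apply: h2; right.
have pr_nth i : i \in marks ds -> nth x0 V (pr i) = nth x0 U i.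
  by move=> Hi; have [_] := h01 _ (pr_mem i Hi); rewrite (h_pr _ _ h03).
have pr_lt i j : i \in marks ds -> j \in marks ds -> i < j -> pr i < pr j.
  move=> Hi Hj ltij; case: (ltngtP (pr i) (pr j)) => // [lt|E].
    by have := h02 _ _ (pr_mem j Hj) (pr_mem i Hi) lt; rewrite !(h_pr _ _ h03) //; lia.
  by have := congr1 h0 E; rewrite !(h_pr _ _ h03) //; lia.
(* A position of [V] strictly between the images could be sent strictly between [i] and [i.+1]. *)
have pr_S i : i \in marks ds -> i.+1 \in marks ds -> pr i.+1 = (pr i).+1.
  move=> Hi HSi; have lt := pr_lt _ _ Hi HSi (ltnSn i).
  apply/eqP; rewrite eqn_leq lt andbT leqNgt; apply/negP => lt2.
  have ltV := ltn_trans lt2 (mV _ (pr_mem _ HSi)).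
  have [||h [[_ h2] h3]] := Hemb [:: (pr i).+1] => //.
    by move=> j; rewrite inE => /eqP->.
  have := h2 _ _ (or_intror (pr_mem _ Hi)) (or_introl (mem_head _ [::])) (ltnSn _).
  have := h2 _ _ (or_introl (mem_head _ [::])) (or_intror (pr_mem _ HSi)) lt2.
  by rewrite !(h_pr _ _ h3) //; lia.
(* The answer to [p] is at the same offset in the image of its letter. *)
pose F p := start 0 V (pr (cx p).1) + (cx p).2.
have piece_nth i : i \in marks ds -> piece 0 (nth x0 V (pr i)) = piece 0 (nth x0 U i).
  by move=> Hi; rewrite pr_nth.
have HF p : p \in xs -> [/\ pr (cx p).1 < size V,
    (cx p).2 < size (piece 0 (nth x0 V (pr (cx p).1))) & F p < size (text 0 V)].
  move=> Hp; have [m1 _] := mI p Hp; have lt := mV _ (pr_mem _ m1).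
  have [_ lto _] := coordP (Hxs p Hp).
  by split=> //; [|apply: start_text => //]; rewrite piece_nth.
exists (map F xs).
  by split=> [|_ /mapP[p /HF[_ _ lt] ->]]; rewrite ?size_map.
move=> zs [szzs Hzs]; pose ps := zs ++ map F xs.
have Hps p : p \in ps -> p < size (text 0 V).
  rewrite mem_cat => /orP[/Hzs//|/mapP[x Hx ->]]; by have [] := HF x Hx.
(* There are [L.+1] possible cuts and at most [n + m] pebbles on [V]. A pebble excludes at most one
   cut, the one that would fall just before it. *)
have [q leq_ Hq] : exists2 q, q <= L & forall p, p \in ps ->
    (coord 0 V p).1 != 0 -> (coord 0 V p).2 != q * size (lw (nth x0 V (coord 0 V p).1)).
  pose qs := [seq (coord 0 V p).2 %/ size (lw (nth x0 V (coord 0 V p).1)) | p <- ps].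
  have [/allP sub|/allPn[q]] := boolP (all (mem qs) (iota 0 L.+1)).
    have := uniq_leq_size (iota_uniq 0 L.+1) sub.
    by rewrite size_iota size_map size_cat size_map szxs szzs addnC ltnNge leL.
  rewrite mem_iota add0n ltnS => leqL nq; exists q => // p Hp b0.
  apply: contra nq => /eqP E; apply/mapP; exists p => //; rewrite E mulnK //.
  have [lt _ _] := coordP (Hps p Hp).
  by have [E0 _ _] := chained_nth cV lt; rewrite lt0n size_eq0 E0.
pose cq p := coord q V p.
have Hcq p : p \in ps -> [/\ (cq p).1 < size V,
    (cq p).2 < size (piece q (nth x0 V (cq p).1)) & p = start q V (cq p).1 + (cq p).2].
  by move=> Hp; apply: coordP; rewrite text_shift //; apply: Hps.
have cq0 p : p \in ps -> (cq p).2 = 0 -> (cq p).1 = 0.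
  move=> Hp E0; have [ltb _ Ep] := Hcq p Hp; apply/eqP/negPn/negP => nb0.
  move: Ep; rewrite E0 addn0 (start_shift leq_ cV) // => Ep.
  have lto : q * size (lw (nth x0 V (cq p).1)) < size (piece 0 (nth x0 V (cq p).1)).
    rewrite size_piece subn0 mul0n addn0; have := mw_nil (nth x0 V (cq p).1).
    rewrite -size_eq0; have := leq_mul2r (size (lw (nth x0 V (cq p).1))) q L.
    rewrite leq_ orbT; lia.
  have Ec : coord 0 V p = ((cq p).1, q * size (lw (nth x0 V (cq p).1))).
    by rewrite {1}Ep coord_start.
  by have := Hq p Hp; rewrite Ec /= eqxx => /(_ nb0).
have [||h [[h1 h2] h3]] := Hemb (map (fun p => (cq p).1) zs).
- move=> _ /mapP[p Hp ->]; have [] // := Hcq p _; by rewrite mem_cat Hp.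
- by rewrite size_map szzs.
pose D j := j \in map (fun p => (cq p).1) zs \/ j \in marks ds'.
pose T p := start q U (h (cq p).1) + (cq p).2.
have HT x : x \in xs -> D (cq (F x)).1 /\ T (F x) = x.
  move=> Hx; have [ltx ltox Ex] := coordP (Hxs x Hx); have [m1 m2] := mI x Hx.
  have [ltb lto _] := HF x Hx.
  have EF : F x = start 0 V (pr (cx x).1) + (cx x).2 by [].
  rewrite -/(cx x) in ltx ltox Ex.
  (* Either the pebble lies after the cut and stays in its own piece, or it is in one of the [q]
     copies given to the preceding letter, which has been marked for this purpose. *)
  have [leo|lto'] := leqP (q * size (lw (nth x0 V (pr (cx x).1)))) (cx x).2.
    have Ec : cq (F x) = (pr (cx x).1, (cx x).2 - q * size (lw (nth x0 V (pr (cx x).1)))).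
      rewrite /cq (_ : F x = start q V (pr (cx x).1) + ((cx x).2 - q * size (lw (nth x0 V (pr (cx x).1))))).
        rewrite coord_start // size_piece; move: lto; rewrite size_piece subn0 mulnBl; lia.
      by rewrite EF (start_shift leq_ cV) // -addnA subnKC.
    rewrite /T Ec /=; split; first by right; apply: pr_mem.
    by rewrite (h_pr _ _ h3) // (start_shift leq_ cU) // pr_nth // -addnA subnKC // -pr_nth.
  have b0 : (cx x).1 != 0.
    apply: contraTneq lto' => b0; rewrite -leqNgt pr_nth // b0.
    have lt0 : 0 < size U by rewrite -b0.
    have [/eqP + _ _] := chained_nth cU lt0; rewrite eqxx => /eqP.
    by move/eqP => ->; rewrite muln0.
  move: lto' EF Ex m1 m2 ltb lto ltx ltox; case: (cx x) b0 => -[//|b] o _ /= lto' EF Ex m1 m2 ltb lto ltx ltox.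
  have EpS := pr_S _ m2 m1; rewrite EpS in lto' EF ltb lto.
  have [_ _ /(_ ltb) Erw] := chained_nth cV (ltnW ltb).
  have [_ _ /(_ ltx) ErU] := chained_nth cU (ltnW ltx).
  set o' := (L - q) * size (lw (nth x0 V (pr b))) + size (mw (nth x0 V (pr b))) + o.
  have Ec : cq (F x) = (pr b, o').
    rewrite /cq (_ : F x = start q V (pr b) + o').
      by rewrite coord_start ?(ltnW ltb) // size_piece Erw /o' ltn_add2l.
    rewrite EF startS ?(ltnW ltb) // (start_shift leq_ cV) ?(ltnW ltb) // size_piece /o'.
    rewrite subn0 mulnBl; have := leq_mul2r (size (lw (nth x0 V (pr b)))) q L.
    rewrite leq_ orbT; lia.
  rewrite /T Ec /=; split; first by right; apply: pr_mem.
  rewrite (h_pr _ _ h3) // Ex startS ?(ltnW ltx) // (start_shift leq_ cU) ?(ltnW ltx) // size_piece /o'.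
  rewrite pr_nth // subn0 mulnBl; have := leq_mul2r (size (lw (nth x0 U b))) q L.
  rewrite leq_ orbT; lia.
have HD p : p \in ps -> D (cq p).1.
  rewrite mem_cat => /orP[Hp|/mapP[x Hx ->]]; last by have [] := HT x Hx.
  by left; apply: map_f.
have TU p : p \in ps -> [/\ h (cq p).1 < size U,
    nth x0 U (h (cq p).1) = nth x0 V (cq p).1 & T p < size (text 0 U)].
  move=> Hp; have [H1 H2] := h1 _ (HD p Hp); split=> //.
  rewrite -(text_shift leq_ cU); apply: start_text => //; rewrite H2.
  by have [] := Hcq p Hp.
exists (map T zs).
  by split=> [|_ /mapP[p Hp ->]]; rewrite ?size_map //; have [] // := TU p; rewrite mem_cat Hp.
have -> : map T zs ++ xs = map T ps.
  rewrite map_cat -map_comp; congr (_ ++ _); rewrite -[LHS]map_id.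
  by apply/eq_in_map => x /HT[].
have h_lt i j : D i -> D j -> (h i < h j) = (i < j).
  move=> Di Dj; case: (ltngtP i j) => [/h2->//|/h2 lt|->]; last exact: ltnn.
  by apply/negbTE; rewrite -leqNgt ltnW // lt.
have h_eq i j : D i -> D j -> (h i == h j) = (i == j).
  by move=> Di Dj; rewrite !eqn_leq !(leqNgt (h _)) !h_lt // -!leqNgt.
have h_first i : D i -> i < size V -> (h i == 0) = (i == 0).
  move=> Di lti; have [lth E] := h1 i Di.
  have [<- _ _] := chained_nth cU lth; have [<- _ _] := chained_nth cV lti.
  by rewrite E.
have h_last i : D i -> i < size V -> ((h i).+1 == size U) = (i.+1 == size V).
  move=> Di lti; have [lth E] := h1 i Di.
  have [_ <- _] := chained_nth cU lth; have [_ <- _] := chained_nth cV lti.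
  by rewrite E.
have TE p : p \in ps -> [/\ (cq p).2 < size (piece q (nth x0 U (h (cq p).1))),
    (cq p).2 = 0 -> h (cq p).1 = 0 & onth (text 0 U) (T p) = onth (text 0 V) p].
  move=> Hp; have [lth E _] := TU p Hp; have [ltb lto Ep] := Hcq p Hp.
  split; first by rewrite E.
    move=> /(cq0 p Hp) E0; apply/eqP; rewrite h_first ?E0 //; last by rewrite -E0.
    by rewrite -E0; apply: HD.
  rewrite -(text_shift leq_ cU) -(text_shift leq_ cV) {2}Ep !onth_text ?E //.
rewrite -/ps; split=> [|i]; rewrite size_map // => lti.
rewrite (nth_map 0) //; have Hp := mem_nth 0 lti; set p := nth 0 ps i in Hp *.
have [ltb lto Ep] := Hcq p Hp; have [lth Eh _] := TU p Hp.
have [lto' o0 Eon] := TE p Hp; split=> //.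
- by rewrite /T start_eq0 // [in RHS]Ep start_eq0 // h_first //; apply: HD.
- rewrite -(text_shift leq_ cU) -(text_shift leq_ cV) /T start_last // [in RHS]Ep start_last //.
  by rewrite h_last ?Eh //; apply: HD.
move=> j ltj; rewrite (nth_map 0) //; have Hp' := mem_nth 0 ltj.
set p' := nth 0 ps j in Hp' *.
have [ltb' lto1' Ep'] := Hcq p' Hp'; have [lth' Eh' _] := TU p' Hp'.
have [lto2' o0' _] := TE p' Hp'; rewrite /T; split.
  by rewrite start_ltE // [in RHS]Ep [in RHS]Ep' start_ltE // h_lt ?h_eq //; apply: HD.
by rewrite start_succE // [in RHS]Ep [in RHS]Ep' start_succE // ?h_eq //; [apply: HD | apply: HD | apply: cq0].
Qed.

End Unfolding.

(** * Canonical decomposition of words *)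

Section Canonical.
Variables (A S C : finType).
Variables (mul : S -> S -> S) (one : S).
Hypothesis mulA : associative mul.
Hypothesis mul1x : left_id one mul.
Hypothesis mulx1 : right_id one mul.
Variable alpha : A -> S.
Implicit Types (w : seq A) (x y : nat).

Definition nu w := foldr (fun a s => mul (alpha a) s) one w.

Lemma nu_cat w w' : nu (w ++ w') = mul (nu w) (nu w').
Proof. by elim: w => //= a w ->. Qed.

(** Letters are arrows between objects: [Start] and [End] are the ends of a word, [Loop e] is an
    inner cut stabilized by the idempotent [e]. *)
Inductive object := Start | End | Loop of S.

Definition loop_value f := if f is Loop e then e else one.

Variable blk : object -> S -> object -> C.
Variables (op : C -> C -> C) (unit_C : C).
Hypothesis opA : associative op.
Hypothesis op1x : left_id unit_C op.
Hypothesis opx1 : right_id unit_C op.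
Hypothesis blk_op : forall f s g t h,
  op (blk f s g) (blk g t h) = blk f (mul s t) h.

Variable Gs : {set S}.
Hypothesis Gs_alpha : forall a, alpha a \in Gs.
Hypothesis Gs_mul : forall s t, s \in Gs -> t \in Gs -> mul s t \in Gs.

(** Absorption [mul s e = s] is imposed at the right end only: a power of [e] inserted at a border
    is absorbed by the letter on its left. *)
Definition letter_ok (c : C) := exists f s g, [/\ c = blk f s g, s \in Gs,
  f = Start \/ (exists2 e, e \in Gs & mul e e = e /\ f = Loop e) &
  g = End \/ (exists2 e, e \in Gs & [/\ mul e e = e, g = Loop e & mul s e = s])].

Lemma nu_Gs w : w != [::] -> nu w \in Gs.
Proof.
elim: w => // a [|b w] IH _; first by rewrite /= mulx1.
exact: Gs_mul (Gs_alpha a) (IH isT).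
Qed.

(** The choice depends on the left context alone, which makes cuts and letters locally
    determined. *)
Definition stabilizer (lc : seq A) : option S :=
  [pick e | [&& e \in Gs, mul e e == e & mul (nu lc) e == nu lc]].

Variable N : nat.
Hypothesis N_card : N = #|S|.

Lemma N_gt0 : 0 < N. Proof. by rewrite N_card; apply/card_gt0P; exists one. Qed.

Definition left_ctx w x := drop (x - N) (take x w).
(** The next cut is at distance at most [N]; one letter more tells whether the word ends there. *)
Definition right_ctx w x := take N.+1 (drop x w).
Definition cut w x := (x == 0) || stabilizer (left_ctx w x).
(** The last [End] is a default value for positions that are not cuts. *)
Definition obj w x :=
  if x == 0 then Start else if x == size w then End else
  if stabilizer (left_ctx w x) is Some e then Loop e else End.
Definition next_cut w x := head (size w) [seq y <- iota x.+1 (size w - x.+1) | cut w y].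
Definition letter w x :=
  let y := next_cut w x in
  blk (obj w x) (mul (nu (drop x (take y w))) (loop_value (obj w y))) (obj w y).
Definition cuts w x := [seq y <- iota 0 x | cut w y].
Definition canon w := map (letter w) (cuts w (size w)).

Definition is_next w x y := [/\ x < y, y <= size w, y < size w -> cut w y &
  forall z, x < z < y -> ~~ cut w z].

Lemma is_nextP w x : x < size w -> is_next w x (next_cut w x).
Proof.
move=> ltx; rewrite /next_cut; case E: [seq _ <- _ | _] => [|y s] /=.
  split=> // [|z /andP[ltz ltzw]]; first by rewrite ltnn.
  apply/negP => cz; have : z \in [seq y <- iota x.+1 (size w - x.+1) | cut w y].
    by rewrite mem_filter cz mem_iota ltz subnKC.
  by rewrite E.
have : y \in [seq y <- iota x.+1 (size w - x.+1) | cut w y] by rewrite E mem_head.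
rewrite mem_filter mem_iota subnKC // => /and3P[cy ltxy lty]; split=> //.
  exact: ltnW.
move=> z /andP[ltz ltzy]; apply/negP => cz.
have : z \in [seq y <- iota x.+1 (size w - x.+1) | cut w y].
  by rewrite mem_filter cz mem_iota ltz subnKC //; apply: ltn_trans lty.
rewrite E inE => /orP[/eqP Ez|sz]; first by rewrite Ez ltnn in ltzy.
have : path ltn y s.
  have : sorted ltn (y :: s).
    by rewrite -E; apply: sorted_filter (iota_ltn_sorted _ _); apply: ltn_trans.
  by [].
move/(order_path_min ltn_trans)/allP/(_ z sz) => /ltnW; rewrite leqNgt ltzy.
by [].
Qed.

Lemma is_next_uniq w x y y' : is_next w x y -> is_next w x y' -> y = y'.
Proof.
move=> [H1 H2 H3 H4] [H1' H2' H3' H4']; case: (ltngtP y y') => // lt.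
  by have := H4' y; rewrite H1 lt H3 ?(leq_trans lt) // => /(_ isT).
by have := H4 y'; rewrite H1' lt H3' ?(leq_trans lt) // => /(_ isT).
Qed.

Lemma prev_cut w x : 0 < x -> exists y, [/\ y < x, cut w y &
  forall z, y < z < x -> ~~ cut w z].
Proof.
elim: x => // x IH _; case cx: (cut w x).
  by exists x; split=> // z; rewrite ltnS => /andP[/leq_trans H /H]; rewrite ltnn.
case: x IH cx => [|x] IH cx; first by rewrite /cut eqxx in cx.
have [//|y [lty cy Hy]] := IH; exists y; split=> //; first exact: leqW.
move=> z /andP[ltz]; rewrite ltnS leq_eqVlt => /orP[/eqP->|lt]; first by rewrite cx.
by apply: Hy; rewrite ltz.
Qed.

(** The idempotent at [x] fixes the value of the left context, a suffix of the prefix of length [x],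
    hence it fixes the value of this prefix. *)
Lemma nu_absorb w x : x <= size w ->
  mul (nu (take x w)) (loop_value (obj w x)) = nu (take x w).
Proof.
move=> lex; rewrite /obj; case: eqP => _; first by rewrite mulx1.
case: eqP => _; first by rewrite mulx1.
rewrite /stabilizer; case: pickP => [e /and3P[_ _ /eqP He]|_] /=; last by rewrite mulx1.
by rewrite -[take x w](cat_take_drop (x - N)) -/(left_ctx w x) nu_cat -mulA He.
Qed.

Lemma value_cuts w x : 0 < x -> x <= size w -> (x < size w -> cut w x) ->
  value op unit_C (map (letter w) (cuts w x)) = blk Start (nu (take x w)) (obj w x).
Proof.
elim/ltn_ind: x => x IH x0 lex cx; have [y [ltyx cy Hy]] := prev_cut w x0.
have nxt : next_cut w y = x.
  apply: is_next_uniq (is_nextP (leq_trans ltyx lex)) _; by split.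
have -> : cuts w x = rcons (cuts w y) y.
  rewrite /cuts -(subnKC (ltnW ltyx)) iotaD filter_cat -cats1; congr (_ ++ _).
  rewrite -[x - y](@prednK) ?subn_gt0 //= cy add0n; congr (_ :: _).
  apply/eqP; rewrite -[_ == _]negbK -has_filter; apply/hasPn => z.
  rewrite mem_iota => /andP[ltz ltzx]; apply: Hy; rewrite ltz.
  by move: ltzx; rewrite -subnS addSn; lia.
rewrite map_rcons -cats1 value_cat //= opx1 /letter nxt.
have Etake : mul (nu (take y w)) (nu (drop y (take x w))) = nu (take x w).
  rewrite -nu_cat -[in RHS](cat_take_drop y (take x w)); congr (nu (_ ++ _)).
  by rewrite take_takel // ltnW.
have [y0|y0] := posnP y.
  rewrite y0 /cuts /= op1x drop0 {1}/obj eqxx.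
  by rewrite nu_absorb.
rewrite IH // ?blk_op; last by rewrite (leq_trans (ltnW ltyx)).
by rewrite mulA Etake nu_absorb.
Qed.

Lemma value_canon w : w != [::] -> value op unit_C (canon w) = blk Start (nu w) End.
Proof.
rewrite -size_eq0 -lt0n => w0; rewrite value_cuts ?ltnn // take_size /obj eqxx.
by rewrite gtn_eqF.
Qed.

Lemma obj_cut w x : cut w x -> x < size w ->
  obj w x = Start \/ (exists2 e, e \in Gs & mul e e = e /\ obj w x = Loop e).
Proof.
rewrite /cut /obj; case: eqP => [|_ /=]; first by left.
move=> st ltx; right; rewrite ltn_eqF //; move: st.
rewrite /stabilizer; case: pickP => // e /and3P[eG /eqP ee _] _.
by exists e.
Qed.

Lemma letter_okP w x : cut w x -> x < size w -> letter_ok (letter w x).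
Proof.
move=> cx ltx; have [lty ley cy _] := is_nextP ltx.
have nG : nu (drop x (take (next_cut w x) w)) \in Gs.
  by apply: nu_Gs; rewrite -size_eq0 size_drop size_takel // -lt0n subn_gt0.
rewrite /letter; set y := next_cut w x in lty ley cy nG *.
have y0 : y != 0 by rewrite -lt0n (leq_ltn_trans _ lty).
exists (obj w x), (mul (nu (drop x (take y w))) (loop_value (obj w y))), (obj w y).
have [E|] := eqVneq y (size w).
  have -> : obj w y = End by rewrite /obj (negbTE y0) E eqxx.
  by split=> //=; [rewrite mulx1 | exact: obj_cut | left].
rewrite neq_ltn [_ < y]ltnNge ley orbF => ltyw.
have [Ey|[e eG [ee Ey]]] := obj_cut (cy ltyw) ltyw.
  by move: Ey; rewrite /obj (negbTE y0); case: eqP => // _; case: (stabilizer _).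
rewrite Ey /=; split=> //; first exact: Gs_mul; first exact: obj_cut.
by right; exists e => //; split=> //; rewrite -mulA ee.
Qed.

(** [e] is the value of an idempotent factor of a long power of [r], hence itself a nonempty power
    of [r]. *)
Lemma idem_power r : r \in Gs -> exists2 e, e \in Gs & mul e e = e /\
  forall s, mul s r = s -> mul s e = s.
Proof.
move=> rG; have [n Hn] := idempotent_factor mulA mul1x mulx1.
have [|a [b [d [e [E nb Eb ee]]]]] := Hn (nseq n.+1 r); first by rewrite size_nseq.
have allr : all (pred1 r) b.
  have := all_pred1_nseq r n.+1; rewrite E !all_cat => /and3P[_ + _].
  by [].
exists e; last split=> // s sr.
  rewrite -Eb; elim: b nb allr {E Eb} => //= x [|y b] IH _ /andP[/eqP-> Hb].
    by rewrite /= mulx1.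
  exact: Gs_mul rG (IH isT Hb).
rewrite -Eb; elim: b allr {nb E Eb} => [|x b IH] /=; first by rewrite mulx1.
by case/andP=> /eqP-> /IH; rewrite mulA sr.
Qed.

Lemma size_left_ctx w x : x <= size w -> size (left_ctx w x) = minn N x.
Proof. by move=> lex; rewrite /left_ctx size_drop size_takel //; lia. Qed.

Lemma left_ctx_add w x j : j <= N -> x + j <= size w ->
  left_ctx w (x + j) =
  drop (size (left_ctx w x) + j - N) (left_ctx w x) ++ take j (drop x w).
Proof.
move=> lejN lexj; have lex : x <= size w by apply: leq_trans lexj; apply: leq_addr.
rewrite size_left_ctx // {1}/left_ctx takeD.
rewrite -{1}[take x w](cat_take_drop (x - N)) -/(left_ctx w x) -catA.
have -> : x + j - N = minn N x + j - N + (x - N) by lia.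
rewrite -drop_drop drop_size_cat; last by rewrite size_takel // size_takel // leq_subr.
rewrite drop_cat size_left_ctx //; case: ltnP => // le.
have -> : minn N x + j - N = minn N x by lia.
by rewrite subnn drop0 [drop _ (left_ctx _ _)]drop_oversize ?size_left_ctx.
Qed.

(** Among the [N.+1] shortest nonempty factors that start at [x] two have the same value, so the
    word [r] between their ends satisfies [s r = s] for this value [s]. The shorter factor has
    length at most [N] and is a suffix of the left context at its end, which is therefore stabilized
    by an idempotent power of [r]. *)
Lemma cut_near w x : x + N < size w -> exists2 i, 0 < i <= N & cut w (x + i).
Proof.
move=> lt; pose f (i : 'I_N.+1) := nu (take i.+1 (drop x w)).
have /injectivePn[i [j nij Eij]] : ~~ injectiveb f.
  apply/negP => /injectiveP/(@leq_card _ _ f); by rewrite card_ord -N_card ltnn.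
wlog ltij : i j nij Eij / i < j.
  by move=> H; case: (ltngtP i j) => [|/H|/val_inj E]; [exact: H | apply; rewrite 1?eq_sym | rewrite E eqxx in nij].
have ltjN : j <= N by rewrite -ltnS.
have lti : i.+1 <= N by exact: leq_trans ltij ltjN.
exists i.+1; rewrite ?lti // /cut addn_eq0 andbF /=.
set r := nu (drop i.+1 (take j.+1 (drop x w))).
have rG : r \in Gs.
  apply: nu_Gs; rewrite -size_eq0 size_drop size_takel.
    by rewrite -lt0n subn_gt0 ltnS.
  rewrite size_drop ltn_subRL; apply: leq_ltn_trans lt; by rewrite leq_add2l.
have Er : mul (f i) r = f i.
  rewrite [RHS]Eij /f /r -nu_cat -[in RHS](cat_take_drop i.+1 (take j.+1 _)).
  by rewrite take_takel // ltnS ltnW.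
have [e eG [ee He]] := idem_power rG.
rewrite /stabilizer; case: pickP => // /(_ e); rewrite eG ee eqxx /=.
rewrite left_ctx_add //; last by rewrite (leq_trans _ (ltnW lt)) // leq_add2l.
by rewrite nu_cat -mulA (He _ Er) eqxx.
Qed.

Lemma next_near w x : x < size w -> next_cut w x <= x + N.
Proof.
move=> ltx; have [lty ley _ Hy] := is_nextP ltx.
have [le|lt] := leqP (size w) (x + N); first exact: leq_trans le.
have [i /andP[i0 leN] ci] := cut_near lt; rewrite leqNgt; apply/negP => ltn.
have /Hy : x < x + i < next_cut w x by rewrite -[X in X < _]addn0 ltn_add2l i0; lia.
by rewrite ci.
Qed.

Lemma drop_take_add w x j : drop x (take (x + j) w) = take j (drop x w).
Proof. by rewrite take_drop addnC. Qed.

(** * Cuts and letters depend on bounded contexts *)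

Section Locality.
Variables (w w' : seq A) (x x' : nat).
Hypothesis ltx : x < size w.
Hypothesis ltx' : x' < size w'.
Hypothesis eq_left : left_ctx w x = left_ctx w' x'.
Hypothesis eq_right : right_ctx w x = right_ctx w' x'.

Lemma ctx0 : (x == 0) = (x' == 0).
Proof.
have := congr1 size eq_left; rewrite !size_left_ctx ?(ltnW ltx) ?(ltnW ltx') //.
by have := N_gt0; lia.
Qed.

Lemma ctx_lt j : j <= N -> (x + j < size w) = (x' + j < size w').
Proof.
have := congr1 size eq_right; rewrite /right_ctx !size_take_min !size_drop => E lej.
by apply/idP/idP => lt; lia.
Qed.

Lemma ctx_take j : j <= N -> take j (drop x w) = take j (drop x' w').
Proof.
move=> lej; have := congr1 (take j) eq_right.
by rewrite /right_ctx !take_takel // ltnW // ltnS.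
Qed.

Lemma ctx_cut j : j <= N -> x + j < size w -> cut w (x + j) = cut w' (x' + j).
Proof.
move=> lej lt; have lt' : x' + j < size w' by rewrite -ctx_lt.
by rewrite /cut !addn_eq0 ctx0 !left_ctx_add ?(ltnW lt) ?(ltnW lt') // eq_left ctx_take.
Qed.

Lemma cut_local : cut w x = cut w' x'.
Proof. by have := @ctx_cut 0 (leq0n _); rewrite !addn0; apply. Qed.

Lemma next_local : exists j, [/\ j <= N, next_cut w x = x + j & next_cut w' x' = x' + j].
Proof.
have [lty ley cy Hy] := is_nextP ltx; have near := next_near ltx.
exists (next_cut w x - x); have lej : next_cut w x - x <= N by rewrite leq_subLR.
split=> //; first by rewrite subnKC // ltnW.
apply: is_next_uniq (is_nextP ltx') _; split.
- by rewrite -[X in X < _]addn0 ltn_add2l subn_gt0.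
- rewrite leqNgt; apply/negP => lt.
  have lt1 : x' + (next_cut w x - x).-1 = size w' \/ size w' < x' + (next_cut w x - x).-1.
    by move: lt; lia.
  have : ~~ (x' + (next_cut w x - x).-1 < size w') by case: lt1; lia.
  by rewrite -ctx_lt; lia.
- move=> lt; rewrite -ctx_cut ?ctx_lt //.
  by rewrite subnKC ?(ltnW lty) // cy // -(subnKC (ltnW lty)) ctx_lt.
move=> z /andP[ltz ltzy].
have Ez : z = x' + (z - x') by rewrite subnKC // ltnW.
have lez : z - x' <= N by lia.
have ltz2 : x + (z - x') < next_cut w x by lia.
rewrite Ez -ctx_cut ?(leq_trans ltz2) //.
by apply: Hy; rewrite ltz2 andbT; lia.
Qed.

Lemma letter_local : letter w x = letter w' x'.
Proof.
have [j [lej E E']] := next_local; have [lty ley cy _] := is_nextP ltx.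
have obj_add i : i <= N -> x + i <= size w -> obj w (x + i) = obj w' (x' + i).
  move=> lei lexi; rewrite /obj !addn_eq0 ctx0.
  have Es : (x + i == size w) = (x' + i == size w').
    case: i lei lexi => [|i] lei lexi; first by rewrite !addn0 !ltn_eqF.
    have := ctx_lt lei; have := ctx_lt (ltnW lei); lia.
  rewrite Es; case: (x' + i =P _) => // ne.
  have le' : x' + i <= size w'.
    case: i lei lexi Es ne => [|i] lei lexi Es ne; first by rewrite addn0 ltnW.
    by have := ctx_lt (ltnW lei); lia.
  by rewrite !left_ctx_add // eq_left ctx_take.
have := obj_add 0 (leq0n _); rewrite !addn0 => /(_ (ltnW ltx)) E0.
rewrite /letter E E' E0 (obj_add j) //; last by rewrite -E.
by rewrite !drop_take_add ctx_take.
Qed.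

End Locality.

(** * Reading contexts with pebbles *)

Local Notation K := (2 * N).+1.

(** The positions at distance at most [N] from [x], in order; those that would fall outside the word
    are clipped to its first or last position. The entry of index [N] is [x]. *)
Definition window w x := [seq minn (size w).-1 (x + d - N) | d <- iota 0 K].

Lemma nth_window w x d : d < K -> nth 0 (window w x) d = minn (size w).-1 (x + d - N).
Proof. by move=> lt; rewrite (nth_map 0) ?size_iota // nth_iota ?add0n. Qed.

Lemma window_center w x : x < size w -> nth 0 (window w x) N = x.
Proof. by move=> ltx; rewrite nth_window ?addnK; lia. Qed.

Lemma window_pts w x : x < size w -> pts w K (window w x).
Proof.
move=> ltx; split; first by rewrite size_map size_iota.
move=> _ /mapP[d _ ->]; apply: leq_ltn_trans (geq_minl _ _) _.
by rewrite ltn_predL (leq_ltn_trans _ ltx).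
Qed.

Lemma onth_take (T : Type) n (s : seq T) i :
  onth (take n s) i = if i < n then onth s i else None.
Proof. by elim: s n i => [|x s IH] [|n] [|i] //=; [rewrite if_same | rewrite IH ltnS]. Qed.

Lemma onth_drop (T : Type) n (s : seq T) i : onth (drop n s) i = onth s (n + i).
Proof. by elim: s n => [|x s IH] [|n] //=; rewrite onth0n. Qed.

Section Window.
Variables (w w' : seq A) (x : nat) (l : seq nat).
Hypothesis ltx : x < size w.
Hypothesis Hagree : agree w (window w x) w' l.
Hypothesis Hl : forall p, p \in l -> p < size w'.
Local Notation x' := (nth 0 l N).

Lemma window_agree d : d < K ->
  [/\ nth 0 l d < size w', onth w (minn (size w).-1 (x + d - N)) = onth w' (nth 0 l d),
      (minn (size w).-1 (x + d - N) == 0) = (nth 0 l d == 0),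
      ((minn (size w).-1 (x + d - N)).+1 == size w) = ((nth 0 l d).+1 == size w') &
      d.+1 < K -> (minn (size w).-1 (x + d.+1 - N) == (minn (size w).-1 (x + d - N)).+1) =
      (nth 0 l d.+1 == (nth 0 l d).+1)].
Proof.
move=> ltd; have [sz H] := Hagree.
have szw : size (window w x) = K by rewrite size_map size_iota.
have [|H1 H2 H3 H4] := H d; first by rewrite szw.
rewrite -(nth_window w x ltd); split=> //.
  by apply: Hl; rewrite mem_nth // -sz szw.
move=> ltd'; have [|_] := H4 d.+1; first by rewrite szw.
by rewrite nth_window.
Qed.

Lemma window_pos d z : x + d = z + N -> z < size w ->
  minn (size w).-1 (x + d - N) = z.
Proof.
move=> E ltz; rewrite E addnK; apply/minn_idPr.
by rewrite -ltnS prednK // (leq_ltn_trans _ ltz).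
Qed.

(** Induction on [j]: the successor atom moves the answer by one step, and the atom for the last
    position makes both words end at the same time. *)
Lemma window_right j : j <= N -> onth w (x + j) = onth w' (x' + j) /\
  (x + j < size w -> nth 0 l (N + j) = x' + j).
Proof.
elim: j => [|j IH] lej.
  have [|_ E _ _ _] := window_agree (d := N); first by lia.
  by rewrite !addn0 -E (window_pos (z := x)).
have [E1 E2] := IH (ltnW lej).
have [|_ _ _ Emax Esucc] := window_agree (d := N + j); first by lia.
have [lt|le] := ltnP (x + j.+1) (size w); last first.
  split=> //; rewrite onth_default //; have [lt2|le2] := ltnP (x + j) (size w).
    have Ep : minn (size w).-1 (x + (N + j) - N) = x + j.
      by apply: window_pos => //; lia.
    move: Emax; rewrite Ep E2 // => Emax; rewrite onth_default //.
    have : (x + j).+1 == size w by lia.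
    by rewrite Emax => /eqP <-; rewrite addnS.
  rewrite onth_default //; rewrite leqNgt; apply/negP => lt.
  have lt' : x' + j < size w' by apply: leq_ltn_trans lt; rewrite leq_add2l.
  move: E1; rewrite onth_default //; case: (w') lt' => // a v lt'.
  by rewrite (onth_some a lt').
have [|_ E _ _ _] := window_agree (d := N + j.+1); first by lia.
have lt' : x + j < size w by lia.
have Ep : minn (size w).-1 (x + (N + j) - N) = x + j.
  by apply: window_pos => //; lia.
have Ep' : minn (size w).-1 (x + (N + j.+1) - N) = x + j.+1.
  by apply: window_pos => //; lia.
move: Esucc; rewrite addnS in E Ep' *; rewrite Ep Ep' E2 // => Esucc.
have : (x + j.+1 == (x + j).+1) by rewrite addnS.
rewrite Esucc => [/eqP El|]; last by lia.
by rewrite -Ep' E El addnS.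
Qed.

Lemma sub_ltK j : N - j < K. Proof. by clear; lia. Qed.

Lemma add_sub_pos j : j <= N -> j <= x -> x + (N - j) = x - j + N.
Proof. by clear; lia. Qed.

(** Symmetric to [window_right], with the atom for the first position. *)
Lemma window_left j : j <= N -> (j <= x) = (j <= x') /\
  (j <= x -> nth 0 l (N - j) = x' - j /\ onth w (x - j) = onth w' (x' - j)).
Proof.
elim: j => [|j IH] lej.
  rewrite !leq0n !subn0; split=> // _; split=> //.
  by have [] := window_right (leq0n N); rewrite !addn0.
have [E1 E2] := IH (ltnW lej).
have [_ _ E0 _ _] := window_agree (sub_ltK j).
have [_ E _ _ Esucc] := window_agree (sub_ltK j.+1).
have [lejx|ltxj] := leqP j x; last first.
  rewrite leqNgt ltxj in E1; rewrite [j < x]leqNgt ltnS (ltnW ltxj) /=; split=> //.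
  by apply/esym/negbTE; rewrite -leqNgt ltnW // ltnNge -E1.
have [E3 E4] := E2 lejx; rewrite lejx in E1.
have Ep : minn (size w).-1 (x + (N - j) - N) = x - j.
  apply: window_pos; first exact: add_sub_pos (ltnW lej) lejx.
  exact: leq_ltn_trans (leq_subr _ _) ltx.
rewrite (subnSK lej) Ep E3 in Esucc *; rewrite Ep E3 in E0.
have [ltjx|lexj] := ltnP j x; last first.
  have : x - j == 0 by rewrite subn_eq0.
  by rewrite E0 subn_eq0 => le'; rewrite [in RHS]ltnNge le'.
have Ep' : minn (size w).-1 (x + (N - j.+1) - N) = x - j.+1.
  apply: window_pos; first exact: add_sub_pos lej ltjx.
  exact: leq_ltn_trans (leq_subr _ _) ltx.
rewrite Ep' in Esucc E.
have : x - j == (x - j.+1).+1 by rewrite subnSK.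
rewrite Esucc => [/eqP El|]; last by rewrite ltnS (leq_trans (leq_subr _ _)) // leq_pmull.
have El' : nth 0 l (N - j.+1) = x' - j.+1 by rewrite [in RHS]subnS El.
have ltj : j < x' by rewrite -subn_gt0 El.
by rewrite ltj; split=> // _; rewrite E El'.
Qed.

Lemma window_ctx : [/\ x' < size w', left_ctx w x = left_ctx w' x' &
  right_ctx w x = right_ctx w' x'].
Proof.
have ltx' : x' < size w'.
  by have [] := window_agree (d := N); lia.
split=> //; last first.
  apply: eq_from_onth => i; rewrite /right_ctx !onth_take !onth_drop.
  by case: ltnP => //; rewrite ltnS => /window_right[].
have Em : minn N x = minn N x'.
  have [[+ _] [+ _]] := (window_left (leqnn N), (window_left (j := minn N x) (geq_minl _ _))).
  have [+ _] := window_left (j := minn N x') (geq_minl _ _); lia.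
have Ectx (v : seq A) z : left_ctx v z = drop (z - minn N z) (take z v).
  by rewrite /left_ctx; congr (drop _ _); lia.
apply: eq_from_onth => i; rewrite !Ectx !onth_drop !onth_take -Em.
have [lt|le] := ltnP i (minn N x); last first.
  have -> : (x - minn N x + i < x) = false by lia.
  by have -> : (x' - minn N x + i < x') = false by lia.
have lei : minn N x - i <= N by lia.
have [_ [|_]] := window_left lei; first by lia.
have -> : x - (minn N x - i) = x - minn N x + i by lia.
have -> : x' - (minn N x - i) = x' - minn N x + i by lia.
move=> ->; have -> : (x - minn N x + i < x) by lia.
by have -> : (x' - minn N x + i < x') by lia.
Qed.

End Window.

Lemma mem_cuts w x : (x \in cuts w (size w)) = (x < size w) && cut w x.
Proof. by rewrite mem_filter mem_iota add0n andbC. Qed.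

Lemma cuts_sorted w y : sorted ltn (cuts w y).
Proof. by apply: sorted_filter (iota_ltn_sorted _ _); apply: ltn_trans. Qed.

Lemma nth_flatten_const k (ss : seq (seq nat)) i d :
  (forall s, s \in ss -> size s = k) -> i < size ss -> d < k ->
  nth 0 (flatten ss) (i * k + d) = nth 0 (nth [::] ss i) d.
Proof.
elim: ss i => //= s ss IH i Hs lti ltd; have szs := Hs s (mem_head _ _).
rewrite nth_cat szs; case: i lti => [|i] lti; first by rewrite ltd.
have -> : (i.+1 * k + d < k) = false by rewrite mulSn; lia.
rewrite mulSn -addnA addKn IH // => t Ht.
by apply: Hs; rewrite inE Ht orbT.
Qed.

Lemma agree_sym w l w' l' : agree w l w' l' -> agree w' l' w l.
Proof.
case=> sz H; split=> // i; rewrite -sz => /H[H1 H2 H3 H4]; split=> // j.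
by case/H4=> -> ->.
Qed.

(** A cut and its letter are determined by a window of [K] positions. Each of the [n] marks costs
    one window in the first round, and the single position of the second round costs one more. *)
Theorem game_canon n w w' : w != [::] -> w' != [::] ->
  game (n * K) K w w' -> le2 n 1 (canon w) (canon w').
Proof.
move=> w0 w'0 gww' ds l szds Eds.
pose cs := cuts w (size w); pose ms := marked ds cs.
have msw x : x \in ms -> x < size w /\ cut w x.
  move=> /(marked_mem (f := letter w) (l := l)) H; have : x \in cs by apply: H.
  by rewrite mem_cuts => /andP[].
have szms : size ms <= n by rewrite size_marked.
(* The game places an exact number of pebbles, so the marks are padded with position 0. *)
pose mk := ms ++ nseq (n - size ms) 0.
have szmk : size mk = n by rewrite size_cat size_nseq subnKC.
have mkw x : x \in mk -> x < size w.
  rewrite mem_cat => /orP[/msw[]//|/nseqP[-> _]].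
  by rewrite lt0n size_eq0.
have szwin (v : seq A) x : size (window v x) = K by rewrite size_map size_iota.
have Hxs : pts w (n * K) (flatten (map (window w) mk)).
  split.
    rewrite size_flatten /shape -map_comp -szmk.
    rewrite (eq_map (g := fun=> K)); last by move=> y; apply: szwin.
    by elim: (mk) => //= y s ->; rewrite mulSn.
  by move=> p /flattenP[_ /mapP[x Hx ->] Hp]; have [_] := window_pts (mkw x Hx); apply.
have [ys [szys Hys] Hgame] := gww' _ Hxs.
pose pi x := nth 0 ys (index x ms * K + N).
have nK m : (K + m < K) = false by rewrite ltnNge leq_addr.
have nth_xs x d : x \in ms -> d < K ->
    nth 0 (flatten (map (window w) mk)) (index x ms * K + d) = nth 0 (window w x) d.
  move=> Hx ltd; have lti : index x ms < size ms by rewrite index_mem.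
  rewrite nth_flatten_const ?size_map ?szmk ?(leq_trans lti) //; last first.
    by move=> s /mapP[y _ ->].
  rewrite (nth_map 0) ?szmk ?(leq_trans lti) // nth_cat lti nth_index //.
have idx x d : x \in ms -> d < K -> index x ms * K + d < n * K.
  move=> Hx ltd; have lti : index x ms < n by apply: leq_trans szms; rewrite index_mem.
  apply: (@leq_trans ((index x ms).+1 * K)); last by rewrite leq_mul2r lti orbT.
  by rewrite (mulSn (index x ms)) [X in _ < X]addnC ltn_add2l.
have agr_ms x zs ts : x \in ms -> pts w' K zs -> pts w K ts ->
    agree w (ts ++ flatten (map (window w) mk)) w' (zs ++ ys) ->
    agree w (window w x) w' (take K (drop (index x ms * K) ys)).
  move=> Hx [szz _] [szt _] agr.
  have ltK : K <= size (drop (index x ms * K) ys).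
    by rewrite size_drop szys leq_subRL; have := idx x (2 * N) Hx (ltnSn _); lia.
  apply: (agree_sub (h := fun d => K + (index x ms * K + d)) agr).
  - by rewrite szwin size_takel.
  - move=> d; rewrite szwin size_cat szt => ltd; rewrite ltn_add2l.
    by case: Hxs => -> _; apply: idx.
  - by move=> d; rewrite szwin => ltd; rewrite nth_cat szt ltnNge leq_addr addKn nth_xs.
  - move=> d; rewrite szwin => ltd; rewrite nth_cat szz ltnNge leq_addr addKn.
    by rewrite nth_take // nth_drop.
have piE x : x \in ms -> pi x = nth 0 (take K (drop (index x ms * K) ys)) N.
  by move=> Hx; rewrite nth_take ?nth_drop //; lia.
have [zs0 Hzs0] := pts_ex K w'0; have [ts0 Hts0 agr0] := Hgame _ Hzs0.
have order_xs x i zs ts : x \in ms -> i < K -> pts w' K zs -> pts w K ts ->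
    agree w (ts ++ flatten (map (window w) mk)) w' (zs ++ ys) ->
    (x < nth 0 ts i) = (pi x < nth 0 zs i) /\ (nth 0 ts i < x) = (nth 0 zs i < pi x).
  move=> Hx lti [szz _] [szt _] [_ H].
  have ltN : N < K by lia.
  have lt1 : i < size (ts ++ flatten (map (window w) mk)).
    by rewrite size_cat szt ltn_addr.
  have lt2 : K + (index x ms * K + N) < size (ts ++ flatten (map (window w) mk)).
    by rewrite size_cat szt ltn_add2l; case: Hxs => -> _; apply: idx.
  have [_ _ _ /(_ _ lt2)[E _]] := H _ lt1; have [_ _ _ /(_ _ lt1)[E' _]] := H _ lt2.
  move: E E'; rewrite !nth_cat szt szz lti nK addKn nth_xs //.
  by rewrite window_center //; have [] := msw x Hx.
apply: (@fits_map _ (letter w) (letter w') pi ds l cs (cuts w' (size w'))).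
- exact: cuts_sorted.
- exact: cuts_sorted.
- by rewrite -Eds.
- move=> x Hx; have [ltx cx] := msw x Hx.
  have [|ltp EL ER] := window_ctx ltx (agr_ms _ _ _ Hx Hzs0 Hts0 agr0).
    by move=> p /mem_take/mem_drop/Hys.
  rewrite -piE // in ltp EL ER; rewrite mem_cuts ltp.
  by rewrite -(cut_local ltx ltp EL ER) cx -(letter_local ltx ltp EL ER).
(* The second round is played on the window of [c']; the centre of the answer is a cut of [w] with
   the same letter, on the same side of every mark. *)
- move=> c'; rewrite mem_cuts => /andP[ltc' cc'].
  have Hzs := window_pts ltc'; have [ts Hts agr] := Hgame _ Hzs.
  have agr' : agree w' (window w' c') w ts.
    apply: agree_sym; have [szt _] := Hts.
    apply: (agree_sub (h := id) agr); rewrite ?szwin ?szt // => i lti.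
    - by rewrite size_cat szt ltn_addr.
    - by rewrite nth_cat szt lti.
    - by rewrite nth_cat szwin lti.
  have [|ltc EL ER] := window_ctx ltc' agr'; first by case: Hts.
  exists (nth 0 ts N); rewrite mem_cuts ltc -(cut_local ltc' ltc EL ER) cc'.
  rewrite -(letter_local ltc' ltc EL ER); split=> // x Hx.
  have := @order_xs x N (window w' c') ts Hx _ Hzs Hts agr.
  by rewrite window_center //; apply; lia.
move=> x y Hx Hy ltxy; have [_ H] := agr0.
have [[szz _] [szt _]] := (Hzs0, Hts0).
have ltN : N < K by lia.
have lt1 z : z \in ms -> K + (index z ms * K + N) < size (ts0 ++ flatten (map (window w) mk)).
  by move=> Hz; rewrite size_cat szt ltn_add2l; case: Hxs => -> _; apply: idx.
have [_ _ _ /(_ _ (lt1 y Hy))[E _]] := H _ (lt1 x Hx).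
move: E; rewrite !nth_cat szt szz !nK !addKn !nth_xs //.
rewrite !window_center; try by [have [] := msw x Hx | have [] := msw y Hy].
by rewrite ltxy => /esym.
Qed.

End Canonical.

(** * The criterion *)

Section Criterion.
Variables (A S C : finType) (mul : S -> S -> S) (one : S).
Hypothesis mulA : associative mul.
Hypothesis mul1x : left_id one mul.
Hypothesis mulx1 : right_id one mul.
Variable alpha : A -> S.
Variables (blk : object S -> S -> object S -> C).
Variables (op : C -> C -> C) (unit_C zero_C : C).
Hypothesis opA : associative op.
Hypothesis op1x : left_id unit_C op.
Hypothesis opx1 : right_id unit_C op.
Hypothesis opx0 : right_zero zero_C op.
Hypothesis blk_op : forall f s g t h,
  op (blk f s g) (blk g t h) = blk f (mul s t) h.
Hypothesis blk_mismatch : forall f s g g' t h, g <> g' ->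
  op (blk f s g) (blk g' t h) = zero_C.
Variables (F1 F2 : S -> Prop) (H1 H2 : C -> Prop).
Hypothesis H1_blk : forall f s g, H1 (blk f s g) <-> [/\ f = Start S, g = End S & F1 s].
Hypothesis H2_blk : forall f s g, H2 (blk f s g) <-> [/\ f = Start S, g = End S & F2 s].
Hypothesis H1_zero : ~ H1 zero_C.
Hypothesis H2_zero : ~ H2 zero_C.
Hypothesis H1_unit : ~ H1 unit_C.
Hypothesis H2_unit : ~ H2 unit_C.

Local Notation nuS := (nu mul one alpha).
Local Notation okG := (letter_ok mul blk).

Section Realizable.
Variable Gs : {set S}.
Hypothesis Gs_words : forall s, s \in Gs -> exists2 w : seq A, w != [::] & nuS w = s.

Variables (n m : nat).
Hypothesis separated : forall w w', w != [::] -> w' != [::] -> game n m w w' ->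
  F1 (nuS w) -> ~ F2 (nuS w').

(** A word of letters whose ends do not match has value [zero_C], accepted on neither side. An
    accepted word is therefore chained, and its unfolding has the label of its value, since the
    inserted loops are absorbed. *)
Lemma le2_separated U V : (forall a, a \in U -> okG Gs a) ->
  (forall a, a \in V -> okG Gs a) -> le2 (2 * n) m.+1 U V ->
  H1 (value op unit_C U) -> ~ H2 (value op unit_C V).
Proof.
(* [blk] is not assumed injective, so one decomposition is fixed for each letter. *)
have /choice[rep Hrep] : forall c, exists r : object S * S * object S, okG Gs c ->
    let: (f, s, g) := r in [/\ c = blk f s g, s \in Gs,
      f = Start S \/ (exists2 e, e \in Gs & mul e e = e /\ f = Loop e) &
      g = End S \/ (exists2 e, e \in Gs & [/\ mul e e = e, g = Loop e & mul s e = s])].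
  move=> c; have [[f [s [g H]]]|no] := EM (okG Gs c).
    by exists (f, s, g).
  by exists (Start S, one, Start S).
case: U => [|c0 U0] okU; first by move=> _ _ /H1_unit.
have [a0 _] : exists a : A, True.
  have := Hrep c0 (okU _ (mem_head _ _)); case: (rep c0) => -[f s] g [_ /Gs_words[]].
  by case=> // a w _ _ _; exists a.
have /choice[wd Hwd] : forall s, exists w : seq A, w != [::] /\ (s \in Gs -> nuS w = s).
  move=> s; have [/Gs_words[w w0 <-]|_] := boolP (s \in Gs); first by exists w.
  by exists [:: a0].
pose dom c := (rep c).1.1; pose lab c := (rep c).1.2; pose cod c := (rep c).2.
pose loop_word f := if f is Loop e then wd e else [::].
pose lw c := loop_word (dom c); pose rw c := loop_word (cod c); pose mw c := wd (lab c).
pose L := n + m.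
have okP c : okG Gs c -> [/\ c = blk (dom c) (lab c) (cod c), lab c \in Gs,
      dom c = Start S \/ (exists2 e, e \in Gs & mul e e = e /\ dom c = Loop e) &
      cod c = End S \/ (exists2 e, e \in Gs & [/\ mul e e = e, cod c = Loop e & mul (lab c) e = lab c])].
  by move/Hrep; rewrite /dom /lab /cod; case: (rep c) => -[].
have paths c U : (forall a, a \in c :: U -> okG Gs a) ->
    value op unit_C (c :: U) = zero_C \/
    [/\ path (linked lw rw) c U & value op unit_C (c :: U) =
      blk (dom c) (nuS (mw c ++ text lw mw rw L 0 U)) (cod (last c U))].
  elim: U c => [|d U IH] c okcU.
    right; split=> //=; have [Ec labc _ _] := okP c (okcU _ (mem_head _ _)).
    by rewrite opx1 /mw cats0 (proj2 (Hwd _) labc) -Ec.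
  have okdU a : a \in d :: U -> okG Gs a by move=> Ha; apply: okcU; rewrite inE Ha orbT.
  have [Ec labc dc cc] := okP c (okcU _ (mem_head _ _)).
  have [Ed labd dd cd] := okP d (okdU _ (mem_head _ _)).
  have vE : value op unit_C (c :: d :: U) = op c (value op unit_C (d :: U)) by [].
  have [v0|[pd vd]] := IH d okdU; first by left; rewrite vE v0 opx0.
  have [Ecd|ncd] := EM (cod c = dom d); last first.
    by left; rewrite vE vd {1}Ec blk_mismatch.
  (* The common object is [End] or a loop for the left letter, [Start] or a loop for the right one:
     it is a loop. *)
  have [e eG [ee Ee ce]] : exists2 e, e \in Gs & [/\ mul e e = e, dom d = Loop e & mul (lab c) e = lab c].
    case: cc => [Eend|[e eG [ee Ee ce]]]; last by exists e; rewrite -?Ecd.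
    by case: dd => [|[e _ [_]]]; rewrite -Ecd Eend.
  right; split.
    rewrite /= pd andbT /linked /rw /lw Ecd eqxx Ee /=.
    by have [] := Hwd e.
  rewrite vE vd {1}Ec Ecd blk_op [last c _]/=; congr (blk _ _ _).
  have -> : text lw mw rw L 0 (d :: U) =
      flatten (nseq L (lw d)) ++ mw d ++ text lw mw rw L 0 U.
    by rewrite /text /= /piece subn0 cats0 catA.
  rewrite [RHS](nu_cat mulA mul1x) (nu_cat mulA mul1x _ (flatten _)) (proj2 (Hwd _) labc).
  have nu_lw : nuS (lw d) = e by rewrite /lw Ee /= (proj2 (Hwd _) eG).
  have absorb k : mul (lab c) (nuS (flatten (nseq k (lw d)))) = lab c.
    elim: k => [|k IHk] /=; first by rewrite mulx1.
    by rewrite (nu_cat mulA mul1x) mulA nu_lw ce.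
  by rewrite mulA absorb.
have text_ok c U H F : (forall f s g, H (blk f s g) <-> [/\ f = Start S, g = End S & F s]) ->
    ~ H zero_C -> (forall a, a \in c :: U -> okG Gs a) -> H (value op unit_C (c :: U)) ->
    chained lw rw (c :: U) /\ F (nuS (text lw mw rw L 0 (c :: U))).
  move=> H_blk H_zero okcU; case: (paths c U okcU) => [->//|[pU ->]].
  case/H_blk => Ec El HF; rewrite /= /lw Ec /= pU /rw El /= eqxx; split=> //.
  rewrite /text /= /piece cats0 /lw Ec /=.
  by have -> : flatten (nseq (L - 0) [::]) = [::] :> seq A by elim: (L - 0).
have text0 c U : text lw mw rw L 0 (c :: U) != [::].
  have [mw0 _] := Hwd (lab c); rewrite -size_eq0 -lt0n /text /= size_cat.
  by rewrite ltn_addr // piece_gt0 // => d; have [] := Hwd (lab d).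
case: V => [|d V] okV leUV H1U H2V; first exact: H2_unit H2V.
have [cU F1U] := text_ok _ _ _ _ H1_blk H1_zero okU H1U.
have [cV F2V] := text_ok _ _ _ _ H2_blk H2_zero okV H2V.
apply: separated F1U F2V; rewrite ?text0 //.
by apply: (le2_game _ c0) leUV => // x; have [] := Hwd (lab x).
Qed.

End Realizable.

(** The certificate may use any closed set [Gs] of values that contains the letters. Conversely [Gs]
    is the set of values of nonempty words, so that each label and each loop is realized by a
    word. *)
Theorem criterion :
  (exists Gs : {set S}, [/\ forall a, alpha a \in Gs,
     forall s t, s \in Gs -> t \in Gs -> mul s t \in Gs &
     exists2 c, saturated op unit_C (okG Gs) c & conflict_free H1 H2 c]) <->
  exists n m, forall w w' : seq A, w != [::] -> w' != [::] -> game n m w w' ->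
    F1 (nuS w) -> ~ F2 (nuS w').
Proof.
split=> [[Gs [Ga Gm [c c_sat c_free]]]|[n [m sep]]].
  have [n Hn] := saturated_separates opA op1x opx1 c_sat c_free.
  exists (n * (2 * #|S|).+1), (2 * #|S|).+1 => w w' w0 w'0 gww' F1w F2w'.
  have leww' : le2 n 1 (canon mul one alpha blk Gs #|S| w) (canon mul one alpha blk Gs #|S| w').
    exact: game_canon.
  apply: Hn leww' _ _.
  - move=> a /mapP[x]; rewrite mem_cuts => /andP[ltx cx] ->; exact: letter_okP.
  - by rewrite (value_canon mulA) //; apply/H1_blk.
  - by rewrite (value_canon mulA) //; apply/H2_blk.
pose Gs : {set S} := [set s | `[< exists2 w : seq A, w != [::] & nuS w = s >]].
exists Gs; split.
- by move=> a; rewrite inE; apply/asboolP; exists [:: a]; rewrite //= mulx1.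
- move=> s t; rewrite !inE => /asboolP[w w0 <-] /asboolP[w' w'0 <-]; apply/asboolP.
  by exists (w ++ w'); [case: w w0 | rewrite (nu_cat mulA mul1x)].
exists (Sat op unit_C (okG Gs)); first exact: Sat_saturated.
apply: (Sat_conflict_free opA op1x opx1 (n := 2 * n) (k := m)) => U V okU okV leUV.
apply: (@le2_separated Gs _ n m sep) leUV => // s.
by rewrite inE => /asboolP.
Qed.

End Criterion.

(** * Separation and games *)

Section Games.
Variable A : finType.
Implicit Types (w : seq A) (L : pred (seq A)).

Lemma agree_trans w l w1 l1 w2 l2 :
  agree w l w1 l1 -> agree w1 l1 w2 l2 -> agree w l w2 l2.
Proof.
move=> [sz H] [sz' H']; split=> [|i lti]; first by rewrite sz.
have [E1 E2 E3 E4] := H i lti; rewrite sz in lti.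
have [E1' E2' E3' E4'] := H' i lti; rewrite E1 E2 E3; split=> // j ltj.
have [-> ->] := E4 j ltj; rewrite sz in ltj; exact: E4'.
Qed.

Lemma agree_refl w l : agree w l w l.
Proof. by split. Qed.

Lemma game_refl n m w : game n m w w.
Proof.
move=> xs Hxs; exists xs => // zs Hzs; exists zs => //; exact: agree_refl.
Qed.

Lemma game_trans n m w w1 w2 : game n m w w1 -> game n m w1 w2 -> game n m w w2.
Proof.
move=> H1 H2 xs /H1[ys /H2[zs Hzs G2] G1]; exists zs => // us /G2[ts /G1[ss Hss a1] a2].
by exists ss => //; apply: agree_trans a2.
Qed.

(** The separator consists of the nonempty words above some nonempty word of [L1], and of the empty
    word if [L1] contains it. The game does not constrain the empty word, which therefore has its
    own condition. *)
Theorem Sigma2_separableE L1 L2 : separable (@Sigma2_language A) L1 L2 <->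
  ~ (L1 [::] /\ L2 [::]) /\ exists n m, forall w w', w != [::] -> w' != [::] ->
    game n m w w' -> L1 w -> ~ L2 w'.
Proof.
split=> [[K [[phi sphi EK] L1K KL2]]|[nil [n [m H]]]].
  have KN w : K w -> ~ L2 w by move=> Kw L2w; have := KL2 w; rewrite Kw L2w.
  split; first by case=> /L1K/KN.
  have [n [m Hg]] := Sigma2_game sphi; exists n, m => w w' w0 w'0 gww' /L1K Kw.
  by apply: KN; rewrite EK (Hg w w') // -EK.
pose K w := (exists v, [/\ v != [::], w != [::], L1 v & game n m v w]) \/
  (w = [::] /\ L1 [::]).
have [|phi sphi phiE] := @game_closed_Sigma2 A n m K.
  move=> w w' w0 w'0 gww' [[v [v0 _ Lv gvw]]|[E _]]; last by rewrite E in w0.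
  by left; exists v; split=> //; apply: game_trans gww'.
exists (models phi); split; first by exists phi.
  move=> w Lw; apply/phiE; have [E|w0] := eqVneq w [::].
    by right; rewrite -E.
  by left; exists w; split=> //; apply: game_refl.
move=> w; apply/negP => /andP[/phiE[[v [v0 w0 Lv gvw]]|[E L1n]] L2w].
  exact: H gvw Lv L2w.
by apply: nil; rewrite -{2}E.
Qed.

End Games.

(** * Exchanging the two levels by negation *)

Fixpoint prenex_neg (A : Type) (n : nat) (phi : formula A n) : formula A n :=
  match phi with
  | FEx f => FAll (prenex_neg f)
  | FAll f => FEx (prenex_neg f)
  | f => FNot f
  end.

Lemma sat_prenex_neg (A : eqType) (w : seq A) n (phi : formula A n)
    (e : 'I_n -> 'I_(size w)) : sat (prenex_neg phi) e = ~~ sat phi e.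
Proof.
elim: phi e => //= {n} n f IH e.
  by rewrite negb_exists; apply: eq_forallb => x; rewrite IH.
by rewrite negb_forall; apply: eq_existsb => x; rewrite IH.
Qed.

Lemma level2_neg (A : eqType) q n (phi : formula A n) :
  level2 q phi -> level2 (dual q) (FNot phi).
Proof.
case=> psi [ppsi Epsi] bl; exists (prenex_neg psi).
  split; last by move=> w e w0; rewrite sat_prenex_neg -Epsi.
  by elim: psi {bl Epsi} ppsi => //=.
have -> : blocks (prenex_neg psi) = map dual (blocks psi).
  by elim: psi {bl Epsi ppsi} => //= k f ->; case: (blocks f) => [|[]].
rewrite size_map; case: bl => [->|]; last by right.
by left; case: q.
Qed.

(** The complement of a separator separates the two languages in the other direction. *)
Lemma Pi2_separableE (A : eqType) (L1 L2 : pred (seq A)) :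
  separable (@Pi2_language A) L1 L2 <-> separable (@Sigma2_language A) L2 L1.
Proof.
have neg q (L L' : pred (seq A)) :
    separable (fun K => exists2 phi : formula A 0, level2 q phi & K =1 models phi) L L' ->
    separable (fun K => exists2 phi : formula A 0, level2 (dual q) phi & K =1 models phi) L' L.
  case=> K [[phi sphi EK] LK KL']; exists (fun w => ~~ K w); split.
  - by exists (FNot phi); [apply: level2_neg | move=> w; rewrite EK].
  - by move=> w L'w; have := KL' w; rewrite L'w andbT.
  - by move=> w; apply/negP => /andP[/negP nK /LK].
by split; [apply: (@neg Universal) | apply: (@neg Existential)].
Qed.

(** * Numbers as sets and relations *)

Lemma bitS x i : bit x i.+1 = bit x./2 i.
Proof. by rewrite /bit iterSr. Qed.

Lemma bit_zero i : bit 0 i = false.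
Proof. by elim: i => // i IH; rewrite bitS. Qed.

Fixpoint mkbits (n : nat) (p : pred nat) : nat :=
  if n is n'.+1 then p 0 + (mkbits n' (fun i => p i.+1)).*2 else 0.

Lemma mkbits_lt n p : mkbits n p < 2 ^ n.
Proof.
elim: n p => //= n IH p; have := IH (fun i => p i.+1).
by rewrite expnS; case: (p 0); lia.
Qed.

Lemma bit_mkbits n p i : i < n -> bit (mkbits n p) i = p i.
Proof.
elim: n p i => //= n IH p [|i] lti; first by rewrite /bit /= oddD odd_double addbF; case: (p 0).
by rewrite bitS half_bit_double IH.
Qed.

Lemma bit_ext n x y : x < 2 ^ n -> y < 2 ^ n ->
  (forall i, i < n -> bit x i = bit y i) -> x = y.
Proof.
elim: n x y => [|n IH] x y; first by case: x; case: y.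
rewrite expnS => ltx lty H.
rewrite -[x]odd_double_half -[y]odd_double_half -![odd _]/(bit _ 0) (H 0) //; congr (_ + _.*2).
by apply: IH; [lia | lia | move=> i lti; rewrite -!bitS; apply: H].
Qed.

Lemma bit_bound x i : bit x i -> i < x.
Proof.
elim: i x => [|i IH] x; first by case: x.
by rewrite bitS => /IH; lia.
Qed.

(* The code of [n1; ...; nk] has the binary digit 1 exactly at the positions
   [n1], [n1 + n2 + 1], and so on. *)
Lemma bit_code_cons v s i : bit (CodeSeq.code (v :: s)) i =
  if i < v then false else if i == v then true else bit (CodeSeq.code s) (i - v.+1).
Proof.
rewrite /= mulnC; elim: v i => [|v IH] [|i] //=.
- by rewrite expn0 muln1 /bit /= odd_double.
- by rewrite expn0 muln1 bitS -[_.*2.+1]/(true + _) half_bit_double subSS subn0.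
- by rewrite expnS mulnCA /bit /= oddM.
- by rewrite bitS expnS mulnCA mul2n doubleK IH ltnS eqSS subSS.
Qed.

(** A member [x] is a run of exactly [x] zeros before a 1, starting at [j], where [j] is 0 or
    follows a 1. The bounds on [j] and [j'] put the condition in bounded form. *)
Lemma mem_code s x : x \in s <->
  exists2 j, j < CodeSeq.code s & [/\ bit (CodeSeq.code s) (j + x),
    forall i, i < x -> ~ bit (CodeSeq.code s) (j + i) &
    j = 0 \/ exists2 j', j' < j & j = j'.+1 /\ bit (CodeSeq.code s) j'].
Proof.
suff H : x \in s <-> exists j, [/\ bit (CodeSeq.code s) (j + x),
    forall i, i < x -> ~ bit (CodeSeq.code s) (j + i) &
    j = 0 \/ exists2 j', j' < j & j = j'.+1 /\ bit (CodeSeq.code s) j'].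
  rewrite H; split=> [[j [H1 H2 H3]]|[j _ H']]; exists j => //.
  by apply: leq_ltn_trans (bit_bound H1); apply: leq_addr.
elim: s x => [|v s IH] x.
  by split=> // -[j []]; rewrite /= bit_zero.
have Bv i : bit (CodeSeq.code (v :: s)) (v.+1 + i) = bit (CodeSeq.code s) i.
  by rewrite bit_code_cons ltnNge leqW ?leq_addr //= gtn_eqF ?addKn // addSn ltnS leq_addr.
have Bvv : bit (CodeSeq.code (v :: s)) v by rewrite bit_code_cons ltnn eqxx.
have Blt i : i < v -> ~ bit (CodeSeq.code (v :: s)) i by rewrite bit_code_cons => ->.
rewrite inE; split=> [/orP[/eqP->|/IH[j [H1 H2 H3]]]|[j [H1 H2 H3]]].
- by exists 0; rewrite !add0n; split=> //; left.
- exists (v.+1 + j); rewrite -addnA Bv; split=> // [i lti|].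
    by rewrite -addnA Bv; apply: H2.
  right; case: H3 => [->|[j' _ [-> Hj']]].
    by exists v; rewrite ?addn0.
  by exists (v.+1 + j'); rewrite ?addnS // Bv.
case: H3 => [j0|[j' _ [Ej Hj']]].
  rewrite j0 add0n in H1; apply/orP; left.
  case: (ltngtP x v) => // [/Blt//|ltvx].
  by have := H2 v ltvx; rewrite j0 add0n Bvv.
have lej' : v <= j' by rewrite leqNgt; apply/negP => /Blt.
have Ej2 : j = v.+1 + (j - v.+1) by rewrite subnKC // Ej.
apply/orP; right; apply/IH; exists (j - v.+1); rewrite -!Bv addnA -Ej2; split=> // [i lti|].
  by rewrite -Bv addnA -Ej2; apply: H2.
have [E|ne] := eqVneq j' v; first by left; rewrite Ej E subnn.
right; exists (j' - v.+1); first by rewrite Ej; lia.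
have lt : v < j' by rewrite ltn_neqAle eq_sym ne.
by rewrite -Bv subnKC // Ej; split=> //; lia.
Qed.

Definition related (d x i j : nat) : bool := bit x (i * d + j).

Section Relations.
Variable d : nat.
Notation number := 'I_(2 ^ (d * d)).
Implicit Types (x y z : number) (p : nat -> nat -> bool).

Definition mkrel p : number :=
  Ordinal (mkbits_lt (d * d) (fun k => p (k %/ d) (k %% d))).

Lemma index_lt i j : i < d -> j < d -> i * d + j < d * d.
Proof.
move=> lti ltj; apply: (@leq_trans (i.+1 * d)); last by rewrite leq_mul2r lti orbT.
by rewrite mulSn addnC ltn_add2r.
Qed.

Lemma rel_mkrel p i j : i < d -> j < d -> related d (mkrel p) i j = p i j.
Proof.
move=> lti ltj; rewrite /related bit_mkbits ?index_lt // divnMDl ?(leq_trans _ lti) //.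
by rewrite divn_small // addn0 modnMDl modn_small.
Qed.

Lemma rel_ext x y : (forall i j, i < d -> j < d -> related d x i j = related d y i j) -> x = y.
Proof.
move=> H; apply/val_inj/(bit_ext (ltn_ord x) (ltn_ord y)) => k ltk.
have d0 : 0 < d by case: (d) ltk.
rewrite (divn_eq k d); apply: H; last by rewrite ltn_mod.
by rewrite ltn_divLR.
Qed.

Definition compose x y : number :=
  mkrel (fun i j => has (fun l => related d x i l && related d y l j) (iota 0 d)).

Definition diag : number := mkrel (fun i j => i == j).

Definition empty_rel : number := mkrel (fun _ _ => false).

Lemma rel_comp x y i j : i < d -> j < d ->
  related d (compose x y) i j <-> exists2 l, l < d & related d x i l /\ related d y l j.
Proof.
move=> lti ltj; rewrite rel_mkrel //; split=> [/hasP[l]|[l ltl [xl yl]]].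
  by rewrite mem_iota => /= ltl /andP[]; exists l.
by apply/hasP; exists l; rewrite ?mem_iota // xl.
Qed.

Lemma rel_diag i j : i < d -> j < d -> related d diag i j = (i == j).
Proof. exact: rel_mkrel. Qed.

Lemma rel_extP x y : (forall i j, i < d -> j < d -> related d x i j <-> related d y i j) -> x = y.
Proof. by move=> H; apply: rel_ext => i j lti ltj; apply/idP/idP => /H; apply. Qed.

Lemma compA : associative compose.
Proof.
move=> x y z; apply: rel_extP => i j lti ltj; rewrite !rel_comp //; split.
  case=> l ltl [xl /rel_comp[] // l' ltl' [yl zl]]; exists l' => //; split=> //.
  by apply/rel_comp => //; exists l.
case=> l ltl [/rel_comp[] // l' ltl' [xl yl] zl]; exists l' => //; split=> //.
by apply/rel_comp => //; exists l.
Qed.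

Lemma comp1x : left_id diag compose.
Proof.
move=> x; apply: rel_extP => i j lti ltj; rewrite rel_comp //; split.
  by case=> l ltl []; rewrite rel_diag // => /eqP->.
by move=> xij; exists i; rewrite // rel_diag.
Qed.

Lemma compx1 : right_id diag compose.
Proof.
move=> x; apply: rel_extP => i j lti ltj; rewrite rel_comp //; split.
  by case=> l ltl [xl]; rewrite rel_diag // => /eqP <-.
by move=> xij; exists j; rewrite // rel_diag.
Qed.

Lemma compx0 : right_zero empty_rel compose.
Proof.
move=> x; apply: rel_extP => i j lti ltj; rewrite rel_comp // rel_mkrel //; split=> //.
by case=> l ltl [_]; rewrite rel_mkrel.
Qed.

End Relations.

Arguments mkrel : simpl never.
Arguments compose : simpl never.
Arguments diag : simpl never.
Arguments empty_rel : simpl never.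

(** * Arrows as block matrices *)

Section Blocks.
Variable D : nat.
Hypothesis D_gt0 : 0 < D.
Let m := 2 ^ (D * D).
Let d := (m + 2) * D.

(** A loop is indexed by its value; the two ends take the first two numbers beyond the values. *)
Definition object_index (f : object 'I_(2 ^ (D * D))) : nat :=
  match f with Start => m | End => m.+1 | Loop e => e end.

Lemma object_index_lt f : object_index f < m + 2.
Proof. by case: f => [||e] /=; rewrite ?addn2 // ltnW // ltnW // !ltnS. Qed.

Lemma object_index_inj : injective object_index.
Proof.
have lt (e : 'I_(2 ^ (D * D))) : e < m by apply: ltn_ord.
case=> [||e] [||e'] //=; try by move/eqP; rewrite ?eqn_leq ?ltnn ?andbF.
- by move=> E; have := lt e'; rewrite -E ltnn.
- by move=> E; have := lt e'; rewrite -E ltnNge leqnSn.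
- by move=> E; have := lt e; rewrite E ltnn.
- by move=> E; have := lt e; rewrite E ltnNge leqnSn.
- by move/val_inj->.
Qed.

(** A Boolean matrix made of blocks of size [D], all zero except for the block [s] in row [f] and
    column [g]. Matching blocks multiply and the others give the empty relation. *)
Definition block_rel (f : object 'I_(2 ^ (D * D))) (s : 'I_(2 ^ (D * D)))
    (g : object 'I_(2 ^ (D * D))) : 'I_(2 ^ (((2 ^ (D * D) + 2) * D) * ((2 ^ (D * D) + 2) * D))) :=
  mkrel d (fun i j => [&& i %/ D == object_index f, j %/ D == object_index g &
                          related D s (i %% D) (j %% D)]).

Lemma row_lt p i : p < m + 2 -> i < D -> p * D + i < d.
Proof.
move=> ltp lti; apply: (@leq_trans (p.+1 * D)); first by rewrite mulSn addnC ltn_add2r.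
by rewrite leq_mul2r ltp orbT.
Qed.

Lemma row_decomp i : i < d -> exists p q, [/\ p < m + 2, q < D & i = p * D + q].
Proof.
move=> lti; exists (i %/ D), (i %% D); split; first by rewrite ltn_divLR.
  by rewrite ltn_mod.
exact: divn_eq.
Qed.

Lemma rel_block f s g p q i j : p < m + 2 -> q < m + 2 -> i < D -> j < D ->
  related d (block_rel f s g) (p * D + i) (q * D + j) =
  [&& p == object_index f, q == object_index g & related D s i j].
Proof.
move=> ltp ltq lti ltj.
rewrite rel_mkrel ?row_lt // !divnMDl // !(divn_small lti, divn_small ltj) !addn0.
by rewrite !modnMDl !modn_small.
Qed.

Lemma block_rel_comp f s g t h :
  compose (block_rel f s g) (block_rel g t h) = block_rel f (compose s t) h.
Proof.
apply: rel_extP => _ _ /row_decomp[p [i [ltp lti ->]]] /row_decomp[q [j [ltq ltj ->]]].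
rewrite rel_comp ?row_lt // rel_block //; split.
  case=> _ /row_decomp[r [l [ltr ltl ->]]]; rewrite !rel_block //.
  case=> /and3P[-> _ sil] /and3P[_ -> tlj]; apply/rel_comp => //.
  by exists l.
case/and3P=> Ep Eq /rel_comp[] // l ltl [sil tlj].
exists (object_index g * D + l); first by rewrite row_lt ?object_index_lt.
by rewrite !rel_block ?object_index_lt // Ep Eq sil tlj eqxx.
Qed.

Lemma block_rel_mismatch f s g g' t h : g <> g' ->
  compose (block_rel f s g) (block_rel g' t h) = empty_rel d.
Proof.
move=> ne; apply: rel_extP => i j lti ltj; rewrite rel_comp // rel_mkrel //; split=> //.
case=> l ltl; move: lti ltj ltl => /row_decomp[p [i' [? ? ->]]] /row_decomp[q [j' [? ? ->]]].
move=> /row_decomp[r [l' [? ? ->]]]; rewrite !rel_block //.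
case=> /and3P[_ /eqP-> _] /and3P[/eqP/object_index_inj E _ _].
by case: (ne E).
Qed.

End Blocks.

Arguments block_rel : simpl never.

(** * Automata as relations *)

Section Automata.
Variables (k : nat) (M1 M2 : nfa 'I_k) (N : nat).
Hypothesis N_gt0 : 0 < N.
Hypothesis init1_lt : forall p, p \in initials M1 -> p < N.
Hypothesis init2_lt : forall p, p \in initials M2 -> p < N.
Hypothesis trans1_lt : forall t, t \in transitions M1 -> t.1.1 < N /\ t.2 < N.
Hypothesis trans2_lt : forall t, t \in transitions M2 -> t.1.1 < N /\ t.2 < N.
Implicit Types (w : seq 'I_k) (p q : nat).

Local Notation D := (N + N).
Local Notation m := (2 ^ (D * D)).
Local Notation d := ((m + 2) * D).

Lemma D_gt0 : 0 < D. Proof. by rewrite addn_gt0 N_gt0. Qed.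

(* The two automata run side by side; the states of the second one are
   shifted by [N]. *)
Definition letter_edge (a : 'I_k) i j : bool :=
  [&& i < N, j < N & (i, a, j) \in transitions M1] ||
  [&& N <= i, N <= j & (i - N, a, j - N) \in transitions M2].

Definition letter_rel (a : 'I_k) : 'I_m := mkrel D (letter_edge a).

Local Notation nuA := (nu (@compose D) (diag D) letter_rel).

Definition recognizes (M : nfa 'I_k) (o : nat) (s : 'I_m) : Prop :=
  exists2 p, p < N & exists2 q, q < N &
    [/\ p \in initials M, q \in finals M & related D s (o + p) (o + q)].

(** [m] and [m.+1] are the indices of [Start] and [End]: only an arrow from [Start] to [End] is
    recognized. *)
Definition recognizes_block (M : nfa 'I_k) (o : nat) (c : 'I_(2 ^ (d * d))) : Prop :=
  exists2 p, p < N & exists2 q, q < N &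
    [/\ p \in initials M, q \in finals M &
        related d c (m * D + (o + p)) (m.+1 * D + (o + q))].

Section OneAutomaton.
Variables (M : nfa 'I_k) (o : nat).
Hypothesis o_le : o <= N.
Hypothesis init_lt : forall p, p \in initials M -> p < N.
Hypothesis trans_lt : forall t, t \in transitions M -> t.1.1 < N /\ t.2 < N.
Hypothesis edge_o : forall a p j, p < N -> j < D ->
  letter_edge a (o + p) j <-> exists2 r, r < N & j = o + r /\ (p, a, r) \in transitions M.

Lemma shift_lt p : p < N -> o + p < D.
Proof. by move=> ltp; rewrite -addnS leq_add. Qed.

Lemma accepts_rel p w : p < N -> accepts_from M p w <->
  exists2 q, q < N & q \in finals M /\ related D (nuA w) (o + p) (o + q).
Proof.
elim: w p => [|a w IH] p ltp; rewrite [accepts_from _ _ _]/=.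
  split=> [Fp|[q ltq [Fq]]]; last by rewrite rel_diag ?shift_lt // eqn_add2l => /eqP->.
  by exists p; rewrite // rel_diag ?shift_lt.
have -> : nuA (a :: w) = compose (letter_rel a) (nuA w) by [].
split=> [/hasP[[[p' b] r] tin /and3P[/eqP Ep /eqP Eb Hr]]|[q ltq [Fq]]].
  rewrite [p']Ep [b]Eb in tin; have [_ ltr] := trans_lt tin.
  have [q ltq [Fq rq]] := (IH r ltr).1 Hr.
  exists q => //; split=> //; rewrite rel_comp ?shift_lt //.
  exists (o + r); rewrite ?shift_lt //; split=> //.
  by rewrite rel_mkrel ?shift_lt //; apply/edge_o; rewrite ?shift_lt //; exists r.
rewrite rel_comp ?shift_lt // => -[l ltl []].
rewrite rel_mkrel ?shift_lt // => /edge_o[] // r ltr [El tin] rq.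
apply/hasP; exists (p, a, r) => //; apply/and3P; split=> //.
by apply/IH => //; exists q; rewrite -?El.
Qed.

Lemma recognizesE w : nfa_language M w <-> recognizes M o (nuA w).
Proof.
split=> [/hasP[p Ip /accepts_rel[|q ltq [Fq pq]]]|[p ltp [q ltq [Ip Fq pq]]]].
- exact: init_lt.
- by exists p; [apply: init_lt | exists q].
by apply/hasP; exists p => //; apply/accepts_rel => //; exists q.
Qed.

Lemma recognizes_blockE f s g : recognizes_block M o (block_rel f s g) <->
  [/\ f = Start _, g = End _ & recognizes M o s].
Proof.
have row p r : r < m + 2 -> p < N -> r * D + (o + p) < d.
  by move=> ltr ltp; apply: row_lt => //; apply: shift_lt.
split=> [[p ltp [q ltq [Ip Fq]]]|[-> -> [p ltp [q ltq [Ip Fq pq]]]]].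
  rewrite rel_block ?shift_lt ?D_gt0 ?addn2 // => /and3P[/eqP Ef /eqP Eg pq].
  have Ef' : object_index (Start 'I_m) = object_index f by [].
  have Eg' : object_index (End 'I_m) = object_index g by [].
  by split; [exact/esym/object_index_inj | exact/esym/object_index_inj | exists p => //; exists q].
exists p => //; exists q => //; split=> //.
by rewrite rel_block ?shift_lt ?D_gt0 ?addn2 // !eqxx.
Qed.

Lemma recognizes_block_empty : ~ recognizes_block M o (empty_rel d).
Proof.
move=> [p ltp [q ltq [_ _]]]; rewrite rel_mkrel //; apply: row_lt; rewrite ?addn2 //;
  exact: shift_lt.
Qed.

Lemma recognizes_block_diag : ~ recognizes_block M o (diag d).
Proof.
move=> [p ltp [q ltq [_ _]]]; rewrite rel_diag; try by apply: row_lt; rewrite ?addn2 ?shift_lt.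
apply/negP; rewrite neq_ltn; apply/orP; left; rewrite mulSn [D + _]addnC -addnA ltn_add2l.
by rewrite ltn_addr // shift_lt.
Qed.

End OneAutomaton.

Lemma edge1 a p j : p < N -> j < D -> letter_edge a (0 + p) j <->
  exists2 r, r < N & j = 0 + r /\ (p, a, r) \in transitions M1.
Proof.
move=> ltp ltj; rewrite add0n /letter_edge ltp (leqNgt N p) ltp /= orbF; split.
  by case/andP=> ltj' H; exists j.
by case=> r ltr [-> H]; rewrite add0n ltr.
Qed.

Lemma edge2 a p j : p < N -> j < D -> letter_edge a (N + p) j <->
  exists2 r, r < N & j = N + r /\ (p, a, r) \in transitions M2.
Proof.
move=> ltp ltj; rewrite /letter_edge ltnNge leq_addr addKn /=; split.
  by case/andP=> lej H; exists (j - N); rewrite ?ltn_subLR ?subnKC.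
by case=> r ltr [-> H]; rewrite leq_addr addKn.
Qed.

Definition certified : Prop := exists Gs : {set 'I_m},
  [/\ forall a, letter_rel a \in Gs,
     forall s t, s \in Gs -> t \in Gs -> compose s t \in Gs &
     exists2 c, saturated (@compose d) (diag d)
                  (letter_ok (@compose D) (@block_rel D) Gs) c &
       conflict_free (recognizes_block M1 0) (recognizes_block M2 N) c].

Theorem certifiedE :
  separable (@Sigma2_language 'I_k) (nfa_language M1) (nfa_language M2) <->
  ~ (nfa_language M1 [::] /\ nfa_language M2 [::]) /\ certified.
Proof.
have E1 := recognizesE (leq0n N) init1_lt trans1_lt edge1.
have E2 := recognizesE (leqnn N) init2_lt trans2_lt edge2.
rewrite Sigma2_separableE /certified.
rewrite (@criterion _ _ _ _ _ (@compA D) (@comp1x D) (@compx1 D) letter_rel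
  (@block_rel D) _ _ (empty_rel d) (@compA d) (@comp1x d) (@compx1 d)
  (@compx0 d) (@block_rel_comp D D_gt0) (@block_rel_mismatch D D_gt0)
  (recognizes M1 0) (recognizes M2 N)).
- split=> -[nil [n [l H]]]; split=> //; exists n, l => w w' w0 w'0 g /E1 R1 /E2 R2;
    exact: (H w w').
- exact: recognizes_blockE (leq0n N).
- exact: recognizes_blockE (leqnn N).
- exact: recognizes_block_empty (leq0n N).
- exact: recognizes_block_empty (leqnn N).
- exact: recognizes_block_diag (leq0n N).
- exact: recognizes_block_diag (leqnn N).
Qed.

End Automata.

(** * The criterion in bounded arithmetic *)

Local Notation "# i" := (TVar i) (at level 8, format "# i").

Definition b_rel (d x i j : term) : bform := BBit x (TAdd (TMul i d) j).

(* Before each formula stand its free variables, from 0 on.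
   d x y z *)
Definition b_comp : bform :=
  BAll #0 (BAll #1 (BIff (b_rel #2 #5 #1 #0)
    (BEx #2 (BAnd (b_rel #3 #4 #2 #0) (b_rel #3 #5 #0 #1))))).

Arguments b_comp : simpl never.

(* d x *)
Definition b_diag : bform :=
  BAll #0 (BAll #1 (BIff (b_rel #2 #3 #1 #0) (BEq #1 #0))).

Section BoundedRelations.
Variable d : nat.

Lemma b_compE (x y z : 'I_(2 ^ (d * d))) :
  bholds b_comp [:: d; val x; val y; val z] <-> z = compose x y.
Proof.
split=> [H|-> i lti j ltj]; last exact: rel_comp.
by apply: rel_extP => i j lti ltj; rewrite rel_comp //; apply: H.
Qed.

Lemma b_diagE (x : 'I_(2 ^ (d * d))) : bholds b_diag [:: d; val x] <-> x = diag d.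
Proof.
split=> [H|-> i lti j ltj]; last first.
  by change (related d (diag d) i j <-> i = j); rewrite rel_diag //; split=> /eqP.
by apply: rel_extP => i j lti ltj; rewrite rel_diag //; split=> [/(H i lti j ltj)/eqP|/eqP/(H i lti j ltj)].
Qed.

End BoundedRelations.

Section NumberSets.
Variable n : nat.
Implicit Types (T : {set 'I_n}).

Definition num_of T : nat := mkbits n (fun i => [exists x in T, val x == i]).

Lemma num_of_lt T : num_of T < 2 ^ n.
Proof. exact: mkbits_lt. Qed.

Lemma bit_num_of T (x : 'I_n) : bit (num_of T) x = (x \in T).
Proof.
rewrite bit_mkbits ?ltn_ord //; apply/existsP/idP => [[y /andP[Ty /eqP/val_inj <-]] //|Tx].
by exists x; rewrite Tx eqxx.
Qed.

Lemma num_of_surj x : x < 2 ^ n -> exists T, x = num_of T.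
Proof.
move=> ltx; exists [set i : 'I_n | bit x i]; apply: (bit_ext ltx (num_of_lt _)) => i lti.
by rewrite (bit_num_of _ (Ordinal lti)) inE.
Qed.

End NumberSets.

(* M B *)
Definition b_empty : bform := BAll #0 (BNot (BBit #2 #0)).

(* M x T *)
Definition b_single : bform := BAll #0 (BIff (BBit #3 #0) (BEq #0 #2)).

(* M B1 B2 B *)
Definition b_union : bform := BAll #0 (BIff (BBit #4 #0) (BOr (BBit #2 #0) (BBit #3 #0))).

(* M E W *)
Definition b_sub : bform := BAll #0 (BImp (BBit #2 #0) (BBit #3 #0)).

(* d M T1 T2 T *)
Definition b_setop : bform :=
  BAll #1 (BIff (BBit #5 #0) (BEx #2 (BEx #3
    (BAnd (BBit #5 #1) (BAnd (BBit #6 #0) (BSub b_comp [:: #3; #1; #0; #2])))))).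

(* d M T1 T2 T *)
Definition b_step : bform :=
  BAll #1 (BAll #2 (BAll #3 (BImp (BBit #5 #2) (BImp (BBit #6 #1)
    (BImp (BSub b_comp [:: #3; #2; #1; #0]) (BBit #7 #0)))))).

Section BoundedSets.
Variable d : nat.
Local Notation M := (2 ^ (d * d)).
Implicit Types (B T E W : {set 'I_M}) (s : 'I_M).

Lemma b_emptyE B : bholds b_empty [:: M; num_of B] <-> B = set0.
Proof.
split=> [H|-> x ltx /=]; last by rewrite (bit_num_of _ (Ordinal ltx)) inE.
by apply/setP => x; have /negP/negbTE := H x (ltn_ord x); rewrite /= bit_num_of inE.
Qed.

Lemma b_singleE s T : bholds b_single [:: M; val s; num_of T] <-> T = [set s].
Proof.
split=> [H|-> x ltx /=].
  apply/setP => x; have := H x (ltn_ord x); rewrite /= bit_num_of inE => E.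
  by apply/idP/eqP => [/E/val_inj|Ex]; last by apply/E; rewrite Ex.
by rewrite (bit_num_of _ (Ordinal ltx)) inE -val_eqE; split=> [/eqP|/= ->].
Qed.

Lemma b_unionE B1 B2 B :
  bholds b_union [:: M; num_of B1; num_of B2; num_of B] <-> B = B1 :|: B2.
Proof.
split=> [H|-> x ltx /=].
  apply/setP => x; have := H x (ltn_ord x); rewrite /= !bit_num_of inE => E.
  by apply/idP/orP => /E.
by rewrite !(bit_num_of _ (Ordinal ltx)) inE; split=> /orP.
Qed.

Lemma b_subE E W : bholds b_sub [:: M; num_of E; num_of W] <-> E \subset W.
Proof.
split=> [H|/subsetP sub x ltx /=].
  by apply/subsetP => x; have := H x (ltn_ord x); rewrite /= !bit_num_of.
by rewrite !(bit_num_of _ (Ordinal ltx)); apply: sub.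
Qed.

Lemma b_setopE T1 T2 T :
  bholds b_setop [:: d; M; num_of T1; num_of T2; num_of T] <-> T = setop (@compose d) T1 T2.
Proof.
split=> [H|-> z ltz].
  apply/setP => z; have := H z (ltn_ord z).
  rewrite /= bit_num_of => E; apply/idP/imset2P.
    case/E=> x ltx [y lty [T1x [T2y /(b_compE (Ordinal ltx) (Ordinal lty) z) Ez]]].
    exists (Ordinal ltx) (Ordinal lty) => //; rewrite -bit_num_of //.
  case=> x y T1x T2y Ez; apply/E; exists x; rewrite ?ltn_ord //; exists y; rewrite ?ltn_ord //.
  by rewrite !bit_num_of; split=> //; split=> //; apply/b_compE.
rewrite /= (bit_num_of _ (Ordinal ltz)); split.
  case/imset2P=> x y T1x T2y Ez; exists x; rewrite ?ltn_ord //; exists y; rewrite ?ltn_ord //.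
  by rewrite !bit_num_of; split=> //; split=> //; apply/(b_compE x y (Ordinal ltz)).
case=> x ltx [y lty [T1x [T2y /(b_compE (Ordinal ltx) (Ordinal lty) (Ordinal ltz)) Ez]]].
by rewrite Ez; apply: mem_setop; rewrite -bit_num_of.
Qed.

Lemma b_stepE T1 T2 T : bholds b_step [:: d; M; num_of T1; num_of T2; num_of T] <->
  forall x y, x \in T1 -> y \in T2 -> compose x y \in T.
Proof.
split=> [H x y T1x T2y|H x ltx y lty z ltz].
  have [z Ez] : exists z, z = compose x y by exists (compose x y).
  rewrite -Ez; have := H x (ltn_ord x) y (ltn_ord y) z (ltn_ord z).
  by rewrite /= !bit_num_of; apply=> //; apply/b_compE.
rewrite /= (bit_num_of _ (Ordinal ltx)) (bit_num_of _ (Ordinal lty)).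
rewrite (bit_num_of _ (Ordinal ltz)) => T1x T2y.
by move/(b_compE (Ordinal ltx) (Ordinal lty) (Ordinal ltz)) ->; apply: H.
Qed.

Definition fact_index (B s T : nat) : nat := (B * M + s) * 2 ^ M + T.

Definition fact (c : nat) B s T : Prop := bit c (fact_index (num_of B) s (num_of T)).

(** The mask has the digit 1 at the mixed-radix indices of the triples in [P], and the index is
    injective. The conclusion is an equality, so that properties of [P] pass to [fact c] by
    rewriting. *)
Lemma fact_surj (P : {set 'I_M} -> 'I_M -> {set 'I_M} -> Prop) :
  exists2 c, c < 2 ^ (2 ^ M * M * 2 ^ M) & fact c = P.
Proof.
pose p i := `[< exists B s T, i = fact_index (num_of B) (val s) (num_of T) /\ P B s T >].
exists (mkbits (2 ^ M * M * 2 ^ M) p); first exact: mkbits_lt.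
apply/funext => B; apply/funext => s; apply/funext => T; apply/propext.
have num_inj (T1 T2 : {set 'I_M}) : num_of T1 = num_of T2 -> T1 = T2.
  by move=> E; apply/setP => x; rewrite -!bit_num_of E.
have flat_inj a b a' b' c : b < c -> b' < c -> a * c + b = a' * c + b' -> a = a' /\ b = b'.
  move=> lt lt' E; have c0 : 0 < c by apply: leq_ltn_trans lt.
  have := congr1 (divn ^~ c) E; rewrite !divnMDl // !divn_small // !addn0 => Ea.
  by split=> //; move: E; rewrite Ea => /addnI.
have flat_lt a b c e : a < e -> b < c -> a * c + b < e * c.
  move=> lta ltb; apply: (@leq_trans (a.+1 * c)); last by rewrite leq_mul2r lta orbT.
  by rewrite mulSn addnC ltn_add2r.
rewrite /fact bit_mkbits; last by rewrite !flat_lt ?num_of_lt.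
split=> [/asboolP[B' [s' [T' [E HP]]]]|HP]; last by apply/asboolP; exists B, s, T.
have [E1 E2] := flat_inj _ _ _ _ _ (num_of_lt T) (num_of_lt T') E.
have [E3 E4] := flat_inj _ _ _ _ _ (ltn_ord s) (ltn_ord s') E1.
by rewrite (num_inj _ _ E2) (num_inj _ _ E3) (val_inj E4).
Qed.

End BoundedSets.

Definition b_fact (M X c B s T : term) : bform :=
  BBit c (TAdd (TMul (TAdd (TMul B M) s) X) T).

(* d M X c *)
Definition b_one : bform :=
  BAll #2 (BAll #2 (BAll #4
    (BImp (BSub b_empty [:: #4; #2]) (BImp (BSub b_diag [:: #3; #1])
      (BImp (BSub b_single [:: #4; #1; #0]) (b_fact #4 #5 #6 #2 #1 #0)))))).

(* d M X c *)
Definition b_op : bform :=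
  BAll #2 (BAll #2 (BAll #4 (BAll #5 (BAll #5 (BAll #7 (BAll #8 (BAll #8 (BAll #10
    (BImp (b_fact #10 #11 #12 #8 #7 #6) (BImp (b_fact #10 #11 #12 #5 #4 #3)
    (BImp (BSub b_union [:: #10; #8; #5; #2]) (BImp (BSub b_comp [:: #9; #7; #4; #1])
    (BImp (BSub b_setop [:: #9; #10; #6; #3; #0])
      (b_fact #10 #11 #12 #2 #1 #0)))))))))))))).

(* d M X c *)
Definition b_idem : bform :=
  BAll #2 (BAll #2 (BAll #4 (BImp (b_fact #4 #5 #6 #2 #1 #0)
    (BImp (BSub b_comp [:: #3; #1; #1; #1])
    (BImp (BSub b_setop [:: #3; #4; #0; #0; #0])
    (BEx #5 (BEx #6 (BAnd (BSub b_sub [:: #6; #2; #0])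
      (BAnd (BSub b_step [:: #5; #6; #0; #4; #0])
      (BAnd (BSub b_step [:: #5; #6; #0; #2; #1])
        (b_fact #6 #7 #8 #4 #3 #1))))))))))).

Section BoundedRules.
Variables (d c : nat).
Local Notation M := (2 ^ (d * d)).
Local Notation X := (2 ^ M).
Implicit Types (B T E : {set 'I_M}) (s : 'I_M).

Lemma b_oneE : bholds b_one [:: d; M; X; c] <->
  fact c set0 (diag d) [set diag d].
Proof.
split=> [H|H _ /num_of_surj[B ->] s lts _ /num_of_surj[T ->]].
  have := H _ (num_of_lt set0) (diag d) (ltn_ord _) _ (num_of_lt [set diag d]).
  by apply; [exact/b_emptyE | exact/b_diagE | exact/b_singleE].
move/b_emptyE-> => /(b_diagE (Ordinal lts)) Es.
by move/(b_singleE (Ordinal lts))->; move: H; rewrite -Es.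
Qed.

Lemma b_opE : bholds b_op [:: d; M; X; c] <->
  forall B1 s1 T1 B2 s2 T2, fact c B1 s1 T1 -> fact c B2 s2 T2 ->
    fact c (B1 :|: B2) (compose s1 s2) (setop (@compose d) T1 T2).
Proof.
split=> [H B1 s1 T1 B2 s2 T2 f1 f2|H].
  have := H _ (num_of_lt B1) s1 (ltn_ord _) _ (num_of_lt T1)
    _ (num_of_lt B2) s2 (ltn_ord _) _ (num_of_lt T2) _ (num_of_lt (B1 :|: B2))
    (compose s1 s2) (ltn_ord _) _ (num_of_lt (setop (@compose d) T1 T2)).
  by apply=> //; [exact/b_unionE | exact/b_compE | exact/b_setopE].
move=> _ /num_of_surj[B1 ->] s1 lts1 _ /num_of_surj[T1 ->].
move=> _ /num_of_surj[B2 ->] s2 lts2 _ /num_of_surj[T2 ->].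
move=> _ /num_of_surj[B ->] s lts _ /num_of_surj[T ->] f1 f2.
move=> /b_unionE -> /(b_compE (Ordinal lts1) (Ordinal lts2) (Ordinal lts)) Es /b_setopE ->.
have := H B1 (Ordinal lts1) T1 B2 (Ordinal lts2) T2 f1 f2.
by rewrite -Es.
Qed.

Lemma b_idemE : bholds b_idem [:: d; M; X; c] <->
  forall B e E, fact c B e E -> compose e e = e -> setop (@compose d) E E = E ->
    exists T W : {set 'I_M}, [/\ E \subset W,
      forall x a, x \in W -> a \in B -> compose x a \in W,
      forall x y, x \in W -> y \in E -> compose x y \in T & fact c B e T].
Proof.
split=> [H B e E f ee EE|H].
  have := H _ (num_of_lt B) e (ltn_ord _) _ (num_of_lt E) f.
  case; [exact/b_compE | exact/b_setopE |].
  move=> _ /num_of_surj[T ->] [_ /num_of_surj[W ->] [/b_subE EW [/b_stepE WB [/b_stepE WE fT]]]].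
  by exists T, W.
move=> _ /num_of_surj[B ->] e lte _ /num_of_surj[E ->] f.
move=> /(b_compE (Ordinal lte) (Ordinal lte) (Ordinal lte)) ee /b_setopE EE.
have [T [W [EW WB WE fT]]] := H B (Ordinal lte) E f (esym ee) (esym EE).
exists (num_of T); first exact: num_of_lt.
exists (num_of W); first exact: num_of_lt.
by split; [exact/b_subE | split; [exact/b_stepE | split; [exact/b_stepE |]]].
Qed.

End BoundedRules.

(** * Reading automata *)

(** The code of [v :: s] is [2 ^ v] times the odd number [2 c + 1], where [c] is the code of [s]. *)
Definition t_cons (v t : term) : term := TMul (TExp2 v) (TSucc (TAdd t t)).
Definition t_code3 (a b c : term) : term := t_cons a (t_cons b (t_cons c TZero)).

Lemma t_consE v t s e : term_value t e = CodeSeq.code s ->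
  term_value (t_cons v t) e = CodeSeq.code (term_value v e :: s).
Proof. by move=> /= ->; rewrite addnn. Qed.

Lemma t_code3E a b c e :
  term_value (t_code3 a b c) e = CodeSeq.code [:: term_value a e; term_value b e; term_value c e].
Proof. by do 3!apply: t_consE. Qed.

(* c x *)
Definition b_mem : bform :=
  BEx #0 (BAnd (BBit #1 (TAdd #0 #2)) (BAnd
    (BAll #2 (BNot (BBit #2 (TAdd #1 #0))))
    (BOr (BEq #0 TZero)
      (BEx #0 (BAnd (BEq #1 (TSucc #0)) (BBit #2 #0)))))).

Arguments b_mem : simpl never.
Arguments t_code3 : simpl never.

Lemma b_memE s x : bholds b_mem [:: CodeSeq.code s; x] <-> x \in s.
Proof.
rewrite mem_code /b_mem; move: (CodeSeq.code s) => c.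
split=> -[j ltj H]; exists j => //; first by case: H => H1 [H2 H3].
by case: H => H1 H2 H3.
Qed.

(* [f] sees the codes of the initial states, of the final states and of the
   transitions of the automaton 0 as its variables 2, 1, 0. *)
Definition b_parts (f : bform) : bform :=
  BEx #0 (BEx #1 (BEx #2 (BAnd (BEq #3 (t_code3 #2 #1 #0)) f))).

(* e p *)
Definition b_init : bform := b_parts (BSub b_mem [:: #2; #4]).

(* e p *)
Definition b_final : bform := b_parts (BSub b_mem [:: #1; #4]).

(* e p a q *)
Definition b_trans : bform := b_parts (BSub b_mem [:: #0; t_code3 #4 #5 #6]).

Arguments b_init : simpl never.
Arguments b_final : simpl never.
Arguments b_trans : simpl never.

Section ReadAutomaton.
Variables (k : nat) (M : nfa 'I_k).

Let parts := [:: CodeSeq.code (initials M); CodeSeq.code (finals M);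
                 CodeSeq.code (map (@encode_transition k) (transitions M))].

(** The entries of a coded list are below its code, so the bounded quantifiers reach the three
    components; they are determined because the code is injective. *)
Lemma b_partsE f env : bholds (b_parts f) (encode_nfa M :: env) <->
  bholds f (nth 0 parts 2 :: nth 0 parts 1 :: nth 0 parts 0 :: encode_nfa M :: env).
Proof.
have /and4P[lt0 lt1 lt2 _] := CodeSeq.ltn_code parts.
split=> [[a lta [b ltb [c ltc [E Hf]]]]|Hf]; last first.
  exists (nth 0 parts 0); first exact: lt0.
  exists (nth 0 parts 1); first exact: lt1.
  exists (nth 0 parts 2); first exact: lt2.
  split; last exact: Hf.
  have E := t_code3E #2 #1 #0
    (nth 0 parts 2 :: nth 0 parts 1 :: nth 0 parts 0 :: encode_nfa M :: env).
  exact: esym E.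
have E' : CodeSeq.code parts = CodeSeq.code [:: a; b; c].
  exact: etrans E (t_code3E #2 #1 #0 _).
have [Ea Eb Ec] := can_inj CodeSeq.codeK E'.
by rewrite /= Ea Eb Ec.
Qed.

Lemma b_initE p : bholds b_init [:: encode_nfa M; p] <-> p \in initials M.
Proof. by rewrite -b_memE; exact: b_partsE. Qed.

Lemma b_finalE p : bholds b_final [:: encode_nfa M; p] <-> p \in finals M.
Proof. by rewrite -b_memE; exact: b_partsE. Qed.

Lemma b_transE p (a : 'I_k) q :
  bholds b_trans [:: encode_nfa M; p; val a; q] <-> (p, a, q) \in transitions M.
Proof.
have -> : ((p, a, q) \in transitions M) =
    (CodeSeq.code [:: p; val a; q] \in map (@encode_transition k) (transitions M)).
  apply/idP/mapP => [tin|[[[p' a'] q'] tin]]; first by exists (p, a, q).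
  by move/(can_inj CodeSeq.codeK) => /= -[-> /val_inj -> ->].
rewrite -b_memE; apply: iff_trans (b_partsE _ _) _; set env := nth 0 parts 2 :: _.
rewrite -[bholds (BSub _ _) env]/(bholds b_mem [:: term_value #0 env;
  term_value (t_code3 #4 #5 #6) env]).
by rewrite t_code3E.
Qed.

(** States that matter are below the code of their automaton, hence the sum of the two codes can
    serve as the common bound [N]. *)
Lemma init_lt_code p : p \in initials M -> p < encode_nfa M.
Proof.
move=> Ip; have /and4P[lt0 _ _ _] := CodeSeq.ltn_code parts.
by apply: leq_ltn_trans lt0; apply/ltnW/(allP (CodeSeq.ltn_code (initials M))).
Qed.

Lemma trans_lt_code t : t \in transitions M ->
  t.1.1 < encode_nfa M /\ t.2 < encode_nfa M.
Proof.
move=> tin; have /and4P[_ _ lt2 _] := CodeSeq.ltn_code parts.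
have ltt : encode_transition t < encode_nfa M.
  apply: leq_ltn_trans lt2; apply/ltnW/(allP (CodeSeq.ltn_code _)).
  exact: map_f.
have /and4P[ltp _ ltq _] := CodeSeq.ltn_code [:: t.1.1; val t.1.2; t.2].
by split; [apply: ltn_trans ltp ltt | apply: ltn_trans ltq ltt].
Qed.

End ReadAutomaton.

(** * The decision procedure *)

Definition b_lt (t u : term) : bform := BLe (TSucc t) u.

(* e1 e2 N D a x *)
Definition b_letter : bform :=
  BAll #3 (BAll #4 (BIff (b_rel #5 #7 #1 #0)
    (BOr (BAnd (b_lt #1 #4) (BAnd (b_lt #0 #4) (BSub b_trans [:: #2; #1; #6; #0])))
      (BEx #4 (BEx #5 (BAnd (BEq #3 (TAdd #6 #1)) (BAnd (BEq #2 (TAdd #6 #0))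
        (BSub b_trans [:: #5; #1; #8; #0])))))))).

(* D d c f s h *)
Definition b_block : bform :=
  BAll #1 (BAll #2 (BIff (b_rel #3 #4 #1 #0)
    (BEx #2 (BEx #3 (BAnd (BEq #3 (TAdd (TMul #7 #4) #1))
      (BAnd (BEq #2 (TAdd (TMul #9 #4) #0)) (b_rel #4 #8 #1 #0))))))).

Arguments b_block : simpl never.

(* D m d g c *)
Definition b_ok : bform :=
  BEx (TSucc (TSucc #1)) (BEx #2 (BEx (TSucc (TSucc #3))
    (BAnd (BSub b_block [:: #3; #5; #7; #2; #1; #0]) (BAnd (BBit #6 #1) (BAnd
      (BOr (BEq #2 #4) (BAnd (b_lt #2 #4) (BAnd (BBit #6 #2)
        (BSub b_comp [:: #3; #2; #2; #2]))))
      (BOr (BEq #0 (TSucc #4)) (BAnd (b_lt #0 #4) (BAnd (BBit #6 #0)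
        (BAnd (BSub b_comp [:: #3; #0; #0; #0])
              (BSub b_comp [:: #3; #1; #0; #1])))))))))).

(* e N o D m d c *)
Definition b_accept : bform :=
  BEx #1 (BEx #2 (BAnd (BSub b_init [:: #2; #1]) (BAnd (BSub b_final [:: #2; #0])
    (b_rel #7 #8 (TAdd (TMul #6 #5) (TAdd #4 #1))
       (TAdd (TMul (TSucc #6) #5) (TAdd #4 #0)))))).

(* D m d M X g c *)
Definition b_let : bform :=
  BAll #3 (BAll #5 (BImp (BSub b_ok [:: #2; #3; #4; #7; #1])
    (BImp (BSub b_single [:: #5; #1; #0]) (b_fact #5 #6 #8 #0 #1 #0)))).

(* e1 e2 N D m d M X c *)
Definition b_free : bform :=
  BAll #7 (BAll #7 (BAll #9 (BAll #9
    (BImp (b_fact #10 #11 #12 #3 #2 #1)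
    (BImp (BSub b_accept [:: #4; #6; TZero; #7; #8; #9; #2])
    (BImp (BBit #1 #0)
      (BNot (BSub b_accept [:: #5; #6; #6; #7; #8; #9; #0])))))))).

(* k e1 e2 N D m g *)
Definition b_gen : bform :=
  BAnd (BAll #0 (BAll #6 (BImp (BSub b_letter [:: #3; #4; #5; #6; #1; #0]) (BBit #8 #0))))
       (BSub b_step [:: #4; #5; #6; #6; #6]).

(* e *)
Definition b_eps : bform :=
  BEx #0 (BAnd (BSub b_init [:: #1; #0]) (BSub b_final [:: #1; #0])).

(* k e1 e2 N D m d M X *)
Definition b_certificate : bform :=
  BAnd (BNot (BAnd (BSub b_eps [:: #1]) (BSub b_eps [:: #2])))
    (BEx (TExp2 #5) (BEx (TExp2 (TMul (TMul #9 #8) #9))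
      (BAnd (BSub b_gen [:: #2; #3; #4; #5; #6; #7; #1])
      (BAnd (BSub b_one [:: #8; #9; #10; #0])
      (BAnd (BSub b_let [:: #6; #7; #8; #9; #10; #1; #0])
      (BAnd (BSub b_op [:: #8; #9; #10; #0])
      (BAnd (BSub b_idem [:: #8; #9; #10; #0])
            (BSub b_free [:: #3; #4; #5; #6; #7; #8; #9; #10; #0])))))))).

(* k e1 e2 *)
Definition b_separable : bform :=
  let N := TAdd #1 #2 in
  let D := TAdd N N in
  let m := TExp2 (TMul D D) in
  let d := TMul (TAdd m (TSucc (TSucc TZero))) D in
  let M := TExp2 (TMul d d) in
  BSub b_certificate [:: #0; #1; #2; N; D; m; d; M; TExp2 M].

Arguments b_letter : simpl never.
Arguments b_ok : simpl never.
Arguments b_accept : simpl never.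
Arguments b_let : simpl never.
Arguments b_free : simpl never.
Arguments b_gen : simpl never.
Arguments b_eps : simpl never.
Arguments b_one : simpl never.
Arguments b_op : simpl never.
Arguments b_idem : simpl never.
Arguments b_step : simpl never.
Arguments b_single : simpl never.

Section Procedure.
Variables (k : nat) (M1 M2 : nfa 'I_k).
Local Notation e1 := (encode_nfa M1).
Local Notation e2 := (encode_nfa M2).
Let N := e1 + e2.
Local Notation D := (N + N).
Local Notation m := (2 ^ (D * D)).
Local Notation d := ((m + 2) * D).
Local Notation M := (2 ^ (d * d)).

Lemma b_letterE (a : 'I_k) (x : 'I_m) :
  bholds b_letter [:: e1; e2; N; D; val a; val x] <-> x = letter_rel M1 M2 N a.
Proof.
have E i j : i < D -> j < D -> letter_edge M1 M2 N a i j <->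
    (i < N /\ (j < N /\ bholds b_trans [:: e1; i; val a; j])) \/
    (exists2 p, p < N & exists2 q, q < N &
       i = N + p /\ (j = N + q /\ bholds b_trans [:: e2; p; val a; q])).
  move=> lti ltj; rewrite /letter_edge; split.
    case/orP=> /and3P[H1 H2 H3]; [left | right].
      by split=> //; split=> //; apply/b_transE.
    exists (i - N); first by rewrite ltn_subLR.
    exists (j - N); first by rewrite ltn_subLR.
    by rewrite !subnKC //; split=> //; split=> //; apply/b_transE.
  case=> [[H1 [H2 /b_transE H3]]|[p ltp [q ltq [-> [-> /b_transE H3]]]]].
    by rewrite H1 H2 H3.
  by rewrite !leq_addr !addKn H3 orbT.
split=> [H|-> i lti j ltj].
  apply: rel_extP => i j lti ltj; rewrite rel_mkrel // E //.
  exact: H i lti j ltj.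
by apply: iff_trans (E i j lti ltj); rewrite -(rel_mkrel (letter_edge M1 M2 N a) lti ltj).
Qed.

Lemma N_pos : 0 < N.
Proof. by rewrite addn_gt0 /encode_nfa /= muln_gt0 expn_gt0. Qed.

Lemma D_pos : 0 < D.
Proof. by rewrite addn_gt0 N_pos. Qed.

Lemma b_blockE (c : 'I_M) f (s : 'I_m) h :
  bholds b_block [:: D; d; val c; object_index f; val s; object_index h] <->
  c = block_rel f s h.
Proof.
have E i j : i < d -> j < d -> related d (block_rel f s h) i j <->
    exists2 p, p < D & exists2 q, q < D & i = object_index f * D + p /\
      (j = object_index h * D + q /\ related D s p q).
  move=> lti ltj; have [x [p [ltx ltp Ei]]] := row_decomp D_pos lti.
  have [y [q [lty ltq Ej]]] := row_decomp D_pos ltj.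
  rewrite Ei Ej rel_block ?D_pos //; split.
    by case/and3P=> /eqP-> /eqP-> spq; exists p => //; exists q.
  case=> p' ltp' [q' ltq' [Ep [Eq spq]]].
  have flat a b a' b' : b < D -> b' < D -> a * D + b = a' * D + b' -> a = a' /\ b = b'.
    move=> lt lt' Eab; have := congr1 (divn ^~ D) Eab.
    rewrite !divnMDl ?D_pos // !divn_small // !addn0 => Ea.
    by split=> //; move: Eab; rewrite Ea => /addnI.
  have [-> ->] := flat _ _ _ _ ltp ltp' Ep; have [-> ->] := flat _ _ _ _ ltq ltq' Eq.
  by rewrite !eqxx.
split=> [H|-> i lti j ltj]; last exact: E.
by apply: rel_extP => i j lti ltj; rewrite E //; apply: H.
Qed.

Lemma object_of_index i : i < m.+2 -> exists f : object 'I_m, i = object_index f.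
Proof.
rewrite ltnS leq_eqVlt => /orP[/eqP->|]; first by exists (End _).
rewrite ltnS leq_eqVlt => /orP[/eqP->|lti]; first by exists (Start _).
by exists (Loop (Ordinal lti)).
Qed.

Lemma b_okE (Gs : {set 'I_m}) (c : 'I_M) :
  bholds b_ok [:: D; m; d; num_of Gs; val c] <->
  letter_ok (@compose D) (@block_rel D) Gs c.
Proof.
have ltn_m (e : 'I_m) : e < m by apply: ltn_ord.
have startP (f : object 'I_m) : (object_index f = m \/ (object_index f < m /\
      (bit (num_of Gs) (object_index f) /\ bholds b_comp [:: D; object_index f; object_index f; object_index f])))
    <-> (f = Start _ \/ (exists2 e, e \in Gs & compose e e = e /\ f = Loop e)).
  split; last first.
    case=> [->|[e eG [ee ->]]]; [by left | right; split; first exact: ltn_m].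
    by rewrite bit_num_of; split=> //; apply/b_compE.
  case=> [/(@object_index_inj D f (Start _))->|]; first by left.
  case: f => [||e] /= [ltf]; first by rewrite ltnn in ltf.
    by rewrite ltnNge leqnSn in ltf.
  by rewrite bit_num_of => -[eG /b_compE ee]; right; exists e.
have endP (f : object 'I_m) (s : 'I_m) : (object_index f = m.+1 \/ (object_index f < m /\
      (bit (num_of Gs) (object_index f) /\ (bholds b_comp [:: D; object_index f; object_index f; object_index f] /\
       bholds b_comp [:: D; val s; object_index f; val s]))))
    <-> (f = End _ \/ (exists2 e, e \in Gs & [/\ compose e e = e, f = Loop e & compose s e = s])).
  split; last first.
    case=> [->|[e eG [ee -> se]]]; [by left | right; split; first exact: ltn_m].
    by rewrite bit_num_of; split=> //; split; apply/b_compE.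
  case=> [/(@object_index_inj D f (End _))->|]; first by left.
  case: f => [||e] /= [ltf]; first by rewrite ltnn in ltf.
    by rewrite ltnNge leqnSn in ltf.
  by rewrite bit_num_of => -[eG [/b_compE ee /b_compE se]]; right; exists e.
split.
  case=> _ /object_of_index[f ->] [s lts [_ /object_of_index[h ->]]].
  case=> Hb [Gs_s [/startP Hf /(endP h (Ordinal lts)) Hh]].
  exists f, (Ordinal lts), h; split=> //; first exact/(b_blockE c f (Ordinal lts)).
  by rewrite -bit_num_of.
case=> f [s [h [Ec Gs_s Hf Hh]]].
have ltf (g : object 'I_m) : object_index g < m.+2 by rewrite -addn2 object_index_lt.
exists (object_index f); first exact: ltf.
exists (val s); first exact: ltn_m.
exists (object_index h); first exact: ltf.
split; first exact/(b_blockE c f s).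
split; first by rewrite /= bit_num_of.
by split; [exact/startP | exact/(endP h s)].
Qed.

Lemma b_acceptE (M' : nfa 'I_k) o (c : 'I_M) :
  bholds b_accept [:: encode_nfa M'; N; o; D; m; d; val c] <->
  recognizes_block M' o c.
Proof.
split=> [[p ltp [q ltq [/b_initE Ip [/b_finalE Fq H]]]]|[p ltp [q ltq [Ip Fq H]]]].
  by exists p => //; exists q.
exists p => //; exists q => //; split; first exact/b_initE.
by split; first exact/b_finalE.
Qed.

Lemma b_epsE (M' : nfa 'I_k) :
  bholds b_eps [:: encode_nfa M'] <-> nfa_language M' [::].
Proof.
split=> [[p ltp [/b_initE Ip /b_finalE Fp]]|/hasP[p Ip Fp]].
  by apply/hasP; exists p.
by exists p; [apply: init_lt_code | split; [exact/b_initE | exact/b_finalE]].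
Qed.

Lemma b_genE (Gs : {set 'I_m}) :
  bholds b_gen [:: k; e1; e2; N; D; m; num_of Gs] <->
  (forall a, letter_rel M1 M2 N a \in Gs) /\
  (forall s t, s \in Gs -> t \in Gs -> compose s t \in Gs).
Proof.
split=> -[H1 H2]; split.
- move=> a; have [x Ex] : exists x, x = letter_rel M1 M2 N a by exists (letter_rel M1 M2 N a).
  rewrite -Ex -bit_num_of; apply: (H1 a (ltn_ord a) x (ltn_ord x)).
  exact/b_letterE.
- exact/b_stepE.
- move=> a lta x ltx /(b_letterE (Ordinal lta) (Ordinal ltx)) Ex.
  by have := H1 (Ordinal lta); rewrite -Ex -bit_num_of.
- exact/(b_stepE Gs Gs Gs).
Qed.

Lemma b_letE (Gs : {set 'I_m}) c :
  bholds b_let [:: D; m; d; M; 2 ^ M; num_of Gs; c] <->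
  forall a : 'I_M, letter_ok (@compose D) (@block_rel D) Gs a -> fact c [set a] a [set a].
Proof.
split=> [H a ok_a|H a lta _ /num_of_surj[B ->]].
  have := H a (ltn_ord a) _ (num_of_lt [set a]).
  by apply; [exact/b_okE | exact/b_singleE].
move=> /(b_okE Gs (Ordinal lta)) /H f /(b_singleE (Ordinal lta)) ->.
exact: f.
Qed.

Lemma b_freeE c :
  bholds b_free [:: e1; e2; N; D; m; d; M; 2 ^ M; c] <->
  conflict_free (@recognizes_block k N M1 0) (@recognizes_block k N M2 N) (fact c).
Proof.
split=> [H B s T t f H1 Tt /b_acceptE H2|H _ /num_of_surj[B ->] s lts _ /num_of_surj[T ->] t ltt].
  apply: (H _ (num_of_lt B) s (ltn_ord s) _ (num_of_lt T) t (ltn_ord t) f) H2.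
    exact/b_acceptE.
  by rewrite /= bit_num_of.
move=> f /(b_acceptE M1 0 (Ordinal lts)) H1 Tt /(b_acceptE M2 N (Ordinal ltt)).
by apply: (H B (Ordinal lts) T (Ordinal ltt)) => //; rewrite -bit_num_of.
Qed.

Theorem b_separableE : bholds b_separable [:: k; e1; e2] <->
  separable (@Sigma2_language 'I_k) (nfa_language M1) (nfa_language M2).
Proof.
have init1 p : p \in initials M1 -> p < N.
  by move/init_lt_code => lt; apply: leq_trans lt (leq_addr _ _).
have init2 p : p \in initials M2 -> p < N.
  by move/init_lt_code => lt; apply: leq_trans lt (leq_addl _ _).
have trans1 t : t \in transitions M1 -> t.1.1 < N /\ t.2 < N.
  by move/trans_lt_code => [lt lt']; split; apply: leq_trans (leq_addr _ _).
have trans2 t : t \in transitions M2 -> t.1.1 < N /\ t.2 < N.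
  by move/trans_lt_code => [lt lt']; split; apply: leq_trans (leq_addl _ _).
rewrite (certifiedE N_pos init1 init2 trans1 trans2).
have -> : bholds b_separable [:: k; e1; e2] <->
    bholds b_certificate [:: k; e1; e2; N; D; m; d; M; 2 ^ M].
  by [].
split=> [[nil [_ /num_of_surj[Gs ->] [c ltc]]]|[nil [Gs [Ga Gm [c0 c_sat c_free]]]]].
  case=> [/b_genE[Ga Gm] [/b_oneE c1 [/b_letE c2 [/b_opE c3 [/b_idemE c4 /b_freeE c5]]]]].
  split; first by case=> /b_epsE H1 /b_epsE H2; apply: nil.
  by exists Gs; split=> //; exists (fact c).
split; first by case=> /b_epsE H1 /b_epsE H2; apply: nil.
have [c ltc Ec] := fact_surj c0; rewrite -Ec in c_sat c_free.
have [c1 c2 c3 c4] := c_sat.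
exists (num_of Gs); first exact: num_of_lt.
exists c => //; split; first exact/b_genE.
split; first exact/b_oneE.
split; first exact/b_letE.
split; first exact/b_opE.
by split; [exact/b_idemE | exact/b_freeE].
Qed.

End Procedure.

Theorem corollary12p4 :
  algorithmically_decidable encode_input
    (fun x : separation_input =>
       separable (@Sigma2_language 'I_(alphabet_size x))
         (nfa_language (automaton1 x)) (nfa_language (automaton2 x)))
  /\
  algorithmically_decidable encode_input
    (fun x : separation_input =>
       separable (@Pi2_language 'I_(alphabet_size x))
         (nfa_language (automaton1 x)) (nfa_language (automaton2 x))).
Proof.
split.
  apply: (@bform_decidable _ _ 3 _ b_separable) => // -[k M1 M2].
  by rewrite b_separableE.
(* The same formula with the two automata exchanged. *)
apply: (@bform_decidable _ _ 3 _ (BSub b_separable [:: #0; #2; #1])) => // -[k M1 M2].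
by rewrite Pi2_separableE -b_separableE.
Qed.
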